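(* Let $(\phi_{1,n})$ and $(\phi_{2,n})$ be sequences of holomorphic self-maps of $\mathbb{D}$ such that for some $a,b\in\mathbb{T}$, $\phi_{1,n}(0)\to a$ and $\phi_{2,n}(0)\to b$. Consider the following statements. (1) $(C_{\phi_{1,n}})_n,(C_{\phi_{2,n}})_n$ are disjointly universal on $\mathcal{B}$. (2) There is a subsequence $(n_k)$ such that $\phi_{1,n_k}^\#(0)\to 1$, $\phi_{2,n_k}^\#(0)\to 1$, and $\rho(\phi_{1,n_k}(0),\phi_{2,n_k}(0))\to 1$. (3) There is a subsequence $(n_k)$ such that $\phi_{1,n_k}^\#(0)\to 1$, $\phi_{2,n_k}^\#(0)\to 1$, and such that for each compact $K\subset\mathbb{D}$ there is $k_0\in\mathbb{N}$ with $\phi_{1,n_k}(K)\cap\phi_{2,n_k}(K)=\emptyset$ for all $k\ge k_0$. (4) There is a subsequence $(n_k)$ such that for each compact $K\subset\mathbb{D}$ there is $k_0\in\mathbb{N}$ such that, for all $k\ge k_0$, $\phi_{1,n_k}|_K$ and $\phi_{2,n_k}|_K$ are univalent and $\phi_{1,n_k}(K)\cap\phi_{2,n_k}(K)=\emptyset$. (5) $(C_{\phi_{1,n}})_n,(C_{\phi_{2,n}})_n$ are disjointly universal on $H(\mathbb{D})$. Then $(1)\Leftrightarrow(2)\Leftrightarrow(3)\Rightarrow(4)\Leftrightarrow(5)$, and $(4)\nRightarrow(3)$ in general (that is, there exist sequences $(\phi_{1,n})$, $(\phi_{2,n})$ of holomorphic self-maps of $\mathbb{D}$ with $\phi_{1,n}(0)\to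 a$ and $\phi_{2,n}(0)\to b$ for some $a,b\in\mathbb{T}$, for which (4) holds and (3) fails).
   Context: $\mathbb{D}=\{z\in\mathbb{C}:|z|<1\}$ and $\mathbb{T}=\{z\in\mathbb{C}:|z|=1\}$. $H(\mathbb{D})$ is the space of holomorphic functions on $\mathbb{D}$ and $\mathcal{B}=\{f\in H(\mathbb{D}):\sup_{z\in\mathbb{D}}|f(z)|\le 1\}$; both carry the topology of uniform convergence on compact subsets of $\mathbb{D}$. For $\phi:\mathbb{D}\to\mathbb{D}$ holomorphic, $C_\phi(f)=f\circ\phi$ is the composition operator; it maps $H(\mathbb{D})$ into itself and $\mathcal{B}$ into itself. For $X=\mathcal{B}$ or $X=H(\mathbb{D})$, $(C_{\phi_{1,n}})_n,(C_{\phi_{2,n}})_n$ are disjointly universal on $X$ if there is $f\in X$ such that $\{(f\circ\phi_{1,n},f\circ\phi_{2,n}):n\in\mathbb{N}\}$ is dense in $X\times X$ with the product topology. For $f:\mathbb{D}\to\mathbb{D}$ holomorphic, its hyperbolic derivative at $0$ is $f^\#(0)=\frac{|f'(0)|}{1-|f(0)|^2}$. For $z,w\in\mathbb{D}$ the pseudo-hyperbolic distance is $\rho(z,w)=\left|\frac{z-w}{1-\overline{z}w}\right|$. Univalent means injective. *)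

(* Defs.v *)
From HB Require Import structures.
From mathcomp Require Import all_boot all_order all_algebra.
From mathcomp Require Import all_classical all_reals all_analysis.
From mathcomp Require Import complex.

Set Implicit Arguments.
Unset Strict Implicit.
Unset Printing Implicit Defensive.

Import Order.TTheory GRing.Theory Num.Theory.
Import numFieldNormedType.Exports.

Local Open Scope classical_set_scope.
Local Open Scope ring_scope.

(* Real quantities such as `|z| live in R[i], where z <= w means that w - z is
   real and nonnegative. *)
HB.instance Definition _ (R : rcfType) := NormedModule.copy R[i] R[i]^o.

(* Functions on the disc are represented by total functions R[i] -> R[i]; none
   of the definitions below depends on the values taken outside of unit_disc. *)
Definition unit_disc (R : realType) : set R[i] := [set z | `|z| < 1].

Definition unit_circle (R : realType) : set R[i] := [set z | `|z| = 1].

(* R[i] is a normed module over itself, so derivable is complex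
   differentiability. *)
Definition holomorphic_disc (R : realType) (f : R[i] -> R[i]) : Prop :=
  forall z, unit_disc z -> derivable f z 1.

Definition holo_selfmap (R : realType) (phi : R[i] -> R[i]) : Prop :=
  holomorphic_disc phi /\ (forall z, unit_disc z -> unit_disc (phi z)).

Definition disc_compacts (R : realType) : set (set R[i]) :=
  [set K | compact K /\ K `<=` @unit_disc R].

(* Topology of uniform convergence on the compact subsets of the disc; the
   spaces below carry the topology induced from it. *)
Definition disc_fun (R : realType) : topologicalType :=
  {family @disc_compacts R, R[i] -> R[i]}.

Definition HD (R : realType) : set (disc_fun R) :=
  [set f | holomorphic_disc f].

Definition BD (R : realType) : set (disc_fun R) :=
  [set f | holomorphic_disc f /\ (forall z, unit_disc z -> `|f z| <= 1)].

Definition comp_op (R : realType) (phi : R[i] -> R[i]) (f : disc_fun R) :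
  disc_fun R := f \o phi.

(* For operators mapping X into itself, as comp_op (phi n) does for X = HD or
   X = BD, the orbit lies in X `*` X, so the inclusion says that it is dense in
   X `*` X for the topology induced by the product topology. *)
Definition disjointly_universal (R : realType) (X : set (disc_fun R))
    (T1 T2 : nat -> disc_fun R -> disc_fun R) : Prop :=
  exists2 f, X f &
    X `*` X `<=` closure (range (fun n => (T1 n f, T2 n f))).

Definition hyp_deriv0 (R : realType) (f : R[i] -> R[i]) : R[i] :=
  `|derive1 f 0| / (1 - `|f 0| ^+ 2).

Definition pseudo_hyp (R : realType) (z w : R[i]) : R[i] :=
  `|(z - w) / (1 - z^* * w)|.

Definition subsequence (s : nat -> nat) : Prop := {homo s : i j / (i < j)%N}.

Definition disj_universal_BD (R : realType) (phi1 phi2 : nat -> R[i] -> R[i]) : Prop :=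
  disjointly_universal (@BD R)
    (fun n => comp_op (phi1 n)) (fun n => comp_op (phi2 n)).

Definition hyp_deriv_separated (R : realType) (phi1 phi2 : nat -> R[i] -> R[i]) : Prop :=
  exists2 s, subsequence s &
    [/\ hyp_deriv0 (phi1 (s k)) @[k --> \oo] --> (1 : R[i]),
        hyp_deriv0 (phi2 (s k)) @[k --> \oo] --> (1 : R[i]) &
        pseudo_hyp (phi1 (s k) 0) (phi2 (s k) 0) @[k --> \oo] --> (1 : R[i])].

Definition hyp_deriv_disjoint (R : realType) (phi1 phi2 : nat -> R[i] -> R[i]) : Prop :=
  exists2 s, subsequence s &
    [/\ hyp_deriv0 (phi1 (s k)) @[k --> \oo] --> (1 : R[i]),
        hyp_deriv0 (phi2 (s k)) @[k --> \oo] --> (1 : R[i]) &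
        forall K, disc_compacts K -> exists k0, forall k, (k0 <= k)%N ->
          phi1 (s k) @` K `&` phi2 (s k) @` K = set0].

Definition univalent_disjoint (R : realType) (phi1 phi2 : nat -> R[i] -> R[i]) : Prop :=
  exists2 s, subsequence s &
    forall K, disc_compacts K -> exists k0, forall k, (k0 <= k)%N ->
      [/\ set_inj K (phi1 (s k)), set_inj K (phi2 (s k)) &
          phi1 (s k) @` K `&` phi2 (s k) @` K = set0].

Definition disj_universal_HD (R : realType) (phi1 phi2 : nat -> R[i] -> R[i]) : Prop :=
  disjointly_universal (@HD R)
    (fun n => comp_op (phi1 n)) (fun n => comp_op (phi2 n)).

Definition boundary_selfmaps (R : realType) (phi : nat -> R[i] -> R[i])
    (a : R[i]) : Prop :=
  [/\ forall n, holo_selfmap (phi n), unit_circle a &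
      phi n 0 @[n --> \oo] --> a].

(* Main.v *)
From HB Require Import structures.
Require Import Defs.
From mathcomp Require Import all_boot all_order all_algebra.
From mathcomp Require Import all_classical all_reals all_analysis.
From mathcomp Require Import complex.
From mathcomp Require Import ring lra.

Set Implicit Arguments.
Unset Strict Implicit.
Unset Printing Implicit Defensive.

Import Order.TTheory GRing.Theory Num.Theory.
Import numFieldNormedType.Exports.
Import Normc.

Local Open Scope classical_set_scope.
Local Open Scope ring_scope.

(** Everything rests on Cauchy's formula.  Goursat's lemma on rectangles, read in
   logarithmic polar coordinates, shows that circle means of a function holomorphic
   in an annulus do not depend on the radius (goursat, cint_radius,
   cauchy_formula).  The maximum principle, the Schwarz-Pick inequalities and
   Weierstrass's theorem follow.

   Both universality statements come from one criterion (universality): if every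
   f in X can be changed by an arbitrarily small amount on a given disc so that
   its compositions with phi1 n and phi2 n, for some n, approximate two given
   elements of X, then infinitely many such corrections, which realize each pair of a
   dense sequence infinitely often, converge to a universal element.

   In H(D) the corrections are polynomials.  When phi1 n and phi2 n are univalent
   on a disc with disjoint images, and these images have escaped towards the unit
   circle, the disc and its two images are three disjoint conformal discs, and on
   their union Runge's theorem (runge_discs) approximates f and the two targets
   transported by the inverses of phi1 n and phi2 n.  Conversely, a function whose
   compositions are close to z + c and z + c + 3 forces univalence and disjoint
   images.

   In the unit ball B corrections must keep the bound 1.  If the hyperbolic
   derivative of phi at 0 is close to 1, then phi is close to an automorphism on
   compact discs (near_rotation): by Schwarz's lemma, after moving phi 0 to the
   origin it is z h(z) with |h| <= 1 and |h 0| close to 1, so h is almost constant.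
   A target in B can therefore be pulled back through phi within B
   (hyp0_pullback).  Two functions of B prescribed near two points at
   pseudo-hyperbolic distance close to 1 can be glued within B (glue): a
   transition function u, the average of q / (q + t) over many dyadic scales t in
   a half-plane coordinate q, goes from 0 to 1 so slowly that |u| + |1 - u| stays
   close to 1, and (1 - u) F + u G nearly respects the bound.  Three gluings, at
   the points 0, phi1 n 0 and phi2 n 0, give the correction.  Conversely,
   Schwarz-Pick applied to a universal f whose compositions are close to two
   automorphisms shows that the hyperbolic derivatives are close to 1 and the
   centres far apart (hyp0_lower, universal_BD_separated).

   For such almost isometric maps, far apart centres amount to disjoint images,
   because the image of a disc is contained in a pseudo-hyperbolic disc
   (selfmap_mob) and nearly fills it (hyp0_covers); near_rotation also makes them
   univalent on compact sets.  Maps onto small Euclidean discs that approach 1 and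
   -1 at a fixed hyperbolic size are univalent with disjoint images, but their
   hyperbolic derivatives at 0 are at most 1/3. *)

Local Notation Re := complex.Re.
Local Notation Im := complex.Im.
Local Notation "x %:C" := (@real_complex_def _ (Phant _) x) : ring_scope.
Local Notation "x +i* y" := (Complex x y) : ring_scope.
Local Notation "''i'" := (Complex 0 1) : ring_scope.
(* the modulus with values in R, whereas the norm of R[i] takes values in R[i] *)
Local Notation "`‖ z ‖" := (normc z) (at level 0, z at level 99, format "`‖ z ‖").

(** * The modulus and limits *)

Section RealNorm.
Variable R : realType.
Implicit Types x y z w : R[i].

Lemma normCE z : `|z| = `‖z‖%:C.
Proof. by case: z. Qed.

Lemma nc_ge0 z : 0 <= `‖z‖.
Proof. by case: z => a b; rewrite sqrtr_ge0. Qed.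

Lemma nc_triangle z w : `‖z + w‖ <= `‖z‖ + `‖w‖.
Proof. exact: le_normcD. Qed.

Lemma nc_opp z : `‖- z‖ = `‖z‖.
Proof. exact: normcN. Qed.

Lemma nc_subC z w : `‖z - w‖ = `‖w - z‖.
Proof. by rewrite -nc_opp opprB. Qed.

Lemma nc_trans_sub y z w : `‖z - w‖ <= `‖z - y‖ + `‖y - w‖.
Proof. by rewrite (_ : z - w = (z - y) + (y - w)) ?nc_triangle //; ring. Qed.

Lemma nc_sub_le z w : `‖z - w‖ <= `‖z‖ + `‖w‖.
Proof. by rewrite -(nc_opp w) nc_triangle. Qed.

Lemma nc_sub_ge z w : `‖z‖ - `‖w‖ <= `‖z - w‖.
Proof. by rewrite lerBlDr; have := nc_triangle (z - w) w; rewrite subrK. Qed.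

Lemma nc_eq0 z : (`‖z‖ == 0) = (z == 0).
Proof.
by apply/eqP/eqP => [/eq0_normc //|->]; rewrite normc0.
Qed.

Lemma nc_gt0 z : (0 < `‖z‖) = (z != 0).
Proof. by rewrite lt_def nc_eq0 nc_ge0 andbT. Qed.

Lemma nc0 : `‖0 : R[i]‖ = 0.
Proof. exact: normc0. Qed.

Lemma nc1 : `‖1 : R[i]‖ = 1.
Proof. exact: normc1. Qed.

Lemma nc_real (r : R) : `‖r%:C‖ = `|r|.
Proof. by rewrite /= expr0n /= addr0 sqrtr_sqr. Qed.

Lemma nc_realp (r : R) : 0 <= r -> `‖r%:C‖ = r.
Proof. by move=> r0; rewrite nc_real ger0_norm. Qed.

Lemma nc_conj z : `‖z^*‖ = `‖z‖.
Proof. by case: z => a b; rewrite -[_^*]/(a +i* - b) /= sqrrN. Qed.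

Lemma ncX z n : `‖z ^+ n‖ = `‖z‖ ^+ n.
Proof.
elim: n => [|n IH]; first by rewrite !expr0 nc1.
by rewrite !exprS normcM IH.
Qed.

Lemma nc_div z w : `‖z / w‖ = `‖z‖ / `‖w‖.
Proof. by rewrite normcM normcV. Qed.

Lemma nc_i : `‖'i : R[i]‖ = 1.
Proof. by rewrite /= expr0n /= expr1n add0r sqrtr1. Qed.

Lemma nc_Re z : `|Re z| <= `‖z‖.
Proof.
by case: z => a b /=; rewrite -sqrtr_sqr ler_wsqrtr // lerDl sqr_ge0.
Qed.

Lemma nc_Im z : `|Im z| <= `‖z‖.
Proof.
by case: z => a b /=; rewrite -sqrtr_sqr ler_wsqrtr // lerDr sqr_ge0.
Qed.

Lemma nc_ReIm z : `‖z‖ <= `|Re z| + `|Im z|.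
Proof.
case: z => a b; rewrite (_ : a +i* b = a%:C + 'i * b%:C); last by simpc.
apply: (le_trans (nc_triangle _ _)).
by rewrite normcM nc_i mul1r !nc_real /=; simpc.
Qed.

Lemma cjM z w : (z * w)^* = z^* * w^*.
Proof. exact: rmorphM. Qed.

Lemma cjB z w : (z - w)^* = z^* - w^*.
Proof. exact: rmorphB. Qed.

Lemma cjV z : (z^-1)^* = (z^*)^-1.
Proof. exact: conjc_inv. Qed.

Lemma cj1 : 1^* = 1 :> R[i].
Proof. exact: conjc1. Qed.

Lemma cj_real (r : R) : (r%:C)^* = r%:C.
Proof. exact: conjc_real. Qed.

Lemma mul_conj z : z * z^* = (`‖z‖ ^+ 2)%:C.
Proof.
case: z => a b; rewrite -[_^*]/(a +i* - b) /= sqr_sqrtr ?addr_ge0 ?sqr_ge0 //.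
by apply/eqP; rewrite eq_complex /=; apply/andP; split; apply/eqP; ring.
Qed.

Lemma nc_sqr z : `‖z‖ ^+ 2 = Re z ^+ 2 + Im z ^+ 2.
Proof. by case: z => a b /=; rewrite sqr_sqrtr ?addr_ge0 ?sqr_ge0. Qed.

(** Neighbourhoods are described by real radii, so that all later estimates
   take place in the totally ordered field R. *)
Lemma nbhsCP z (P : R[i] -> Prop) :
  (\forall w \near z, P w) <->
  exists2 d : R, 0 < d & forall w, `‖w - z‖ < d -> P w.
Proof.
split.
  move=> /nbhs_ballP[e /=]; case: e => er ei.
  rewrite ltcE /= => /andP[/eqP -> e0] H.
  exists er => // w; rewrite nc_subC => wd; apply: H.
  by rewrite -ball_normE /= normCE ltcE /= eqxx.
move=> [d d0 H]; apply/nbhs_ballP; exists d%:C => /=; first by rewrite ltcR.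
by move=> w; rewrite -ball_normE /= normCE ltcR nc_subC => /H.
Qed.

Lemma near_ncP z (d : R) : 0 < d -> \forall w \near z, `‖w - z‖ < d.
Proof. by move=> d0; apply/nbhsCP; exists d. Qed.

Lemma nearCW z (P : R[i] -> Prop) : (forall w, P w) -> \forall w \near z, P w.
Proof. by move=> H; apply/nbhsCP; exists 1. Qed.

End RealNorm.

(** Distances are measured by the modulus in the ordered field R, the order of
   R[i] being partial. *)
Definition tends (R : realType) (T : Type) (F : set_system T) (f : T -> R[i])
  (l : R[i]) := forall e : R, 0 < e -> \forall x \near F, `‖f x - l‖ < e.

Definition cts (R : realType) (f : R[i] -> R[i]) (z : R[i]) :=
  tends (nbhs z) f (f z).

Section Tends.
Variables (R : realType) (T : Type) (F : set_system T).
Context {FF : Filter F}.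
Implicit Types (f g : T -> R[i]) (a b : R[i]).

Lemma tends_cst a : tends F (fun=> a) a.
Proof. by move=> e e0; apply: nearW => x; rewrite subrr nc0. Qed.

Lemma tends_ext f g a : f =1 g -> tends F f a -> tends F g a.
Proof.
move=> fg fa e e0; near=> x; rewrite -fg.
by near: x; exact: fa.
Unshelve. all: by end_near. Qed.

Lemma tends_near f g a : (\forall x \near F, f x = g x) -> tends F f a ->
  tends F g a.
Proof.
move=> fg fa e e0; near=> x; rewrite -(near fg x) //.
by near: x; exact: fa.
Unshelve. all: by end_near. Qed.

Lemma tendsD f g a b :
  tends F f a -> tends F g b -> tends F (fun x => f x + g x) (a + b).
Proof.
move=> fa gb e e0; have e2 : 0 < e / 2 by rewrite divr_gt0.
near=> x; rewrite (_ : _ - _ = (f x - a) + (g x - b)); last by ring.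
apply: (le_lt_trans (nc_triangle _ _)).
rewrite [e]splitr ltrD //; near: x; [exact: fa|exact: gb].
Unshelve. all: by end_near. Qed.

Lemma tendsN f a : tends F f a -> tends F (fun x => - f x) (- a).
Proof.
move=> fa e e0; near=> x; rewrite -opprD nc_opp; near: x; exact: fa.
Unshelve. all: by end_near. Qed.

Lemma tendsB f g a b :
  tends F f a -> tends F g b -> tends F (fun x => f x - g x) (a - b).
Proof. by move=> fa /tendsN; exact: tendsD. Qed.

Lemma tends_bounded f a :
  tends F f a -> \forall x \near F, `‖f x‖ < `‖a‖ + 1.
Proof.
move=> /(_ 1 ltr01); apply: filterS => x fx.
by rewrite -[f x](subrK a) addrC (le_lt_trans (nc_triangle _ _)) ?ltrD2l.
Qed.

Lemma tendsM f g a b :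
  tends F f a -> tends F g b -> tends F (fun x => f x * g x) (a * b).
Proof.
move=> fa gb e e0.
set M := `‖a‖ + `‖b‖ + 1.
have M0 : 0 < M by rewrite ltr_wpDl // addr_ge0 ?nc_ge0.
have e2 : 0 < e / (2 * M) by rewrite divr_gt0 ?mulr_gt0.
near=> x.
rewrite (_ : _ - _ = f x * (g x - b) + (f x - a) * b); last by ring.
apply: (le_lt_trans (nc_triangle _ _)); rewrite !normcM.
have h1 : `‖f x‖ <= M.
  have : `‖f x‖ < `‖a‖ + 1 by near: x; exact: tends_bounded.
  by rewrite /M => /ltW h; apply: (le_trans h); have := nc_ge0 b; lra.
have h2 : `‖b‖ <= M by rewrite /M; have := nc_ge0 a; lra.
have h3 : `‖g x - b‖ < e / (2 * M) by near: x; exact: gb.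
have h4 : `‖f x - a‖ < e / (2 * M) by near: x; exact: fa.
have -> : e = M * (e / (2 * M)) + e / (2 * M) * M by field; rewrite gt_eqF.
apply: ler_ltD.
  by apply: ler_pM; rewrite ?nc_ge0 // ltW.
apply: (@le_lt_trans _ _ (`‖f x - a‖ * M)); first by rewrite ler_wpM2l ?nc_ge0.
by rewrite ltr_pM2r.
Unshelve. all: by end_near. Qed.

Lemma tends_away f a : a != 0 -> tends F f a ->
  \forall x \near F, `‖a‖ / 2 < `‖f x‖.
Proof.
move=> a0 /(_ (`‖a‖ / 2)) fa; have : 0 < `‖a‖ / 2 by rewrite divr_gt0 ?nc_gt0.
move=> /fa; apply: filterS => x; rewrite nc_subC.
by have := nc_sub_ge a (a - f x); rewrite (_ : a - (a - f x) = f x); [lra | ring].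
Qed.

Lemma tendsV f a : a != 0 -> tends F f a ->
  tends F (fun x => (f x)^-1) a^-1.
Proof.
move=> a0 fa e e0; have na : 0 < `‖a‖ by rewrite nc_gt0.
have fa' := tends_away a0 fa.
near=> x.
have hx : `‖a‖ / 2 < `‖f x‖ by near: x.
have fx0 : f x != 0 by rewrite -nc_gt0 (lt_trans _ hx) ?divr_gt0.
rewrite (_ : _ - _ = (a - f x) / (f x * a)); last by field; rewrite ?fx0 ?a0.
rewrite nc_div normcM ltr_pdivrMr; last by rewrite mulr_gt0 ?nc_gt0.
apply: (@lt_le_trans _ _ (e * (`‖a‖ / 2 * `‖a‖))).
  rewrite nc_subC; near: x; apply: fa.
  by rewrite !mulr_gt0 // divr_gt0.
by rewrite ler_wpM2l ?ltW // ltr_pM2r.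
Unshelve. all: by end_near. Qed.

Lemma tends_comp (g : R[i] -> R[i]) f a : cts g a -> tends F f a ->
  tends F (g \o f) (g a).
Proof.
move=> ga fa e e0; have /nbhsCP[d d0 gd] := ga _ e0.
near=> x; apply: gd; near: x; exact: fa.
Unshelve. all: by end_near. Qed.

End Tends.

Lemma tends_bound (R : realType) (T : Type) (F : set_system T)
    {FF : ProperFilter F} (f : T -> R[i]) (a c : R[i]) (M : R) :
  tends F f a -> (\forall x \near F, `‖f x - c‖ <= M) -> `‖a - c‖ <= M.
Proof.
move=> fa fM; apply/ler_addgt0Pl => e e0.
have [x [h1 h2]] := filter_ex (filterI (fa e e0) fM).
apply: (le_trans (nc_trans_sub (f x) _ _)); apply: lerD => //.
by rewrite nc_subC ltW.
Qed.

Lemma tends_unique (R : realType) (T : Type) (F : set_system T)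
    {FF : ProperFilter F} (f : T -> R[i]) (a b : R[i]) :
  tends F f a -> tends F f b -> a = b.
Proof.
move=> fa fb; apply/eqP; rewrite -subr_eq0 -nc_eq0 eq_le nc_ge0 andbT.
apply/ler_addgt0Pl => e e0; rewrite addr0; apply: (tends_bound fa).
by apply: filterS (fb e e0) => x /ltW.
Qed.

Section Cts.
Variable R : realType.
Implicit Types (f g : R[i] -> R[i]) (z : R[i]).

Lemma cts_id z : cts id z.
Proof. by move=> e e0; apply/nbhsCP; exists e. Qed.

Lemma cts_cst a z : cts (fun=> a) z.
Proof. exact: tends_cst. Qed.

Lemma cts_comp f g z : cts f (g z) -> cts g z -> cts (f \o g) z.
Proof. by move=> cf cg; exact: tends_comp. Qed.

Lemma cts_conj z : cts (fun w => w^*) z.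
Proof.
move=> e e0; apply/nbhsCP; exists e => // w.
by rewrite -rmorphB /= nc_conj.
Qed.

End Cts.

(** * Complex derivatives and holomorphic functions *)

(** Complex differentiability in Caratheodory's form: the difference quotient
   extends continuously.  Products, quotients and compositions then reduce to
   the algebra of continuous functions. *)
Definition cder (R : realType) (f : R[i] -> R[i]) (z c : R[i]) :=
  exists q, [/\ cts q z, q z = c & forall w, f w = f z + q w * (w - z)].

Section Cder.
Variable R : realType.
Implicit Types (f g q : R[i] -> R[i]) (z c w : R[i]).

Lemma cder_eps f z c : cder f z c <->
  forall e : R, 0 < e -> \forall w \near z,
    `‖f w - f z - c * (w - z)‖ <= e * `‖w - z‖.
Proof.
split=> [[q [cq qz fq]] e e0|H].
  have := cq e e0; apply: filterS => w.
  rewrite qz fq => wq.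
  rewrite (_ : _ - _ = (q w - c) * (w - z)); last by ring.
  by rewrite normcM ler_wpM2r ?nc_ge0 // ltW.
exists (fun w => if w == z then c else (f w - f z) / (w - z)); split.
- move=> e e0; have e2 : 0 < e / 2 by rewrite divr_gt0.
  have := H _ e2; apply: filterS => w; rewrite eqxx.
  have [-> _|wz] := eqVneq w z; first by rewrite subrr nc0.
  have wz' : w - z != 0 by rewrite subr_eq0.
  rewrite (_ : _ / _ - c = (f w - f z - c * (w - z)) / (w - z)); last by field.
  rewrite nc_div ltr_pdivrMr ?nc_gt0 // => /le_lt_trans; apply.
  by rewrite ltr_pM2r ?nc_gt0 // ltr_pdivrMr // mulr_natr mulr2n ltrDl.
- by rewrite eqxx.
- move=> w; have [->|wz] := eqVneq w z; first by rewrite subrr mulr0 addr0.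
  by rewrite divfK ?subr_eq0 // addrC subrK.
Qed.

Lemma cder_cts f z c : cder f z c -> cts f z.
Proof.
move=> [q [cq qz fq]].
have : tends (nbhs z) (fun w => f z + q w * (w - z)) (f z + q z * (z - z)).
  apply: tendsD; first exact: tends_cst.
  apply: tendsM; first exact: cq.
  by apply: tendsB; [exact: cts_id|exact: tends_cst].
rewrite subrr mulr0 addr0; apply: tends_ext => w; exact/esym/fq.
Qed.

Lemma cder_near f g z c : (\forall w \near z, f w = g w) ->
  cder f z c -> cder g z c.
Proof.
move=> fg /cder_eps fz; apply/cder_eps => e e0.
have fgz := nbhs_singleton fg.
near=> w; rewrite -fgz -(near fg w) //; near: w; exact: fz.
Unshelve. all: by end_near. Qed.

Lemma cder_cst a z : cder (fun=> a) z 0.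
Proof.
by exists (fun=> 0); split=> [||w]; [exact: cts_cst| |rewrite mul0r addr0].
Qed.

Lemma cder_id z : cder id z 1.
Proof.
by exists (fun=> 1); split=> [||w]; [exact: cts_cst| |rewrite mul1r addrC subrK].
Qed.

Lemma cderD f g z c d : cder f z c -> cder g z d ->
  cder (fun w => f w + g w) z (c + d).
Proof.
move=> [p [cp pz fp]] [q [cq qz gq]].
exists (fun w => p w + q w); split; [exact: (tendsD cp cq)|by rewrite pz qz|].
by move=> w; rewrite fp gq; ring.
Qed.

Lemma cderM f g z c d : cder f z c -> cder g z d ->
  cder (fun w => f w * g w) z (c * g z + f z * d).
Proof.
move=> fz gz; have cg := cder_cts gz.
case: fz gz => [p [cp pz fp]] [q [cq qz gq]].
exists (fun w => p w * g w + f z * q w); split.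
- apply: tendsD; first exact: (tendsM cp cg).
  by apply: tendsM; [exact: tends_cst|exact: cq].
- by rewrite pz qz.
- by move=> w; rewrite fp gq; ring.
Qed.

Lemma cderN f z c : cder f z c -> cder (fun w => - f w) z (- c).
Proof.
move=> fz; have := cderM (cder_cst (-1) z) fz.
rewrite mul0r add0r mulN1r; apply: cder_near.
by apply: nearCW => w; rewrite mulN1r.
Qed.

Lemma cderB f g z c d : cder f z c -> cder g z d ->
  cder (fun w => f w - g w) z (c - d).
Proof. by move=> fz /cderN; exact: cderD. Qed.

Lemma cderZ a f z c : cder f z c -> cder (fun w => a * f w) z (a * c).
Proof.
by move=> fz; have := cderM (cder_cst a z) fz; rewrite mul0r add0r.
Qed.

Lemma cder_comp f g z c d : cder f (g z) c -> cder g z d ->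
  cder (f \o g) z (c * d).
Proof.
move=> fz gz; have cg := cder_cts gz.
case: fz gz => [p [cp pz fp]] [q [cq qz gq]].
exists (fun w => p (g w) * q w); split.
- by apply: tendsM; [exact: (cts_comp cp cg)|exact: cq].
- by rewrite pz qz.
- move=> w /=; rewrite fp (_ : g w - g z = q w * (w - z)); first by rewrite mulrA.
  by rewrite gq; ring.
Qed.

Lemma cder_inv z : z != 0 -> cder (fun w => w^-1) z (- z^-2).
Proof.
move=> z0; apply: (@cder_near (fun w => if w == 0 then z^-1 + z^-2 * z else w^-1)).
  have nz : 0 < `‖z‖ by rewrite nc_gt0.
  near=> w; case: eqP => // w0.
  have : `‖w - z‖ < `‖z‖ by near: w; exact: near_ncP.
  by rewrite w0 sub0r nc_opp ltxx.
exists (fun w => if w == 0 then - z^-2 else - (w^-1 * z^-1)); split.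
- rewrite /cts (negPf z0); apply: (@tends_near _ _ _ _ (fun w => - (w^-1 * z^-1))).
    have nz : 0 < `‖z‖ by rewrite nc_gt0.
    near=> w; case: eqP => // w0.
    have : `‖w - z‖ < `‖z‖ by near: w; exact: near_ncP.
    by rewrite w0 sub0r nc_opp ltxx.
  apply: tendsN; apply: tendsM; last exact: tends_cst.
  by apply: tendsV => //; exact: cts_id.
- by rewrite (negPf z0) -invfM -expr2.
- move=> w; rewrite (negPf z0); case: eqP => [->|/eqP w0].
    by field.
  by field; rewrite z0 w0.
Unshelve. all: by end_near. Qed.

Lemma cderV g z d : g z != 0 -> cder g z d ->
  cder (fun w => (g w)^-1) z (- (g z) ^- 2 * d).
Proof. by move=> g0; exact: (cder_comp (cder_inv g0)). Qed.

Lemma cder_affine a b z : cder (fun w => a + b * w) z b.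
Proof.
have := cderD (cder_cst a z) (cderZ b (cder_id z)).
by rewrite add0r mulr1.
Qed.

Lemma cderX n z : cder (fun w => w ^+ n) z (n%:R * z ^+ n.-1).
Proof.
elim: n => [|n IH].
  by rewrite mul0r; apply: cder_near (cder_cst 1 z); apply: nearCW => w; rewrite expr0.
have := cderM (cder_id z) IH; rewrite mul1r.
rewrite (_ : _ + _ = n.+1%:R * z ^+ n.+1.-1); last first.
  case: n {IH} => [|n]; first by rewrite /= mul0r mulr0 addr0 mul1r.
  by rewrite /= mulrCA -exprS -[in RHS]natr1 mulrDl mul1r addrC.
by apply: cder_near; apply: nearCW => w; rewrite exprS.
Qed.

Lemma cvg_tendsP (T : Type) (F : set_system T) {FF : Filter F}
  (f : T -> R[i]) l : f @ F --> l <-> tends F f l.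
Proof.
split=> [fl e e0|fl A /nbhsCP[d d0 dA]].
  by apply: (fl [set w | `‖w - l‖ < e]); exact: near_ncP.
by rewrite /nbhs /=; have := fl d d0; apply: filterS => x /dA.
Qed.

Lemma cder_dnbhs f z c :
  cder f z c <-> (fun h => h^-1 *: ((f \o shift z) (h *: 1) - f z)) @ 0^' --> c.
Proof.
have E h : h^-1 *: ((f \o shift z) (h *: 1) - f z) = (f (h + z) - f z) / h.
  by rewrite /shift /= mulrC -[h *: 1]/(h * 1) mulr1.
have nearD P : (\forall h \near (0 : R[i])^', P h) <->
    exists2 d : R, 0 < d & forall h : R[i], h != 0 -> `‖h‖ < d -> P h.
  split=> [/nbhsCP[d d0 dP]|[d d0 dP]].
    by exists d => // h h0 hd; apply: dP => //; rewrite subr0.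
  by apply/nbhsCP; exists d => // h; rewrite subr0 => hd h0; apply: dP.
split=> [/cder_eps H|/cvg_tendsP H].
  apply/cvg_tendsP => e e0; have e2 : 0 < e / 2 by rewrite divr_gt0.
  have /nbhsCP[d d0 dP] := H _ e2.
  apply/nearD; exists d => // h h0 hd; rewrite E.
  have := dP (h + z); rewrite addrK => /(_ hd) {}H.
  rewrite (_ : _ / _ - _ = (f (h + z) - f z - c * h) / h); last by field.
  rewrite nc_div ltr_pdivrMr ?nc_gt0 // (le_lt_trans H) //.
  by rewrite ltr_pM2r ?nc_gt0 // ltr_pdivrMr // mulr_natr mulr2n ltrDl.
apply/cder_eps => e e0; have /nearD[d d0 dP] := H _ e0.
apply/nbhsCP; exists d => // w wd.
have [->|wz] := eqVneq w z; first by rewrite !subrr mulr0 subrr nc0 mulr0.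
have wz' : w - z != 0 by rewrite subr_eq0.
have := dP _ wz' wd; rewrite E subrK.
rewrite (_ : _ / _ - _ = (f w - f z - c * (w - z)) / (w - z)); last by field.
by rewrite nc_div ltr_pdivrMr ?nc_gt0 // => /ltW.
Qed.

Lemma cder_derivable f z c : cder f z c -> derivable f z 1.
Proof. by move=> /cder_dnbhs; apply: cvgP. Qed.

Lemma derivable_cder f z : derivable f z 1 -> exists c, cder f z c.
Proof. by move=> /cvg_ex[c /cder_dnbhs fz]; exists c. Qed.

Lemma dnbhs_proper (z : R[i]) : ProperFilter z^'.
Proof.
apply: Build_ProperFilter_ex => P /nbhsCP[d d0 dP].
exists (z + (d / 2)%:C); apply: dP.
  by rewrite addrC addKr nc_realp ?divr_ge0 ?ltW // ltr_pdivrMr // mulr_natr mulr2n ltrDl.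
rewrite -subr_eq0 addrC addKr -nc_eq0 nc_realp ?divr_ge0 ?ltW //.
by rewrite gt_eqF // divr_gt0.
Qed.

Lemma cder_unique f z c d : cder f z c -> cder f z d -> c = d.
Proof.
move=> /cder_dnbhs/cvg_tendsP fc /cder_dnbhs/cvg_tendsP fd.
exact: (@tends_unique _ _ _ (dnbhs_proper 0) _ _ _ fc fd).
Qed.

Lemma derive1_cder f z c : cder f z c -> derive1 f z = c.
Proof.
move=> fc; rewrite derive1E.
suff : cder f z ('D_1 f z) by move=> h; exact: (cder_unique h fc).
by apply/cder_dnbhs; exact: (cder_derivable fc).
Qed.

End Cder.

Section Holo.
Variable R : realType.
Implicit Types (f g : R[i] -> R[i]) (z c w : R[i]).

Definition holo f := forall z, `‖z‖ < 1 -> exists c, cder f z c.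

Lemma holomorphic_discP f : holomorphic_disc f <-> holo f.
Proof.
have E z : unit_disc z <-> `‖z‖ < 1 by rewrite /unit_disc /= normCE ltcR.
split=> H z /E h; first exact/derivable_cder/H.
by have [c /cder_derivable] := H z h.
Qed.

Lemma holo_cder f z : holo f -> `‖z‖ < 1 -> cder f z (derive1 f z).
Proof. by move=> hf /hf[c fc]; rewrite (derive1_cder fc). Qed.

Lemma holo_cts f z : holo f -> `‖z‖ < 1 -> cts f z.
Proof. by move=> hf z1; exact: cder_cts (holo_cder hf z1). Qed.

Lemma holo_cst a : holo (fun=> a).
Proof. by move=> z _; exists 0; exact: cder_cst. Qed.

Lemma holo_id : holo id.
Proof. by move=> z _; exists 1; exact: cder_id. Qed.

Lemma holoD f g : holo f -> holo g -> holo (fun w => f w + g w).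
Proof.
by move=> hf hg z z1; have [[c fc] [d gd]] := (hf z z1, hg z z1);
  exists (c + d); exact: cderD.
Qed.

Lemma holoB f g : holo f -> holo g -> holo (fun w => f w - g w).
Proof.
by move=> hf hg z z1; have [[c fc] [d gd]] := (hf z z1, hg z z1);
  exists (c - d); exact: cderB.
Qed.

Lemma holoM f g : holo f -> holo g -> holo (fun w => f w * g w).
Proof.
by move=> hf hg z z1; have [[c fc] [d gd]] := (hf z z1, hg z z1);
  eexists; exact: (cderM fc gd).
Qed.

Lemma holoZ a f : holo f -> holo (fun w => a * f w).
Proof. by apply: holoM; exact: holo_cst. Qed.

Lemma holoX f n : holo f -> holo (fun w => f w ^+ n).
Proof.
move=> hf z z1; have [c fc] := hf z z1.
eexists; exact: (cder_comp (cderX n (f z)) fc).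
Qed.

Lemma holoV f : (forall z, `‖z‖ < 1 -> f z != 0) -> holo f ->
  holo (fun w => (f w)^-1).
Proof.
move=> f0 hf z z1; have [c fc] := hf z z1.
by eexists; exact: (cderV (f0 z z1) fc).
Qed.

Lemma holo_comp f g : (forall z, `‖z‖ < 1 -> `‖g z‖ < 1) ->
  holo f -> holo g -> holo (f \o g).
Proof.
move=> g1 hf hg z z1; have [[c fc] [d gd]] := (hf _ (g1 z z1), hg z z1).
by eexists; exact: (cder_comp fc gd).
Qed.

End Holo.

(** * Integration of complex curves *)

Definition ctsR (R : realType) (u : R -> R[i]) := forall t, tends (nbhs t) u (u t).

(** Derivatives along R are taken coordinatewise: R[i] is a normed module over
   itself, so derivable on it would mean complex differentiability. *)
Definition rder (R : realType) (U : R -> R[i]) (t : R) (c : R[i]) :=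
  is_derive t 1 (fun s => Re (U s)) (Re c) /\
  is_derive t 1 (fun s => Im (U s)) (Im c).

Definition integ (R : realType) (u : R -> R[i]) (a b : R) : R[i] :=
  (\int[@lebesgue_measure R]_(t in `[a, b]) Re (u t))%R +i*
  (\int[@lebesgue_measure R]_(t in `[a, b]) Im (u t))%R.

Section RealCurves.
Variable R : realType.
Implicit Types (u v U V : R -> R[i]) (a b c t : R).

Lemma tends_part (p : R[i] -> R) (T : Type) (F : set_system T) {FF : Filter F}
    (f : T -> R[i]) (l : R[i]) :
  (forall z w, `|p z - p w| <= `‖z - w‖) -> tends F f l ->
  (p \o f) @ F --> p l.
Proof.
move=> pL fl; apply/cvgrPdist_lt => e e0.
apply: filterS (fl e e0) => x; rewrite distrC; apply: le_lt_trans; exact: pL.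
Qed.

Lemma ReD (z w : R[i]) : Re (z + w) = Re z + Re w.
Proof. by case: z w => [? ?] [? ?]. Qed.

Lemma ImD (z w : R[i]) : Im (z + w) = Im z + Im w.
Proof. by case: z w => [? ?] [? ?]. Qed.

Lemma ReB (z w : R[i]) : Re (z - w) = Re z - Re w.
Proof. by case: z w => [? ?] [? ?]. Qed.

Lemma ImB (z w : R[i]) : Im (z - w) = Im z - Im w.
Proof. by case: z w => [? ?] [? ?]. Qed.

Lemma Re_lip (z w : R[i]) : `|Re z - Re w| <= `‖z - w‖.
Proof. by have := nc_Re (z - w); rewrite ReB. Qed.

Lemma Im_lip (z w : R[i]) : `|Im z - Im w| <= `‖z - w‖.
Proof. by have := nc_Im (z - w); rewrite ImB. Qed.

Lemma nc_lip (z w : R[i]) : `|normc z - normc w| <= `‖z - w‖.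
Proof.
rewrite ler_norml; have := nc_sub_ge z w; have := nc_sub_ge w z.
by rewrite (nc_subC w); lra.
Qed.

Lemma tends_ReIm (T : Type) (F : set_system T) {FF : Filter F}
    (f : T -> R[i]) (l : R[i]) :
  (fun x => Re (f x)) @ F --> Re l -> (fun x => Im (f x)) @ F --> Im l ->
  tends F f l.
Proof.
move=> /cvgrPdist_lt fr /cvgrPdist_lt fi e e0.
have e2 : 0 < e / 2 by rewrite divr_gt0.
near=> x; apply: (le_lt_trans (nc_ReIm _)); rewrite ReB ImB [e]splitr.
by rewrite ltrD // distrC; near: x; [exact: fr|exact: fi].
Unshelve. all: by end_near. Qed.

Lemma ctsR_Re u : ctsR u -> continuous (fun t => Re (u t)).
Proof. by move=> cu t; exact: (tends_part Re_lip (cu t)). Qed.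

Lemma ctsR_Im u : ctsR u -> continuous (fun t => Im (u t)).
Proof. by move=> cu t; exact: (tends_part Im_lip (cu t)). Qed.

Lemma real_antider (f : R -> R) a : continuous f ->
  exists F : R -> R, forall t, a < t -> is_derive t 1 F (f t).
Proof.
move=> cf; exists (fun x => (\int[@lebesgue_measure R]_(t in `[a, x]) f t)%R).
move=> t at_.
have [] := @continuous_FTC1_closed _ f a t (t + 1) _ _ at_ (cf t).
- by rewrite ltrDl.
- apply: continuous_compact_integrable; first exact: segment_compact.
  exact: continuous_subspaceT.
- by move=> d1 d2; rewrite -d2 derive1E; exact/derivableP.
Qed.

Lemma real_FTC (f F : R -> R) a b : a <= b -> continuous f ->
  (forall t, a <= t <= b -> is_derive t 1 F (f t)) ->
  (\int[@lebesgue_measure R]_(t in `[a, b]) f t)%R = F b - F a.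
Proof.
rewrite le_eqVlt => /predU1P[<- cf dF|ab cf dF].
  by rewrite set_itv1 Rintegral_set1 subrr.
have cF t : a <= t <= b -> F x @[x --> t] --> F t.
  move=> /dF d; apply: differentiable_continuous.
  by apply/derivable1_diffP; exact: ex_derive.
rewrite /Rintegral (@continuous_FTC2 _ f F) //.
- exact: continuous_subspaceT.
- split.
  + move=> t; rewrite in_itv /= => /andP[/ltW a1 /ltW b1].
    by have d := dF t; apply: ex_derive; apply: d; rewrite a1 b1.
  + by apply: cvg_at_right_filter; apply: cF; rewrite lexx ltW.
  + by apply: cvg_at_left_filter; apply: cF; rewrite lexx ltW.
- move=> t; rewrite in_itv /= => /andP[/ltW a1 /ltW b1].
  by rewrite derive1E; apply: derive_val; apply: dF; rewrite a1 b1.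
Qed.

Lemma antider_exists u a : ctsR u -> exists U, forall t, a < t -> rder U t (u t).
Proof.
move=> cu; have [F FP] := real_antider a (ctsR_Re cu).
have [G GP] := real_antider a (ctsR_Im cu).
by exists (fun t => F t +i* G t) => t at_; split => /=; [exact: FP|exact: GP].
Qed.

Lemma integ_FTC u U a b : a <= b -> ctsR u ->
  (forall t, a <= t <= b -> rder U t (u t)) -> integ u a b = U b - U a.
Proof.
move=> ab cu dU; rewrite /integ.
rewrite (real_FTC ab (ctsR_Re cu) (fun t h => (dU t h).1)).
rewrite (real_FTC ab (ctsR_Im cu) (fun t h => (dU t h).2)).
by case: (U b) (U a) => [? ?] [? ?].
Qed.

(** Every integral is an increment of one antiderivative; the elementary rules
   below are rules for increments. *)
Lemma integ_antider u a : ctsR u -> exists2 U,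
  forall t, a < t -> rder U t (u t) &
  forall x y, a < x -> x <= y -> integ u x y = U y - U x.
Proof.
move=> cu; have [U dU] := antider_exists a cu; exists U => // x y ax xy.
by apply: integ_FTC => // t /andP[xt _]; apply: dU; exact: lt_le_trans xt.
Qed.

Lemma rderD U V t (c d : R[i]) : rder U t c -> rder V t d ->
  rder (fun s => U s + V s) t (c + d).
Proof.
move=> [u1 u2] [v1 v2]; split; rewrite (ReD, ImD).
  have -> : (fun s => Re (U s + V s)) = (fun s => Re (U s)) + (fun s => Re (V s)).
    by apply/funext => s; rewrite (ReD, ImD).
  exact: is_deriveD.
have -> : (fun s => Im (U s + V s)) = (fun s => Im (U s)) + (fun s => Im (V s)).
  by apply/funext => s; rewrite (ReD, ImD).
exact: is_deriveD.
Qed.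

Lemma rderZ (k : R[i]) U t (c : R[i]) : rder U t c -> rder (fun s => k * U s) t (k * c).
Proof.
move=> [u1 u2]; case: k c u1 u2 => k1 k2 [c1 c2] /= u1 u2; split => /=.
  have -> : (fun s => Re ((k1 +i* k2) * U s)) =
     k1 *: (fun s => Re (U s)) - k2 *: (fun s => Im (U s)).
    by apply/funext => s; rewrite !fctE; case: (U s).
  exact: is_deriveB.
have -> : (fun s => Im ((k1 +i* k2) * U s)) =
   k1 *: (fun s => Im (U s)) + k2 *: (fun s => Re (U s)).
  by apply/funext => s; rewrite !fctE; case: (U s).
exact: is_deriveD.
Qed.

(** The mean value inequality, obtained from the real mean value theorem along
   the direction of the increment. *)
Lemma mean_value_le U u a b M : a <= b ->
  (forall t, a <= t <= b -> rder U t (u t)) ->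
  (forall t, a <= t <= b -> `‖u t‖ <= M) ->
  `‖U b - U a‖ <= M * (b - a).
Proof.
rewrite le_eqVlt => /predU1P[<- _ _|ab dU uM].
  by rewrite !subrr nc0 mulr0.
set D := U b - U a.
have [->|D0] := eqVneq D 0.
  have aab : a <= a <= b by rewrite lexx ltW.
  rewrite nc0 mulr_ge0 ?subr_ge0 ?(ltW ab) //.
  exact: le_trans (nc_ge0 _) (uM a aab).
pose f s := Re (D^* * U s).
have df t : a <= t <= b -> is_derive t 1 f (Re (D^* * u t)).
  by move=> h; have [] := rderZ D^* (dU t h).
have [||t] := @MVT _ f (fun t => Re (D^* * u t)) a b ab.
- by move=> x; rewrite in_itv /= => /andP[/ltW h1 /ltW h2]; apply: df; rewrite h1.
- apply: derivable_within_continuous => x; rewrite in_itv /= => h.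
  by have d := df x h; exact: ex_derive.
rewrite in_itv /= => /andP[/ltW h1 /ltW h2].
have -> : f b - f a = `‖D‖ ^+ 2.
  by rewrite /f -ReB -mulrBr -/D mulrC mul_conj.
move=> E; have : `‖D‖ ^+ 2 <= `‖D‖ * M * (b - a).
  rewrite E ler_wpM2r ?subr_ge0 ?(ltW ab) //.
  apply: (le_trans (ler_norm _)); apply: (le_trans (nc_Re _)).
  by rewrite normcM nc_conj ler_wpM2l ?nc_ge0 // uM // h1.
by rewrite expr2 -mulrA ler_pM2l // nc_gt0.
Qed.

Lemma integ_le u a b M : a <= b -> ctsR u ->
  (forall t, a <= t <= b -> `‖u t‖ <= M) -> `‖integ u a b‖ <= M * (b - a).
Proof.
move=> ab cu uM; have a1 : a - 1 < a by rewrite gtrBl.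
have [U dU ->//] := integ_antider (a - 1) cu.
apply: mean_value_le uM => // t /andP[at_ _]; apply: dU.
exact: lt_le_trans at_.
Qed.

Lemma integ_add u a b c : a <= b -> b <= c -> ctsR u ->
  integ u a b + integ u b c = integ u a c.
Proof.
move=> ab bc cu; have a1 : a - 1 < a by rewrite gtrBl.
have [U dU E] := integ_antider (a - 1) cu.
have b1 := lt_le_trans a1 ab.
by rewrite (E a b) // (E b c) // (E a c) ?(le_trans ab) //; ring.
Qed.

Lemma ctsRD u v : ctsR u -> ctsR v -> ctsR (fun t => u t + v t).
Proof. by move=> cu cv t; exact: (tendsD (cu t) (cv t)). Qed.

Lemma ctsRB u v : ctsR u -> ctsR v -> ctsR (fun t => u t - v t).
Proof. by move=> cu cv t; exact: (tendsB (cu t) (cv t)). Qed.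

Lemma ctsRM u v : ctsR u -> ctsR v -> ctsR (fun t => u t * v t).
Proof. by move=> cu cv t; exact: (tendsM (cu t) (cv t)). Qed.

Lemma ctsRV u : (forall t, u t != 0) -> ctsR u -> ctsR (fun t => (u t)^-1).
Proof. by move=> u0 cu t; exact: (tendsV (u0 t) (cu t)). Qed.

Lemma ctsR_cst (k : R[i]) : ctsR (fun=> k).
Proof. by move=> t; exact: tends_cst. Qed.

Lemma ctsRZ k u : ctsR u -> ctsR (fun t => k * u t).
Proof. by apply: ctsRM; exact: ctsR_cst. Qed.

Lemma ctsR_comp (f : R[i] -> R[i]) u : (forall t, cts f (u t)) -> ctsR u ->
  ctsR (f \o u).
Proof. by move=> cf cu t; exact: (tends_comp (cf t) (cu t)). Qed.

Lemma integ_lin k u v a b : a <= b -> ctsR u -> ctsR v ->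
  integ (fun t => u t + k * v t) a b = integ u a b + k * integ v a b.
Proof.
move=> ab cu cv; have a1 : a - 1 < a by rewrite gtrBl.
have [U dU ->//] := integ_antider (a - 1) cu.
have [V dV ->//] := integ_antider (a - 1) cv.
rewrite (@integ_FTC _ (fun t => U t + k * V t)) //; first by ring.
- by apply: ctsRD => //; exact: ctsRZ.
- move=> t /andP[at_ _]; have at1 := lt_le_trans a1 at_.
  by apply: rderD; [exact: dU|exact/rderZ/dV].
Qed.

Lemma integ_cst k a b : a <= b -> integ (fun=> k) a b = k * (b - a)%:C.
Proof.
move=> ab; rewrite (@integ_FTC _ (fun t => k * t%:C)) //.
- by rewrite -mulrBr rmorphB.
- exact: ctsR_cst.
- move=> t _; rewrite -[X in rder _ _ X]mulr1; apply: rderZ; split => /=.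
    exact: is_derive_id.
  exact: is_derive_cst.
Qed.

Lemma eq_integ u v a b : (forall t, a <= t <= b -> u t = v t) ->
  integ u a b = integ v a b.
Proof.
move=> uv; rewrite /integ; congr (_ +i* _); apply: eq_Rintegral => t;
  by rewrite inE /= in_itv /= => /uv ->.
Qed.

Lemma integZ k v a b : a <= b -> ctsR v ->
  integ (fun t => k * v t) a b = k * integ v a b.
Proof.
move=> ab cv; have := integ_lin k ab (ctsR_cst 0) cv.
rewrite (integ_cst _ ab) mul0r add0r => <-.
by apply: eq_integ => t _; rewrite add0r.
Qed.

Lemma integB u v a b : a <= b -> ctsR u -> ctsR v ->
  integ (fun t => u t - v t) a b = integ u a b - integ v a b.
Proof.
move=> ab cu cv; have := integ_lin (-1) ab cu cv; rewrite mulN1r => <-.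
by apply: eq_integ => t _; rewrite mulN1r.
Qed.

Lemma integ_conj u a b : a <= b -> ctsR u ->
  integ (fun t => (u t)^*) a b = (integ u a b)^*.
Proof.
move=> ab cu; have a1 : a - 1 < a by rewrite gtrBl.
have [U dU ->//] := integ_antider (a - 1) cu.
rewrite (@integ_FTC _ (fun t => (U t)^*)) ?rmorphB //.
- by apply: ctsR_comp cu => t; exact: cts_conj.
- move=> t /andP[at_ _]; have [d1 d2] := dU t (lt_le_trans a1 at_).
  split; first by move: d1; congr is_derive; [apply/funext => s; case: (U s)|case: (u t)].
  rewrite (_ : (fun s => _) = - (fun s => Im (U s))); last first.
    by apply/funext => s; rewrite fctE; case: (U s).
  by rewrite (_ : Im (u t)^* = - Im (u t)); [exact: is_deriveN|case: (u t)].
Qed.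

End RealCurves.

(** * The complex exponential *)

Section ComplexExponential.
Variable R : realType.
Implicit Types (z w h : R[i]) (t : R).

Lemma eqC z w : Re z = Re w -> Im z = Im w -> z = w.
Proof. by case: z w => [? ?] [? ?] /= -> ->. Qed.

Definition cis t : R[i] := cos t +i* sin t.

Definition cexp z : R[i] := (expR (Re z))%:C * cis (Im z).

Lemma nc_cis t : `‖cis t‖ = 1.
Proof. by rewrite /= cos2Dsin2 sqrtr1. Qed.

Lemma nc_cexp z : `‖cexp z‖ = expR (Re z).
Proof. by rewrite normcM nc_cis mulr1 nc_realp ?expR_ge0. Qed.

Lemma cexpD z w : cexp (z + w) = cexp z * cexp w.
Proof.
rewrite /cexp ReD ImD expRD /cis cosD sinD.
by apply: eqC => /=; ring.
Qed.

Lemma cexp0 : cexp 0 = 1.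
Proof. by rewrite /cexp /cis /= expR0 cos0 sin0 mul1r. Qed.

Lemma rderM (U V : R -> R[i]) t (c d : R[i]) : rder U t c -> rder V t d ->
  rder (fun s => U s * V s) t (c * V t + U t * d).
Proof.
move=> [u1 u2] [v1 v2]; split.
  have -> : (fun s => Re (U s * V s)) =
      (fun s => Re (U s)) * (fun s => Re (V s)) - (fun s => Im (U s)) * (fun s => Im (V s)).
    by apply/funext => s; rewrite !fctE; case: (U s) (V s) => [? ?] [? ?].
  apply: (is_derive_eq (is_deriveB (is_deriveM u1 v1) (is_deriveM u2 v2))).
  case: c d (U t) (V t) {u1 u2 v1 v2} => [? ?] [? ?] [? ?] [? ?] /=.
  by rewrite /GRing.scale /=; ring.
have -> : (fun s => Im (U s * V s)) =
    (fun s => Re (U s)) * (fun s => Im (V s)) + (fun s => Im (U s)) * (fun s => Re (V s)).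
  by apply/funext => s; rewrite !fctE; case: (U s) (V s) => [? ?] [? ?].
apply: (is_derive_eq (is_deriveD (is_deriveM u1 v2) (is_deriveM u2 v1))).
case: c d (U t) (V t) {u1 u2 v1 v2} => [? ?] [? ?] [? ?] [? ?] /=.
by rewrite /GRing.scale /=; ring.
Qed.

Lemma rder_real (f : R -> R) t d : is_derive t 1 f d ->
  rder (fun s => (f s)%:C) t d%:C.
Proof. by move=> fd; split => //=; exact: is_derive_cst. Qed.

Lemma rder_cis t : rder cis t ('i * cis t).
Proof.
split => /=.
  by apply: (is_derive_eq (is_derive_cos t)); ring.
by apply: (is_derive_eq (is_derive_sin t)); ring.
Qed.

Lemma is_derive_scale (f : R -> R) t (a d : R) : is_derive (t * a) 1 f d ->
  is_derive t 1 (fun s => f (s * a)) (d * a).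
Proof.
move=> fd; have ha : is_derive t 1 (fun s => s * a) a.
  rewrite (_ : (fun s => s * a) = a *: id); last first.
    by apply/funext => s; rewrite fctE /= mulrC.
  apply: (is_derive_eq (is_deriveZ a (is_derive_id t 1))).
  by rewrite /GRing.scale /= mulr1.
exact: (@is_derive1_comp _ f (fun s => s * a)).
Qed.

Lemma rder_cexp_line h t :
  rder (fun s => cexp (s%:C * h)) t (h * cexp (t%:C * h)).
Proof.
case: h => a b.
have -> : (fun s => cexp (s%:C * (a +i* b))) = (fun s => (expR (s * a))%:C * cis (s * b)).
  by apply/funext => s; rewrite /cexp /=; simpc.
have d1 := rder_real (is_derive_scale (is_derive_expR (t * a))).
have d2 : rder (fun s => cis (s * b)) t ('i * cis (t * b) * b%:C).
  have [c1 c2] := rder_cis (t * b).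
  split.
    by apply: (is_derive_eq (is_derive_scale c1)); rewrite /=; simpc; rewrite /=; ring.
  by apply: (is_derive_eq (is_derive_scale c2)); rewrite /=; simpc; rewrite /=; ring.
have := rderM d1 d2; congr rder.
by rewrite /cexp /=; simpc; apply: eqC => /=; ring.
Qed.

Lemma ctsR_part (f : R -> R[i]) : continuous (fun t => Re (f t)) ->
  continuous (fun t => Im (f t)) -> ctsR f.
Proof. by move=> c1 c2 t; apply: tends_ReIm; [exact: c1|exact: c2]. Qed.

Lemma tends_real (T : Type) (F : set_system T) {FF : Filter F} (f : T -> R) (l : R) :
  f @ F --> l -> tends F (fun x => (f x)%:C) l%:C.
Proof. by move=> fl; apply: tends_ReIm => //=; exact: cvg_cst. Qed.

Lemma cts_cexp z : cts cexp z.
Proof.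
have cr : (fun w => Re w) @ z --> Re z
  by exact: (tends_part (@Re_lip R) (@cts_id R z)).
have ci : (fun w => Im w) @ z --> Im z
  by exact: (tends_part (@Im_lip R) (@cts_id R z)).
apply: tendsM.
  by apply: tends_real; exact: (cvg_comp _ _ cr (@continuous_expR R (Re z))).
apply: tends_ReIm => /=.
  exact: (cvg_comp _ _ ci (@continuous_cos R (Im z))).
exact: (cvg_comp _ _ ci (@continuous_sin R (Im z))).
Qed.

(** On the segment from 0 to h the curve cexp (s h) - s h has the small
   derivative h (cexp (s h) - 1), which gives the derivative at the origin; the
   addition formula transports it everywhere. *)
Lemma cder_cexp z : cder cexp z (cexp z).
Proof.
have d0 : cder cexp 0 1.
  apply/cder_eps => e e0.
  have /nbhsCP[d d0 dP] := cts_cexp 0 e0.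
  apply/nbhsCP; exists d => // h; rewrite !subr0 mul1r => hd.
  have := @mean_value_le R (fun s => cexp (s%:C * h) - s%:C * h)
    (fun s => h * (cexp (s%:C * h) - 1)) 0 1 (e * `‖h‖) ler01.
  rewrite !mul1r !mul0r cexp0 !subr0 mulr1 addrAC; apply.
    move=> t _; rewrite mulrBr mulr1; apply: rderD; first exact: rder_cexp_line.
    rewrite (_ : (fun s => _) = (fun s => (- h) * s%:C)); last first.
      by apply/funext => s; rewrite mulNr mulrC.
    rewrite -[X in rder _ _ X]mulr1; apply: rderZ.
    exact: (rder_real (is_derive_id t 1)).
  move=> t /andP[t0 t1]; rewrite normcM mulrC ler_wpM2r ?nc_ge0 //.
  rewrite -cexp0; apply/ltW/dP; rewrite subr0 normcM nc_realp //.
  by apply: le_lt_trans hd; rewrite ler_piMl // nc_ge0.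
have := cderZ (cexp z) (cder_comp (g := fun w => - z + 1 * w) (z := z) (f := cexp) (c := 1) (d := 1) _ (cder_affine (-z) 1 z)).
rewrite !mulr1; have -> : - z + 1 * z = 0 by ring.
move=> /(_ d0); apply: cder_near; apply: nearCW => w /=.
by rewrite -cexpD; congr cexp; ring.
Qed.

End ComplexExponential.

(** * Goursat's lemma *)

Arguments normc {R} x : simpl never.
Arguments integ {R} u a b : simpl never.

Section Goursat.
Variable R : realType.
Implicit Types (F : R[i] -> R[i]) (x y : R).

(** The integral of F dz along the boundary of [x0, x1] x [y0, y1]. *)
Definition rect_bd F x0 x1 y0 y1 : R[i] :=
  integ (fun x => F (x +i* y0)) x0 x1 - integ (fun x => F (x +i* y1)) x0 x1 +
  'i * (integ (fun y => F (x1 +i* y)) y0 y1 - integ (fun y => F (x0 +i* y)) y0 y1).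

Lemma ctsR_hline y : ctsR (fun x => x +i* y : R[i]).
Proof. by apply: ctsR_part => t /=; [exact: cvg_id|exact: cvg_cst]. Qed.

Lemma ctsR_vline x : ctsR (fun y => x +i* y : R[i]).
Proof. by apply: ctsR_part => t /=; [exact: cvg_cst|exact: cvg_id]. Qed.

Lemma cts_hline F y : (forall z, cts F z) -> ctsR (fun x => F (x +i* y)).
Proof. by move=> cF; exact: ctsR_comp (ctsR_hline y). Qed.

Lemma cts_vline F x : (forall z, cts F z) -> ctsR (fun y => F (x +i* y)).
Proof. by move=> cF; exact: ctsR_comp (ctsR_vline x). Qed.

Lemma rect_bd_hsplit F x0 xm x1 y0 y1 : (forall z, cts F z) ->
  x0 <= xm -> xm <= x1 ->
  rect_bd F x0 x1 y0 y1 = rect_bd F x0 xm y0 y1 + rect_bd F xm x1 y0 y1.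
Proof.
move=> cF h1 h2; rewrite /rect_bd.
by rewrite -!(integ_add h1 h2 (cts_hline _ cF)); ring.
Qed.

Lemma rect_bd_vsplit F x0 x1 y0 ym y1 : (forall z, cts F z) ->
  y0 <= ym -> ym <= y1 ->
  rect_bd F x0 x1 y0 y1 = rect_bd F x0 x1 y0 ym + rect_bd F x0 x1 ym y1.
Proof.
move=> cF h1 h2; rewrite /rect_bd.
by rewrite -!(integ_add h1 h2 (cts_vline _ cF)); ring.
Qed.

Lemma rect_bd_le F x0 x1 y0 y1 M : (forall z, cts F z) ->
  x0 <= x1 -> y0 <= y1 ->
  (forall x y, x0 <= x <= x1 -> y0 <= y <= y1 -> `‖F (x +i* y)‖ <= M) ->
  `‖rect_bd F x0 x1 y0 y1‖ <= M * (2 * (x1 - x0) + 2 * (y1 - y0)).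
Proof.
move=> cF h1 h2 FM; have i1 : x0 <= x0 <= x1 by rewrite lexx.
have i2 : x0 <= x1 <= x1 by rewrite lexx andbT.
have j1 : y0 <= y0 <= y1 by rewrite lexx.
have j2 : y0 <= y1 <= y1 by rewrite lexx andbT.
apply: (le_trans (nc_triangle _ _)); rewrite normcM nc_i mul1r mulrDr.
apply: lerD; apply: (le_trans (nc_sub_le _ _)); rewrite mulrCA mulr_natl mulr2n.
  by apply: lerD; apply: integ_le h1 (cts_hline _ cF) _ => t h; exact: FM.
by apply: lerD; apply: integ_le h2 (cts_vline _ cF) _ => t h; exact: FM.
Qed.

Lemma rect_bd_sub F A B x0 x1 y0 y1 : (forall z, cts F z) ->
  x0 <= x1 -> y0 <= y1 ->
  rect_bd (fun z => F z - (A + B * z)) x0 x1 y0 y1 = rect_bd F x0 x1 y0 y1.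
Proof.
move=> cF h1 h2; pose L z : R[i] := A + B * z.
have cL z : cts L z by exact: cder_cts (cder_affine A B z).
have E : rect_bd L x0 x1 y0 y1 = 0.
  rewrite /rect_bd -(integB h1 (cts_hline y0 cL) (cts_hline y1 cL)).
  rewrite -(integB h2 (cts_vline x1 cL) (cts_vline x0 cL)).
  rewrite (@eq_integ _ _ (fun=> B * (y0 - y1)%:C * 'i)); last first.
    by move=> t _; rewrite /L -mulrA (_ : (y0 - y1)%:C * 'i = (t +i* y0) - (t +i* y1));
      [ring|apply: eqC => /=; ring].
  rewrite (@eq_integ _ (fun y => L (x1 +i* y) - _) (fun=> B * (x1 - x0)%:C)); last first.
    by move=> t _; rewrite /L (_ : (x1 - x0)%:C = (x1 +i* t) - (x0 +i* t));
      [ring|apply: eqC => /=; ring].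
  by rewrite !integ_cst // !rmorphB /=; ring.
rewrite -[RHS]subr0 -E /rect_bd -/(L _).
have hB y := integB h1 (cts_hline y cF) (cts_hline y cL).
have vB x := integB h2 (cts_vline x cF) (cts_vline x cL).
rewrite /L in hB vB *; rewrite !hB !vB.
by ring.
Qed.

(** The boundary integral is the sum of those over the four quarters, of which one
   must carry at least a quarter. *)
Lemma rect_bd_quarter F (a b : R) : (forall z, cts F z) -> 0 <= a -> 0 <= b ->
  forall (p : R * R) (h : R), 0 <= h -> exists q : R * R,
    [/\ p.1 <= q.1 <= q.1 + h / 2 * a, q.1 + h / 2 * a <= p.1 + h * a,
        p.2 <= q.2 <= q.2 + h / 2 * b, q.2 + h / 2 * b <= p.2 + h * b &
        `‖rect_bd F p.1 (p.1 + h * a) p.2 (p.2 + h * b)‖ <=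
        4 * `‖rect_bd F q.1 (q.1 + h / 2 * a) q.2 (q.2 + h / 2 * b)‖].
Proof.
move=> cF a0 b0 [x y] h h0 /=.
have k0 : 0 <= h / 2 * a by rewrite !mulr_ge0 // invr_ge0.
have l0 : 0 <= h / 2 * b by rewrite !mulr_ge0 // invr_ge0.
have ka : h * a = h / 2 * a + h / 2 * a by field.
have lb : h * b = h / 2 * b + h / 2 * b by field.
set k := h / 2 * a in k0 ka *; set l := h / 2 * b in l0 lb *.
rewrite ka lb !addrA.
have xk : x <= x + k by rewrite lerDl.
have yl : y <= y + l by rewrite lerDl.
have xkk : x + k <= x + k + k by rewrite lerDl.
have yll : y + l <= y + l + l by rewrite lerDl.
rewrite (rect_bd_hsplit y (y + l + l) cF xk xkk).
rewrite (rect_bd_vsplit x (x + k) cF yl yll).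
rewrite (rect_bd_vsplit (x + k) (x + k + k) cF yl yll).
set A := rect_bd _ x _ y _; set B := rect_bd _ x _ _ _.
set C := rect_bd _ _ _ y _; set D := rect_bd _ _ _ _ _.
have T : `‖A + B + (C + D)‖ <= `‖A‖ + `‖B‖ + (`‖C‖ + `‖D‖).
  by apply: (le_trans (nc_triangle _ _)); apply: lerD; exact: nc_triangle.
have xa : x <= x <= x + k by rewrite lexx.
have xb : x <= x + k <= x + k + k by rewrite xk.
have ya : y <= y <= y + l by rewrite lexx.
have yb : y <= y + l <= y + l + l by rewrite yl.
have [h1|h1] := leP `‖A + B + (C + D)‖ (4 * `‖A‖); first by exists (x, y); split.
have [h2|h2] := leP `‖A + B + (C + D)‖ (4 * `‖B‖).
  by exists (x, y + l); split => //; exact: lexx.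
have [h3|h3] := leP `‖A + B + (C + D)‖ (4 * `‖C‖).
  by exists (x + k, y); split => //; exact: lexx.
have h4 : `‖A + B + (C + D)‖ <= 4 * `‖D‖.
  move: T h1 h2 h3; move: (normc (A + B + (C + D))) (normc A) (normc B) (normc C) (normc D).
  by clear; move=> n a' b' c' d' ? ? ? ?; lra.
by exists (x + k, y + l); split => //; exact: lexx.
Qed.

(** Goursat's lemma.  Repeated quartering pins down a point near which F is
   affine up to a small relative error, and affine functions integrate to zero
   along rectangles. *)
Lemma goursat F x0 y0 (a b : R) : (forall z, cts F z) -> 0 <= a -> 0 <= b ->
  (forall x y, x0 <= x <= x0 + a -> y0 <= y <= y0 + b ->
     exists c, cder F (x +i* y) c) ->
  rect_bd F x0 (x0 + a) y0 (y0 + b) = 0.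
Proof.
move=> cF a0 b0 dF.
pose h n : R := 2^-1 ^+ n.
have h0 n : 0 <= h n by rewrite exprn_ge0 // invr_ge0.
have hS n : h n.+1 = h n / 2 by rewrite /h exprSr.
have [nxt nxtP] := choice (fun pn : (R * R) * nat =>
  rect_bd_quarter cF a0 b0 pn.1 (h0 pn.2)).
pose P := fix P n := if n is m.+1 then nxt (P m, m) else (x0, y0).
have PP n := nxtP (P n, n).
have mono1 n m : (P n).1 <= (P (n + m)%N).1 /\
    (P (n + m)%N).1 + h (n + m)%N * a <= (P n).1 + h n * a.
  elim: m => [|m [i1 i2]]; first by rewrite addn0.
  rewrite addnS hS; have [/andP[j1 _] j2 _ _ _] := PP (n + m)%N.
  by split; [exact: le_trans j1|exact: le_trans i2].
have mono2 n m : (P n).2 <= (P (n + m)%N).2 /\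
    (P (n + m)%N).2 + h (n + m)%N * b <= (P n).2 + h n * b.
  elim: m => [|m [i1 i2]]; first by rewrite addn0.
  rewrite addnS hS; have [_ _ /andP[j1 _] j2 _] := PP (n + m)%N.
  by split; [exact: le_trans j1|exact: le_trans i2].
have nested (p : nat -> R) (c : R) : 0 <= c ->
    (forall n m, p n <= p (n + m)%N /\ p (n + m)%N + h (n + m)%N * c <= p n + h n * c) ->
    exists s, forall n, p n <= s <= p n + h n * c.
  move=> c0 pP; pose s := sup (range p).
  have ub n : ubound (range p) (p n + h n * c).
    move=> _ [m _ <-]; have [nm|/ltnW mn] := leqP n m.
      have [_] := pP n (m - n)%N; rewrite subnKC //; apply: le_trans.
      by rewrite lerDl mulr_ge0.
    have [+ _] := pP m (n - m)%N; rewrite subnKC // => /le_trans; apply.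
    by rewrite lerDl mulr_ge0.
  exists s => n; apply/andP; split.
    by apply: ub_le_sup; [exists (p 0%N + h 0%N * c)|exists n].
  by apply: ge_sup; [exists (p 0%N); exists 0%N|exact: ub].
have [x xP] := nested (fun n => (P n).1) a a0 mono1.
have [y yP] := nested (fun n => (P n).2) b b0 mono2.
have hh0 : h 0%N = 1 by rewrite /h expr0.
have [c cF'] : exists c, cder F (x +i* y) c.
  by apply: dF; [have := xP 0%N|have := yP 0%N]; rewrite hh0 mul1r.
pose E n := rect_bd F (P n).1 ((P n).1 + h n * a) (P n).2 ((P n).2 + h n * b).
have E4 n : `‖E 0%N‖ <= 4 ^+ n * `‖E n‖.
  elim: n => [|n IH]; first by rewrite expr0 mul1r.
  apply: (le_trans IH); rewrite exprSr -mulrA ler_wpM2l ?exprn_ge0 //.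
  by have [_ _ _ _] := PP n; rewrite /E hS.
rewrite (_ : rect_bd _ _ _ _ _ = E 0%N); last by rewrite /E hh0 !mul1r.
apply/eqP; rewrite -nc_eq0 eq_le nc_ge0 andbT.
apply/ler_addgt0Pl => e e0; rewrite addr0.
pose S := a + b + 1; have S0 : 0 < S by rewrite ltr_wpDl // addr_ge0.
have e1 : 0 < e / (2 * S ^+ 2) by rewrite divr_gt0 // mulr_gt0 // exprn_gt0.
have /nbhsCP[d d0 dP] := (cder_eps F (x +i* y) c).1 cF' _ e1.
have [n nd] : exists n, h n * S < d.
  have i1 : `|2^-1 : R| < 1 by rewrite ger0_norm ?invr_ge0 // invf_lt1 // ltr1n.
  have /cvgrPdist_lt H := cvg_expr i1.
  have [n _ /(_ n (leqnn n))] := H _ (divr_gt0 d0 S0).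
  rewrite sub0r normrN ger0_norm; last exact: h0.
  by move=> /= hn; exists n; rewrite -ltr_pdivlMr.
have close u v : (P n).1 <= u <= (P n).1 + h n * a ->
    (P n).2 <= v <= (P n).2 + h n * b -> `‖(u +i* v) - (x +i* y)‖ <= h n * S.
  move=> /andP[u1 u2] /andP[v1 v2].
  have /andP[x1 x2] := xP n; have /andP[y1 y2] := yP n.
  apply: (le_trans (nc_ReIm _)); rewrite /S !mulrDr mulr1.
  rewrite -[leLHS]addr0 lerD //; apply: lerD; rewrite /= ler_norml; apply/andP; split; lra.
apply: (le_trans (E4 n)).
have hn0 := h0 n.
have x01 : (P n).1 <= (P n).1 + h n * a by rewrite lerDl mulr_ge0.
have y01 : (P n).2 <= (P n).2 + h n * b by rewrite lerDl mulr_ge0.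
rewrite /E -(rect_bd_sub (F (x +i* y) - c * (x +i* y)) c cF x01 y01).
apply: (@le_trans _ _ (4 ^+ n * (e / (2 * S ^+ 2) * (h n * S) *
   (2 * ((P n).1 + h n * a - (P n).1) + 2 * ((P n).2 + h n * b - (P n).2))))).
  rewrite ler_wpM2l ?exprn_ge0 //; apply: rect_bd_le => //.
    move=> z; apply: tendsB; first exact: cF.
    exact: (cder_cts (cder_affine _ c z)).
  move=> u v hu hv; have cl := close u v hu hv.
  rewrite (_ : _ - _ = F (u +i* v) - F (x +i* y) - c * ((u +i* v) - (x +i* y))); last by ring.
  apply: (le_trans (dP _ (le_lt_trans cl nd))).
  by rewrite ler_wpM2l // ltW.
have -> : 4 ^+ n = (h n) ^- 2.
  by rewrite /h -exprM mulnC exprM -exprVn; congr (_ ^+ n); rewrite exprVn invrK; ring.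
have hn : h n != 0 by rewrite expf_neq0 // invr_eq0.
rewrite (_ : (_ * _)%R = e * ((a + b) / S)); last by field; rewrite hn gt_eqF.
by rewrite ler_piMr ?(ltW e0) // ler_pdivrMr // mul1r lerDl.
Qed.

End Goursat.

(** * Circle integrals *)

Section CircleIntegrals.
Variable R : realType.
Implicit Types (f g G : R[i] -> R[i]) (z w : R[i]) (r t : R).

Lemma tends_fst (T S : Type) (F : set_system T) (G : set_system S)
    {FF : Filter F} {FG : Filter G} (f : T -> R[i]) (l : R[i]) :
  tends F f l -> tends (filter_prod F G) (fun p => f p.1) l.
Proof. by move=> fl e e0; apply: (cvg_fst (fl e e0)). Qed.

Lemma tends_snd (T S : Type) (F : set_system T) (G : set_system S)
    {FF : Filter F} {FG : Filter G} (f : S -> R[i]) (l : R[i]) :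
  tends G f l -> tends (filter_prod F G) (fun p => f p.2) l.
Proof. by move=> fl e e0; apply: (cvg_snd (fl e e0)). Qed.

(** Joint continuity at every point of the compact interval of integration
   upgrades to uniform closeness, hence to convergence of the integrals. *)
Lemma tends_integ (T : Type) (F : set_system T) {FF : Filter F}
    (u : T -> R -> R[i]) (v : R -> R[i]) (a b : R) : a <= b ->
  (\forall i \near F, ctsR (u i)) -> ctsR v ->
  (forall t, a <= t <= b -> tends (filter_prod (nbhs t) F) (fun p => u p.2 p.1) (v t)) ->
  tends F (fun i => integ (u i) a b) (integ v a b).
Proof.
move=> ab cu cv uv e e0; pose d := e / (b - a + 1).
have ba : 0 < b - a + 1 by rewrite ltr_wpDl // subr_ge0.
have d0 : 0 < d by rewrite divr_gt0.
have : \forall i \near F, `[a, b] `<=` (fun t => `‖u i t - v t‖ < d).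
  have /compact_near_coveringP := @segment_compact R a b.
  apply => // t; rewrite /= in_itv /= => /uv utv.
  have : tends (filter_prod (nbhs t) F) (fun p => u p.2 p.1 - v p.1) (v t - v t).
    by exact: (tendsB utv (tends_fst (cv t))).
  rewrite subrr => /(_ d d0).
  by apply: filterS => -[s i] /=; rewrite subr0.
move=> H; near=> i.
have ci : ctsR (u i) by near: i.
rewrite -(integB ab ci cv); apply: (@le_lt_trans _ _ (d * (b - a))).
  apply: integ_le => //; first exact: ctsRB.
  move=> t tab; apply/ltW; have : `[a, b]%classic t by rewrite /= in_itv.
  by move: t {tab}; near: i.
rewrite /d mulrAC ltr_pdivrMr // ltr_pM2l //; lra.
Unshelve. all: by end_near. Qed.

Definition circ r t : R[i] := r%:C * cis t.

Definition cint r G : R[i] := integ (fun t => G (circ r t)) 0 (2 * pi).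

Lemma cexp_circ x y : cexp (x +i* y) = circ (expR x) y.
Proof. by []. Qed.

Lemma ctsR_circ r : ctsR (circ r).
Proof.
apply: ctsRZ; apply: ctsR_part => t /=; [exact: continuous_cos|exact: continuous_sin].
Qed.

Lemma two_pi_ge0 : 0 <= 2 * pi :> R.
Proof. by rewrite mulr_ge0 // ltW // pi_gt0. Qed.

Lemma two_pi_neq0 : (2 * pi)%:C != 0 :> R[i].
Proof. by rewrite -nc_gt0 nc_realp ?two_pi_ge0 // mulr_gt0 // pi_gt0. Qed.

Lemma cis2pi : cis (2 * pi) = 1 :> R[i].
Proof. by rewrite /cis mulr_natl cos2pi sin2pi. Qed.

Lemma cis0 : cis 0 = 1 :> R[i].
Proof. by rewrite /cis cos0 sin0. Qed.

Lemma clamp_lip (a b x y : R) :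
  `|Num.max a (Num.min b x) - Num.max a (Num.min b y)| <= `|x - y|.
Proof.
have lip m u v : (m = Num.max a \/ m = Num.min b) -> `|m u - m v| <= `|u - v|.
  have n1 := ler_norm (u - v); have n2 := ler_norm (v - u); rewrite distrC in n2.
  case=> ->.
    by case: (leP a u) => h1; case: (leP a v) => h2; rewrite ler_norml; lra.
  by case: (leP b u) => h1; case: (leP b v) => h2; rewrite ler_norml; lra.
by apply: (le_trans (lip _ _ _ (or_introl erefl))); exact: lip (or_intror erefl).
Qed.

(** In logarithmic polar coordinates an annulus becomes a rectangle whose
   horizontal sides cancel by periodicity, so Goursat's lemma compares the two
   vertical sides: the mean over a circle does not depend on its radius.  The
   real part is clamped to extend the integrand continuously. *)
Lemma cint_radius G (p0 p1 r0 r1 : R) : 0 <= p0 ->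
  (forall z, p0 < `‖z‖ < p1 -> exists c, cder G z c) ->
  p0 < r0 -> r0 <= r1 -> r1 < p1 -> cint r0 G = cint r1 G.
Proof.
move=> p00 dG h0 h1 h2.
pose q0 := (p0 + r0) / 2; pose q1 := (p1 + r1) / 2.
have q00 : 0 < q0 by rewrite /q0; lra.
have q10 : 0 < q1 by rewrite /q1; lra.
have r00 : 0 < r0 by lra.
have r10 : 0 < r1 by lra.
pose cl z : R[i] := (Num.max (ln q0) (Num.min (ln q1) (Re z))) +i* (Im z).
have ccl z : cts cl z.
  move=> e e0; apply/nbhsCP; exists (e / 2) => [|w wz]; first by rewrite divr_gt0.
  apply: (le_lt_trans (nc_ReIm _)); rewrite ReB ImB /= [e]splitr.
  apply: ltrD; last exact: le_lt_trans (Im_lip _ _) wz.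
  exact: le_lt_trans (le_trans (clamp_lip _ _ _ _) (Re_lip _ _)) wz.
pose F z := G (cexp (cl z)).
have ann z : p0 < `‖cexp (cl z)‖ < p1.
  rewrite nc_cexp /=; apply/andP; split.
    apply: (@lt_le_trans _ _ q0); first by rewrite /q0; lra.
    by rewrite -[leLHS]lnK ?posrE // ler_expR le_max lexx.
  apply: (@le_lt_trans _ _ q1); last by rewrite /q1; lra.
  rewrite -[leRHS]lnK ?posrE // ler_expR ge_max ge_min lexx /= andbT ler_ln ?posrE //.
  by rewrite /q0 /q1; lra.
have cF z : cts F z.
  have [c /cder_cts cG] := dG _ (ann z).
  exact: (cts_comp (f := G) (g := @cexp R \o cl) cG
           (cts_comp (f := @cexp R) (g := cl) (cts_cexp _) (ccl z))).
have in_cl z : ln q0 < Re z < ln q1 -> cl z = z.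
  move=> /andP[/ltW i1 /ltW i2]; case: z i1 i2 => x y /= i1 i2.
  by rewrite /cl /= (min_idPr i2) (max_idPr i1).
have lr x : r0 <= x <= r1 -> ln q0 < ln x < ln q1.
  move=> /andP[i1 i2]; have x0 : 0 < x by lra.
  by rewrite !ltr_ln ?posrE // /q0 /q1; apply/andP; split; lra.
have a0 : 0 <= ln r1 - ln r0 by rewrite subr_ge0 ler_ln ?posrE.
have in_r z : ln r0 <= Re z <= ln r1 -> ln q0 < Re z < ln q1.
  move=> /andP[i1 i2].
  have /andP[j1 _] : ln q0 < ln r0 < ln q1 by apply: lr; rewrite lexx.
  have /andP[_ j2] : ln q0 < ln r1 < ln q1 by apply: lr; rewrite lexx andbT.
  by rewrite (lt_le_trans j1) ?(le_lt_trans i2).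
have := goursat (x0 := ln r0) (y0 := 0) cF a0 two_pi_ge0 _.
rewrite add0r addrC subrK /rect_bd.
rewrite (@eq_integ _ (fun x => F (x +i* 0)) (fun x => F (x +i* (2 * pi)))); last first.
  move=> x _; rewrite /F; congr G.
  by rewrite /cl /= !cexp_circ /circ cis2pi cis0.
rewrite subrr add0r => H.
have {H} /eqP : 'i * (integ (fun y : R => F (ln r1 +i* y)) 0 (2 * pi) -
   integ (fun y : R => F (ln r0 +i* y)) 0 (2 * pi)) = 0 :> R[i].
  apply: H => x y xr _; have xq : ln q0 < Re (x +i* y) < ln q1 by apply: in_r.
  have [c dc] := dG _ (ann (x +i* y)); rewrite (in_cl _ xq) in dc.
  exists (c * cexp (x +i* y)).
  apply: (@cder_near _ (G \o (@cexp R))); last exact: cder_comp (cder_cexp _).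
  have cr : (fun w => Re w) @ (x +i* y) --> x
    by exact: (tends_part (@Re_lip R) (@cts_id R (x +i* y))).
  move/andP: xq => /= [xq1 xq2].
  near=> w; rewrite /F /= in_cl //; apply/andP; split; near: w.
    exact: (cvgr_gt _ cr).
  exact: (cvgr_lt _ cr).
rewrite mulf_eq0 subr_eq0 => /orP[/eqP/(congr1 (@normc R))|/eqP E].
  by rewrite nc_i nc0 => /eqP; rewrite oner_eq0.
have cE x : r0 <= x <= r1 -> cint x G = integ (fun y : R => F (ln x +i* y)) 0 (2 * pi).
  move=> xr; have x0 : x \is Num.pos by rewrite posrE; case/andP: xr; lra.
  rewrite /cint; apply: eq_integ => t _; rewrite /F in_cl; last exact: lr.
  by rewrite cexp_circ (lnK x0).
have i0 : r0 <= r0 <= r1 by rewrite lexx.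
have i1 : r0 <= r1 <= r1 by rewrite lexx andbT.
exact: etrans (cE r0 i0) (etrans (esym E) (esym (cE r1 i1))).
Unshelve. all: by end_near. Qed.

End CircleIntegrals.

(** * Cauchy's formula *)

Section CauchyFormula.
Variable R : realType.
Implicit Types (f g G : R[i] -> R[i]) (z w : R[i]) (r s t : R) (k : R -> R[i]).

Lemma nc_circ_abs r t : `‖circ r t‖ = `|r|.
Proof. by rewrite normcM nc_cis mulr1 nc_real. Qed.

Lemma ctsR_cis : ctsR (@cis R).
Proof.
by apply: ctsR_part => t /=; [exact: continuous_cos|exact: continuous_sin].
Qed.

Lemma tends_circ r t :
  tends (filter_prod (nbhs t) (nbhs r)) (fun p => circ p.2 p.1) (circ r t).
Proof.
apply: tendsM; last exact: (tends_fst (ctsR_cis t)).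
apply: (@tends_snd R R R (nbhs t) (nbhs r) _ _ (fun s => s%:C)).
by apply: tends_real; exact: cvg_id.
Qed.

Lemma ctsR_circ_comp G r : `|r| < 1 -> (forall z, `‖z‖ < 1 -> cts G z) ->
  ctsR (fun t => G (circ r t)).
Proof.
move=> r1 cG; apply: ctsR_comp (ctsR_circ r) => t.
by apply: cG; rewrite nc_circ_abs.
Qed.

Lemma tends_cint G r : `|r| < 1 -> (forall z, `‖z‖ < 1 -> cts G z) ->
  tends (nbhs r) (fun s => cint s G) (cint r G).
Proof.
move=> r1 cG; apply: tends_integ.
- exact: two_pi_ge0.
- have : \forall s \near r, `|s| < 1.
    have /(_ r) := @norm_continuous R R^o; move/cvgr_lt; exact.
  by apply: filterS => s s1; exact: ctsR_circ_comp.
- exact: ctsR_circ_comp.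
- move=> t _.
  apply: (@tends_comp _ _ _ _ G (fun p => circ p.2 p.1) (circ r t)).
    by apply: cG; rewrite nc_circ_abs.
  exact: tends_circ.
Qed.

(** Circle integrals depend continuously on the radius, so radii whose circles
   carry points where G is merely continuous are reached in the limit. *)
Lemma cint_const G (p q : R) : 0 <= p -> p < q -> q < 1 ->
  (forall z, `‖z‖ < 1 -> cts G z) ->
  (forall z, p < `‖z‖ < q -> exists c, cder G z c) ->
  cint p G = cint q G.
Proof.
move=> p0 pq q1 cG dG; pose m := (p + q) / 2.
have E s : p < s < q -> cint s G = cint m G.
  move=> /andP[ps sq]; have [sm|/ltW ms] := leP s m.
    by apply: (cint_radius p0 dG) => //; rewrite /m; lra.
  by apply/esym; apply: (cint_radius p0 dG) => //; rewrite /m; lra.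
have lim r : p <= r <= q -> cint r G = cint m G.
  move=> /andP[pr rq]; have r1 : `|r| < 1 by rewrite ger0_norm; lra.
  apply/eqP; rewrite -subr_eq0 -nc_eq0 eq_le nc_ge0 andbT.
  apply/ler_addgt0Pl => e e0; rewrite addr0.
  have /nbhs_ballP[d /= d0 dP] := tends_cint r1 cG e0.
  pose h := Num.min (d / 2) ((q - p) / 2) / 2.
  have h0 : 0 < h by rewrite divr_gt0 // lt_min !divr_gt0 // subr_gt0.
  have hd : h < d.
    rewrite /h ltr_pdivrMr // gt_min; apply/orP; left; lra.
  have hq : h <= (q - p) / 4.
    rewrite /h ler_pdivrMr // ge_min; apply/orP; right; lra.
  have [rm|mr] := leP r m.
    rewrite -(E (r + h)); last by rewrite /m in rm; apply/andP; split; lra.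
    rewrite nc_subC; apply/ltW/dP; rewrite /ball /= opprD addrA subrr sub0r normrN.
    by rewrite ger0_norm ?ltW.
  rewrite -(E (r - h)); last by rewrite /m in mr; apply/andP; split; lra.
  rewrite nc_subC; apply/ltW/dP; rewrite /ball /= opprB addrC subrK.
  by rewrite ger0_norm ?ltW.
by rewrite (lim p) ?(lim q) // ?lexx ?(ltW pq).
Qed.

Lemma cint0 G : cint 0 G = G 0 * (2 * pi)%:C.
Proof.
rewrite /cint (@eq_integ _ _ (fun=> G 0)).
  by rewrite integ_cst ?two_pi_ge0 // subr0.
by move=> t _; rewrite /circ mul0r.
Qed.

Lemma mean_value G r : holo G -> 0 <= r < 1 -> cint r G = G 0 * (2 * pi)%:C.
Proof.
move=> hG /andP[]; rewrite le_eqVlt => /predU1P[<- _|r0 r1]; first exact: cint0.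
rewrite -cint0; apply/esym; apply: cint_const => //.
- by move=> z z1; exact: holo_cts.
- by move=> z /andP[_ zr]; apply: hG; exact: lt_trans r1.
Qed.

Lemma circ_sub_neq0 r t z : `‖z‖ < r -> circ r t - z != 0.
Proof.
move=> zr; rewrite subr_eq0; apply: contraTneq zr => <-.
by rewrite nc_circ_abs -leNgt ler_norm.
Qed.

(** Conjugation turns the kernel z/(z - w) on the circle into a function
   holomorphic inside, to which the mean value property applies. *)
Lemma integ_kernel r z : `‖z‖ < r ->
  integ (fun t => circ r t / (circ r t - z)) 0 (2 * pi) = (2 * pi)%:C.
Proof.
move=> zr; have r0 : 0 < r by exact: le_lt_trans (nc_ge0 z) zr.
pose w := z / r%:C; have w1 : `‖w‖ < 1.
  by rewrite nc_div nc_realp ?ltW // ltr_pdivrMr // mul1r.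
pose p := (1 + `‖w‖) / 2; have nw := nc_ge0 w.
have p0 : 0 < p by rewrite /p; lra.
have p1 : 0 <= p < 1 by rewrite /p; lra.
pose v : R[i] := w^* * (p^-1)%:C; have wp : `‖v‖ < 1.
  by rewrite /v normcM nc_conj nc_realp ?invr_ge0 ?ltW // ltr_pdivrMr // mul1r /p; lra.
pose H (x : R[i]) : R[i] := ((1 : R[i]) - v * x)^-1.
have H0 x : `‖x‖ < 1 -> 1 - v * x != 0.
  move=> x1; rewrite subr_eq0; apply/eqP => /(congr1 (@normc R)).
  rewrite nc1 normcM => E; have : `‖v‖ * `‖x‖ < 1.
    by rewrite mulr_ilt1 ?nc_ge0.
  by rewrite -E ltxx.
have hH : holo H.
  apply: holoV => //; apply: holoB; first exact: holo_cst.
  by apply: holoZ; exact: holo_id.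
have := mean_value hH p1; rewrite /H mulr0 subr0 invr1 mul1r.
move=> /(congr1 (fun x : R[i] => x^*)); rewrite -integ_conj ?two_pi_ge0 //; last first.
  apply: (@ctsR_circ_comp H); first by case/andP: p1 => a b; rewrite ger0_norm.
  by move=> x x1; exact: holo_cts.
rewrite [X in _ = X]cj_real.
move=> <-; apply: eq_integ => t _.
have c1 : (cis t)^* = (cis t)^-1 :> R[i].
  have n0 : cis t != 0 :> R[i] by rewrite -nc_gt0 nc_cis.
  apply: (mulfI n0); rewrite mulfV // mul_conj nc_cis expr1n //.
have pn : p%:C != 0 :> R[i] by rewrite -nc_gt0 nc_realp ?ltW.
have rn : r%:C != 0 :> R[i] by rewrite -nc_gt0 nc_realp ?ltW.
have cn : cis t != 0 :> R[i] by rewrite -nc_gt0 nc_cis.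
have sn := circ_sub_neq0 t zr.
have -> : ((1 - v * circ p t)^-1)^* = (1 - w * (p^-1)%:C * (p%:C * (cis t)^-1))^-1.
  by rewrite cjV cjB cj1 cjM /v cjM conjCK /circ cjM !cj_real c1.
have -> : 1 - w * (p^-1)%:C * (p%:C * (cis t)^-1) = (r%:C * cis t - z) / (r%:C * cis t).
  have -> : (p^-1)%:C = p%:C^-1 :> R[i] by rewrite -[LHS]/(real_complex _ _) fmorphV.
  by rewrite /w; field; rewrite pn rn cn.
by rewrite invf_div.
Qed.

Definition cauchy_int k r z : R[i] :=
  integ (fun t => k t / (circ r t - z)) 0 (2 * pi).

Definition cauchy_int2 k r z : R[i] :=
  integ (fun t => k t / (circ r t - z) ^+ 2) 0 (2 * pi).

Definition cauchy_density f r t : R[i] := f (circ r t) * circ r t / (2 * pi)%:C.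

Lemma ctsR_density f r : `|r| < 1 -> (forall z, `‖z‖ < 1 -> cts f z) ->
  ctsR (cauchy_density f r).
Proof.
move=> r1 cf; apply: ctsRM; last exact: ctsR_cst.
by apply: ctsRM (ctsR_circ r); exact: ctsR_circ_comp.
Qed.

Lemma ctsR_ckernel k r z n : ctsR k -> `‖z‖ < r ->
  ctsR (fun t => k t / (circ r t - z) ^+ n).
Proof.
move=> ck zr; apply: ctsRM => //; apply: ctsRV.
  by move=> t; rewrite expf_neq0 // circ_sub_neq0.
apply: (@ctsR_comp _ (fun x => x ^+ n)) (ctsRB (ctsR_circ r) (ctsR_cst z)) => t.
exact: (cder_cts (cderX n _)).
Qed.

(** Cauchy's formula.  The difference quotient of f at z is continuous, so its
   circle integrals vanish, even across the circle through z. *)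
Lemma cauchy_formula f r z : holo f -> `‖z‖ < r -> r < 1 ->
  f z = cauchy_int (cauchy_density f r) r z.
Proof.
move=> hf zr r1; have r0 : 0 < r by exact: le_lt_trans (nc_ge0 z) zr.
have r1' : `|r| < 1 by rewrite ger0_norm // ltW.
have z1 := lt_trans zr r1.
have [c [q [cq _ fq]]] := hf z z1.
have qE w : w != z -> q w = (f w - f z) / (w - z).
  by move=> wz; rewrite fq addrC addKr mulfK // subr_eq0.
have dq w : `‖w‖ < 1 -> w != z -> exists d, cder q w d.
  move=> w1 wz; have wz' : w - z != 0 by rewrite subr_eq0.
  have df := holo_cder hf w1.
  have d1 := cderB df (cder_cst (f z) w).
  have d2 := cderV (g := fun w => w - z) wz' (cderB (cder_id w) (cder_cst z w)).
  eexists; apply: cder_near (cderM d1 d2).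
  have n0 : 0 < `‖w - z‖ by rewrite nc_gt0.
  near=> v; rewrite qE //; apply/negP => /eqP vz.
  have : `‖v - w‖ < `‖w - z‖ by near: v; exact: near_ncP.
  by rewrite vz nc_subC ltxx.
pose G w := q w * w.
have cG w : `‖w‖ < 1 -> cts G w.
  move=> w1; apply: tendsM; last exact: cts_id.
  by have [->|/(dq w w1)[d /cder_cts]] := eqVneq w z.
have dG w : `‖w‖ < 1 -> w != z -> exists d, cder G w d.
  move=> w1 wz; have [d dd] := dq w w1 wz.
  by eexists; exact: cderM dd (cder_id w).
have G0 : cint r G = 0.
  have <- : cint `‖z‖ G = cint r G.
    apply: cint_const => //; first exact: nc_ge0.
    move=> w /andP[zw wr]; apply: dG; first exact: lt_trans r1.
    by apply: contraTneq zw => ->; rewrite ltxx.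
  have [z0|z0] := eqVneq z 0; first by rewrite z0 nc0 cint0 /G mulr0 mul0r.
  have <- : cint 0 G = cint `‖z‖ G.
    apply: cint_const => //; first by rewrite nc_gt0.
    move=> w /andP[_ wz]; apply: dG; first exact: lt_trans z1.
    by apply: contraTneq wz => ->; rewrite ltxx.
  by rewrite cint0 /G mulr0 mul0r.
have cf := fun w (w1 : `‖w‖ < 1) => holo_cts hf w1.
have cK1 : ctsR (fun t => f (circ r t) * circ r t / (circ r t - z) ^+ 1).
  by apply: ctsR_ckernel => //; apply: ctsRM (ctsR_circ r); exact: ctsR_circ_comp.
have cK2 : ctsR (fun t => circ r t / (circ r t - z) ^+ 1).
  by apply: ctsR_ckernel => //; exact: ctsR_circ.
have : integ (fun t => f (circ r t) * circ r t / (circ r t - z) ^+ 1) 0 (2 * pi)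
   = f z * (2 * pi)%:C.
  apply/eqP; rewrite -subr_eq0 -(integ_kernel zr); apply/eqP.
  rewrite -[X in f z * X](@eq_integ _ (fun t => circ r t / (circ r t - z) ^+ 1)); last first.
    by move=> t _; rewrite expr1.
  rewrite -(integZ (f z) (two_pi_ge0 R) cK2).
  rewrite -(integB (two_pi_ge0 R) cK1 (ctsRZ (f z) cK2)).
  rewrite -[RHS]G0; apply: eq_integ => t _; rewrite /G qE; last first.
    by rewrite -subr_eq0 circ_sub_neq0.
  by rewrite expr1; ring.
move=> H; rewrite /cauchy_int.
rewrite (@eq_integ _ _ (fun t => (2 * pi)%:C^-1 *
  (f (circ r t) * circ r t / (circ r t - z) ^+ 1))); last first.
  by move=> t _; rewrite /cauchy_density expr1; ring.
rewrite integZ ?two_pi_ge0 // H mulrC mulfK //; exact: two_pi_neq0.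
Unshelve. all: by end_near. Qed.

(** Q is the difference quotient of the integrand in the parameter, so that
   differentiating under the integral amounts to the continuity of the integral
   of Q, which tends_integ provides. *)
Lemma cder_integ (u Q : R[i] -> R -> R[i]) z (a b : R) : a <= b ->
  (\forall w \near z, ctsR (u w)) -> (\forall w \near z, ctsR (Q w)) ->
  (\forall w \near z, forall t, u w t = u z t + (w - z) * Q w t) ->
  (forall t, tends (filter_prod (nbhs t) (nbhs z)) (fun p => Q p.2 p.1) (Q z t)) ->
  cder (fun w => integ (u w) a b) z (integ (Q z) a b).
Proof.
move=> ab cu cQ uQ tQ.
have cu0 := nbhs_singleton cu; have cQ0 := nbhs_singleton cQ.
apply: (@cder_near _ (fun w => integ (u z) a b + (w - z) *
   (if w == z then integ (Q z) a b else integ (Q w) a b))).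
  near=> w; have -> : (if w == z then integ (Q z) a b else integ (Q w) a b) = integ (Q w) a b.
    by case: eqP => [->|].
  have cw : ctsR (Q w) by near: w.
  rewrite -integ_lin //; apply: eq_integ => t _; apply/esym.
  by move: t; near: w.
exists (fun w => integ (Q w) a b); split => //; last first.
  move=> w; rewrite eqxx subrr mul0r addr0 mulrC; congr (_ + _ * _).
  by case: eqP => [->|].
by apply: tends_integ => // t _; exact: tQ.
Unshelve. all: by end_near. Qed.

Lemma near_ltr z r : `‖z‖ < r -> \forall w \near z, `‖w‖ < r.
Proof.
move=> zr; apply/nbhsCP; exists (r - `‖z‖); first by rewrite subr_gt0.
by move=> w wz; have := nc_triangle (w - z) z; rewrite subrK; lra.
Qed.

Lemma tends_ckernel r t z : `‖z‖ < r ->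
  tends (filter_prod (nbhs t) (nbhs z)) (fun p => (circ r p.1 - p.2)^-1) (circ r t - z)^-1.
Proof.
move=> zr; apply: tendsV; first exact: circ_sub_neq0.
apply: tendsB; first exact: (tends_fst (ctsR_circ r t)).
exact: (@tends_snd R R R[i] (nbhs t) (nbhs z) _ _ id z (@cts_id R z)).
Qed.

Lemma cauchy_int_cder k r z : ctsR k -> `‖z‖ < r ->
  cder (cauchy_int k r) z (cauchy_int2 k r z).
Proof.
move=> ck zr; rewrite /cauchy_int /cauchy_int2.
rewrite [X in cder _ _ X](@eq_integ _ _ (fun t => k t / (circ r t - z) / (circ r t - z))); last first.
  by move=> t _; rewrite expr2 invfM mulrA.
have ck1 w : `‖w‖ < r -> ctsR (fun t => k t / (circ r t - w)).
  by move=> wr; have := ctsR_ckernel 1 ck wr.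
apply: (@cder_integ (fun w t => k t / (circ r t - w)) (fun w t => k t / (circ r t - z) / (circ r t - w))).
- exact: two_pi_ge0.
- by apply: filterS (near_ltr zr) => w; exact: ck1.
- apply: filterS (near_ltr zr) => w wr.
  by have := ctsR_ckernel 1 (ck1 z zr) wr.
- apply: filterS (near_ltr zr) => w wr t.
  by field; rewrite !circ_sub_neq0.
- move=> t; apply: tendsM; last exact: tends_ckernel.
  exact: (tends_fst (ck1 z zr t)).
Qed.

Lemma cauchy_int2_cder k r z : ctsR k -> `‖z‖ < r ->
  exists c, cder (cauchy_int2 k r) z c.
Proof.
move=> ck zr; rewrite /cauchy_int2.
have ck1 w n : `‖w‖ < r -> ctsR (fun t => k t / (circ r t - w) ^+ n).
  by move=> wr; exact: ctsR_ckernel.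
pose Q w t := k t / (circ r t - z) ^+ 1 / (circ r t - w) ^+ 2 +
              k t / (circ r t - z) ^+ 2 / (circ r t - w) ^+ 1.
eexists; apply: (@cder_integ (fun w t => k t / (circ r t - w) ^+ 2) Q).
- exact: two_pi_ge0.
- by apply: filterS (near_ltr zr) => w; exact: ck1.
- apply: filterS (near_ltr zr) => w wr.
  by apply: ctsRD; apply: ctsR_ckernel => //; exact: ck1.
- apply: filterS (near_ltr zr) => w wr t; rewrite /Q.
  by field; rewrite !circ_sub_neq0.
- move=> t; apply: tendsD; apply: tendsM.
  + exact: (tends_fst (ck1 z _ zr t)).
  + apply: (tends_ext (f := fun p : R * R[i] => (circ r p.1 - p.2)^-1 * (circ r p.1 - p.2)^-1)).
      by move=> p; rewrite -invfM -expr2.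
    rewrite (_ : _ ^- 2 = (circ r t - z)^-1 * (circ r t - z)^-1); last by rewrite -invfM -expr2.
    by apply: tendsM; exact: tends_ckernel.
  + exact: (tends_fst (ck1 z _ zr t)).
  + exact: tends_ckernel.
Qed.

End CauchyFormula.

(** * Consequences of Cauchy's formula *)

Section HolomorphicFunctions.
Variable R : realType.
Implicit Types (f g h : R[i] -> R[i]) (z w a : R[i]) (r s : R).

(** The value on the diagonal is the one that makes the quotient holomorphic. *)
Definition dquot f z w := if w == z then derive1 f z else (f w - f z) / (w - z).

Lemma dquotE f z w : f w = f z + (w - z) * dquot f z w.
Proof.
rewrite /dquot; case: eqP => [->|/eqP wz]; first by rewrite subrr mul0r addr0.
by rewrite mulrC divfK ?subr_eq0 // addrC subrK.
Qed.

Lemma derive1_cauchy f r z : holo f -> `‖z‖ < r -> r < 1 ->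
  derive1 f z = cauchy_int2 (cauchy_density f r) r z.
Proof.
move=> hf zr r1; apply: derive1_cder.
have ck : ctsR (cauchy_density f r).
  apply: ctsR_density; last by move=> w w1; exact: holo_cts.
  by rewrite ger0_norm // ltW // (le_lt_trans (nc_ge0 z)).
apply: cder_near (cauchy_int_cder ck zr).
by apply: filterS (near_ltr zr) => w wr; rewrite (cauchy_formula hf wr).
Qed.

Lemma between r s : r < s -> exists2 m, r < m & m < s.
Proof. by move=> rs; exists ((r + s) / 2); lra. Qed.

(** The derivative is a Cauchy integral with a squared kernel, and such
   integrals are differentiable again. *)
Lemma holo_derive1 f : holo f -> holo (derive1 f).
Proof.
move=> hf z /between[r zr r1].
have ck : ctsR (cauchy_density f r).
  apply: ctsR_density; last by move=> w w1; exact: holo_cts.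
  by rewrite ger0_norm // ltW // (le_lt_trans (nc_ge0 z)).
have [c dc] := cauchy_int2_cder ck zr; exists c; apply: cder_near dc.
by apply: filterS (near_ltr zr) => w wr; rewrite (derive1_cauchy hf wr).
Qed.

(** The divided difference is again a Cauchy integral, with the density of f
   divided by the distance vector to z; this removes the singularity. *)
Lemma holo_dquot f z : `‖z‖ < 1 -> holo f -> holo (dquot f z).
Proof.
move=> z1 hf w w1.
have [r] : exists2 r, Num.max `‖z‖ `‖w‖ < r & r < 1.
  by apply: between; rewrite gt_max z1.
rewrite gt_max => /andP[zr wr] r1.
have r1' : `|r| < 1 by rewrite ger0_norm // ltW // (le_lt_trans (nc_ge0 z)).
pose k := cauchy_density f r.
have ck : ctsR k.
  by apply: ctsR_density => // v v1; exact: holo_cts.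
have ck1 v : `‖v‖ < r -> ctsR (fun t => k t / (circ r t - v)).
  by move=> vr; have := ctsR_ckernel 1 ck vr.
have [c dc] : exists c, cder (cauchy_int (fun t => k t / (circ r t - z)) r) w c.
  by eexists; exact: (cauchy_int_cder (ck1 z zr) wr).
exists c; apply: cder_near dc; apply: filterS (near_ltr wr) => v vr.
rewrite /dquot; case: eqP => [->|/eqP vz].
  rewrite (derive1_cauchy hf zr r1); apply: eq_integ => t _.
  by rewrite expr2 invfM mulrA.
rewrite (cauchy_formula hf vr r1) (cauchy_formula hf zr r1) /cauchy_int -/k.
rewrite -(integB (two_pi_ge0 R) (ck1 v vr) (ck1 z zr)).
have ckz : ctsR (fun t => k t / (circ r t - z) / (circ r t - v)).
  by have := ctsR_ckernel 1 (ck1 z zr) vr.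
apply: (mulIf (x := v - z)); first by rewrite subr_eq0.
rewrite divfK ?subr_eq0 // mulrC -(integZ (v - z) (two_pi_ge0 R) ckz).
apply: eq_integ => t _.
by field; rewrite !circ_sub_neq0.
Qed.

(** Weierstrass: locally uniform limits of holomorphic functions satisfy
   Cauchy's formula, hence are holomorphic. *)
Lemma holo_approx f :
  (forall r e, r < 1 -> 0 < e -> exists2 g, holo g &
     forall z, `‖z‖ <= r -> `‖g z - f z‖ <= e) -> holo f.
Proof.
move=> H.
have cf z : `‖z‖ < 1 -> cts f z.
  move=> /between[r zr r1] e e0; have e4 : 0 < e / 4 by rewrite divr_gt0.
  have [g hg gf] := H r _ r1 e4.
  have cg := holo_cts hg (lt_trans zr r1).
  apply: filterS (filterI (cg _ e4) (near_ltr zr)) => w [gw wr].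
  have := nc_trans_sub (g w) (f w) (f z); have := nc_trans_sub (g z) (g w) (f z).
  have := gf w (ltW wr); have := gf z (ltW zr); rewrite (nc_subC (f w) (g w)); lra.
move=> z /between[r zr r1].
have r0 : 0 < r := le_lt_trans (nc_ge0 z) zr.
have r1' : `|r| < 1 by rewrite ger0_norm // ltW.
have ck := ctsR_density r1' cf.
have E w : `‖w‖ < r -> f w = cauchy_int (cauchy_density f r) r w.
  move=> wr; apply/eqP; rewrite -subr_eq0 -nc_eq0 eq_le nc_ge0 andbT.
  apply/ler_addgt0Pl => e e0; rewrite addr0.
  have rw : 0 < r - `‖w‖ by rewrite subr_gt0.
  pose d := e / (1 + r / (r - `‖w‖)).
  have C0 : 0 < 1 + r / (r - `‖w‖) by rewrite addr_gt0 // divr_gt0.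
  have d0 : 0 < d by rewrite divr_gt0.
  have [g hg gf] := H r d r1 d0.
  have cg : ctsR (cauchy_density g r).
    by apply: ctsR_density => // v v1; exact: holo_cts.
  apply: (le_trans (nc_trans_sub (g w) _ _)).
  rewrite {2}(cauchy_formula hg wr r1) /cauchy_int.
  have c1 := ctsR_ckernel 1 cg wr; have c2 := ctsR_ckernel 1 ck wr.
  rewrite -(integB (two_pi_ge0 R) c1 c2).
  have -> : e = d + d * (r / (r - `‖w‖)) / (2 * pi) * (2 * pi - 0).
    rewrite subr0 divfK; last by rewrite gt_eqF // mulr_gt0 // pi_gt0.
    by rewrite -[X in X + _]mulr1 -mulrDr divfK // gt_eqF.
  apply: lerD; first by rewrite nc_subC gf // ltW.
  apply: integ_le; [exact: two_pi_ge0|exact: ctsRB|move=> t _].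
  rewrite /cauchy_density expr1.
  rewrite (_ : _ - _ = (g (circ r t) - f (circ r t)) * (circ r t / (circ r t - w)) / (2 * pi)%:C);
    last by ring.
  rewrite nc_div [X in _ / X]nc_realp ?two_pi_ge0 //.
  rewrite ler_wpM2r ?invr_ge0 ?two_pi_ge0 // normcM.
  apply: ler_pM; rewrite ?nc_ge0 //; first by apply: gf; rewrite nc_circ_abs ger0_norm // ltW.
  rewrite nc_div nc_circ_abs gtr0_norm // ler_wpM2l ?(ltW r0) // lef_pV2 ?posrE //.
    by have := nc_sub_ge (circ r t) w; rewrite nc_circ_abs gtr0_norm.
  by rewrite nc_gt0 circ_sub_neq0.
eexists; apply: cder_near (cauchy_int_cder ck zr).
by apply: filterS (near_ltr zr) => w wr; rewrite (E w wr).
Qed.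

(** Cauchy's formula bounds f by a constant times its maximum on the circle;
   applied to powers of f it makes the constant 1. *)
Lemma max_modulus f r z (M : R) : holo f -> `‖z‖ < r -> r < 1 ->
  (forall w, `‖w‖ = r -> `‖f w‖ <= M) -> `‖f z‖ <= M.
Proof.
move=> hf zr r1 fM; have r0 : 0 < r := le_lt_trans (nc_ge0 z) zr.
have rz : 0 < r - `‖z‖ by rewrite subr_gt0.
have nr : `‖r%:C‖ = r by rewrite nc_realp // ltW.
have M0 : 0 <= M := le_trans (nc_ge0 _) (fM _ nr).
pose C := r / (r - `‖z‖); have C0 : 0 < C by rewrite divr_gt0.
have r1' : `|r| < 1 by rewrite ger0_norm // ltW.
have bnd n : `‖f z‖ ^+ n <= M ^+ n * C.
  have hfn := holoX n hf.
  rewrite -ncX (cauchy_formula hfn zr r1).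
  have -> : M ^+ n * C = M ^+ n * C / (2 * pi) * (2 * pi - 0).
    by rewrite subr0 divfK // gt_eqF // mulr_gt0 // pi_gt0.
  apply: integ_le; first exact: two_pi_ge0.
    have ck : ctsR (cauchy_density (fun w => f w ^+ n) r).
      by apply: ctsR_density => // w w1; exact: holo_cts.
    by have := ctsR_ckernel 1 ck zr.
  move=> t _; rewrite /cauchy_density.
  rewrite (_ : _ / _ = f (circ r t) ^+ n * (circ r t / (circ r t - z)) / (2 * pi)%:C);
    last by ring.
  rewrite nc_div [X in _ / X]nc_realp ?two_pi_ge0 //.
  rewrite ler_wpM2r ?invr_ge0 ?two_pi_ge0 // normcM ncX.
  apply: ler_pM; rewrite ?exprn_ge0 ?nc_ge0 //.
    by rewrite lerXn2r ?nnegrE ?nc_ge0 // fM // nc_circ_abs gtr0_norm.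
  rewrite nc_div nc_circ_abs gtr0_norm // ler_wpM2l ?(ltW r0) // lef_pV2 ?posrE //.
    by have := nc_sub_ge (circ r t) z; rewrite nc_circ_abs gtr0_norm.
  by rewrite nc_gt0 circ_sub_neq0.
rewrite leNgt; apply/negP => fzM.
have fz0 : 0 < `‖f z‖ := le_lt_trans M0 fzM.
have q1 : `|M / `‖f z‖| < 1.
  by rewrite ger0_norm ?divr_ge0 ?nc_ge0 // ltr_pdivrMr // mul1r.
have /cvgrPdist_lt/(_ C^-1) H := cvg_expr q1.
have [n _ /(_ n (leqnn n))] : \forall n \near \oo, `|0 - (M / `‖f z‖) ^+ n| < C^-1.
  by apply: H; rewrite invr_gt0.
rewrite /= sub0r normrN ger0_norm ?exprn_ge0 ?divr_ge0 ?nc_ge0 //.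
rewrite expr_div_n ltr_pdivrMr ?exprn_gt0 // -ltr_pdivrMl ?invr_gt0 //.
by rewrite invrK mulrC ltNge bnd.
Qed.

Lemma holo_affine f a s : 0 <= s -> `‖a‖ + s <= 1 -> holo f ->
  holo (fun w => f (a + s%:C * w)).
Proof.
move=> s0 as1 hf w w1; have [s00|sn0] := eqVneq s 0.
  exists 0; apply: cder_near (cder_cst (f a) w); apply: nearCW => v.
  by rewrite s00 mul0r addr0.
have a1 : `‖a + s%:C * w‖ < 1.
  apply: (le_lt_trans (nc_triangle _ _)); rewrite normcM nc_realp //.
  have : s * `‖w‖ < s by rewrite gtr_pMr // lt_def sn0.
  lra.
have [c dc] := hf _ a1; eexists.
exact: (cder_comp (f := f) (g := fun v => a + s%:C * v) dc (cder_affine _ _ _)).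
Qed.

(** Minimum modulus principle in the form that produces zeros: without one, the
   maximum principle for 1/f is violated. *)
Lemma min_modulus_zero f a s0 s1 z (m : R) : holo f -> `‖a‖ + s1 <= 1 ->
  `‖z - a‖ < s0 -> s0 < s1 ->
  (forall w, `‖w - a‖ = s0 -> m <= `‖f w‖) -> `‖f z‖ < m ->
  exists2 w, `‖w - a‖ < s1 & f w = 0.
Proof.
move=> hf as1 zs0 s01 fm fz.
have s10 : 0 < s1 := lt_trans (le_lt_trans (nc_ge0 _) zs0) s01.
apply: contrapT => nz.
have nz' w : `‖w - a‖ < s1 -> f w != 0.
  by move=> ws; apply/eqP => fw; apply: nz; exists w.
have m0 : 0 < m := le_lt_trans (nc_ge0 _) fz.
have inb w : `‖w‖ < 1 -> `‖a + s1%:C * w - a‖ < s1.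
  move=> w1; rewrite addrC addKr normcM nc_realp ?(ltW s10) //.
  by rewrite gtr_pMr.
have hg : holo (fun w => (f (a + s1%:C * w))^-1).
  apply: holoV; first by move=> w w1; exact/nz'/inb.
  by apply: holo_affine => //; exact: ltW.
have s1n : s1%:C != 0 :> R[i] by rewrite -nc_gt0 nc_realp ?ltW.
pose w0 := (z - a) / s1%:C.
have wE : a + s1%:C * w0 = z by rewrite /w0 mulrC divfK // addrC subrK.
have w0s : `‖w0‖ < s0 / s1.
  by rewrite nc_div nc_realp ?(ltW s10) // ltr_pM2r ?invr_gt0.
have := max_modulus (M := m^-1) hg w0s; rewrite wE ltr_pdivrMr // mul1r => /(_ s01).
have fz0 : 0 < `‖f z‖ by rewrite nc_gt0 nz' // (lt_trans zs0).
rewrite normcV lef_pV2 ?posrE // leNgt fz => H.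
suff : false by []; apply: H => w ws0; rewrite normcV lef_pV2 ?posrE //.
  apply: fm; rewrite addrC addKr normcM nc_realp ?(ltW s10) // ws0.
  by rewrite mulrC divfK // gt_eqF.
rewrite nc_gt0; apply: nz'; apply: inb; rewrite ws0 ltr_pdivrMr // mul1r //.
Qed.

Lemma compact_cball r : compact [set z : R[i] | `‖z‖ <= r].
Proof.
pose p (x : R * R) : R[i] := x.1 +i* x.2.
have cp : continuous p.
  move=> x; apply/cvg_tendsP; apply: tends_ReIm => /=; [exact: cvg_fst|exact: cvg_snd].
have cK := compact_setX (@segment_compact R (- r) r) (@segment_compact R (- r) r).
have cI := continuous_compact (continuous_subspaceT cp) cK.
apply: (subclosed_compact _ cI).
  rewrite -openC openE => z /= /negP; rewrite -ltNge => rz.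
  apply/nbhsCP; exists (`‖z‖ - r); first by rewrite subr_gt0.
  move=> w wz /=; apply/negP; rewrite -ltNge.
  by have := nc_trans_sub w z 0; rewrite !subr0 nc_subC; lra.
move=> z /= zr; exists (Re z, Im z); last by case: z {zr}.
split => /=; rewrite in_itv /= -ler_norml; first exact: le_trans (nc_Re z) zr.
exact: le_trans (nc_Im z) zr.
Qed.

Lemma compact_nc_max f (K : set R[i]) : compact K -> K !=set0 ->
  (forall z, K z -> cts f z) ->
  exists2 z0, K z0 & forall z, K z -> `‖f z‖ <= `‖f z0‖.
Proof.
move=> cK K0 cf.
have cn : {within K, continuous (fun z => `‖f z‖ : R)}.
  apply: continuous_in_subspaceT => z /set_mem Kz.
  exact: (tends_part (@nc_lip R) (cf z Kz)).
have [c cK' cM] := @compact_EVT_max _ _ _ _ K0 cK cn.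
by exists c => [|z Kz]; [exact: set_mem|apply: cM; exact: mem_set].
Qed.

Lemma cball_bound f r : holo f -> r < 1 -> exists2 M, 0 < M &
  forall z, `‖z‖ <= r -> `‖f z‖ <= M.
Proof.
move=> hf r1; have [r0|r0] := ltP r 0.
  by exists 1 => // z zr; have := nc_ge0 z; lra.
have [|z z1|z0 z0r zM] := @compact_nc_max f [set z | `‖z‖ <= r] (@compact_cball r).
- by exists 0; rewrite /= nc0.
- by apply: holo_cts => //; exact: le_lt_trans r1.
exists (`‖f z0‖ + 1); first by rewrite ltr_wpDl ?nc_ge0.
by move=> z zr; apply: (le_trans (zM z zr)); rewrite lerDl.
Qed.

(** Schwarz's lemma: the maximum principle for f(z)/z on circles of radius
   tending to 1. *)
Lemma schwarz f : holo f -> (forall z, `‖z‖ < 1 -> `‖f z‖ <= 1) -> f 0 = 0 ->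
  forall z, `‖z‖ < 1 -> `‖dquot f 0 z‖ <= 1.
Proof.
move=> hf f1 f0 z z1; rewrite leNgt; apply/negP => h1.
have hz : 0 < `‖dquot f 0 z‖ by lra.
have [r] : exists2 r, Num.max `‖z‖ (`‖dquot f 0 z‖^-1) < r & r < 1.
  by apply: between; rewrite gt_max z1 /= invf_lt1.
rewrite gt_max => /andP[zr hr] r1.
have r0 : 0 < r := le_lt_trans (nc_ge0 z) zr.
have n0 : `‖0 : R[i]‖ < 1 by rewrite nc0.
have := max_modulus (M := r^-1) (holo_dquot n0 hf) zr r1 _.
suff H : forall w, `‖w‖ = r -> `‖dquot f 0 w‖ <= r^-1.
  by move=> /(_ H); rewrite leNgt -[X in _ < X]invrK ltf_pV2 ?posrE ?invr_gt0 // hr.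
move=> w wr; rewrite /dquot -nc_eq0 wr gt_eqF // f0 !subr0 nc_div wr.
by rewrite ler_pdivrMr // mulVf ?gt_eqF // f1 // wr.
Qed.

End HolomorphicFunctions.

(** * Moebius maps and the Schwarz-Pick inequalities *)

Section SchwarzPick.
Variable R : realType.
Implicit Types (f g h phi : R[i] -> R[i]) (z w a : R[i]) (r s : R).

Lemma one_sub_real (x : R) : 1 - x%:C = (1 - x)%:C.
Proof. by apply: eqC => /=; ring. Qed.

Definition mob a z := (z - a) / (1 - a^* * z).

(** The identity behind the invariance of the pseudo-hyperbolic distance. *)
Lemma mob_norm_id a z :
  `‖1 - a^* * z‖ ^+ 2 - `‖z - a‖ ^+ 2 = (1 - `‖a‖ ^+ 2) * (1 - `‖z‖ ^+ 2).
Proof.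
case: a z => [a b] [x y]; rewrite -[(_ +i* _)^*]/(a +i* - b) !nc_sqr /=; ring.
Qed.

Lemma mob_den_ge a z : 1 - `‖a‖ * `‖z‖ <= `‖1 - a^* * z‖.
Proof. by have := nc_sub_ge 1 (a^* * z); rewrite nc1 normcM nc_conj. Qed.

Lemma mob_den_neq0 a z : `‖a‖ < 1 -> `‖z‖ <= 1 -> 1 - a^* * z != 0.
Proof.
move=> a1 z1; rewrite -nc_gt0; apply: lt_le_trans (mob_den_ge a z).
have : `‖a‖ * `‖z‖ <= `‖a‖ by rewrite ler_piMr ?nc_ge0.
lra.
Qed.

Lemma nc_mob_id a z : `‖a‖ < 1 -> `‖z‖ <= 1 ->
  (1 - `‖mob a z‖ ^+ 2) * `‖1 - a^* * z‖ ^+ 2 = (1 - `‖a‖ ^+ 2) * (1 - `‖z‖ ^+ 2).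
Proof.
move=> a1 z1; rewrite -mob_norm_id /mob nc_div expr_div_n.
have d0 := mob_den_neq0 a1 z1; rewrite -nc_eq0 in d0.
by rewrite mulrBl mul1r divfK // expf_neq0.
Qed.

Lemma sqr_lt1 z : (0 < 1 - `‖z‖ ^+ 2) = (`‖z‖ < 1).
Proof. by rewrite subr_gt0 expr_lt1 // nc_ge0. Qed.

Lemma sqr_le1 z : (0 <= 1 - `‖z‖ ^+ 2) = (`‖z‖ <= 1).
Proof. by rewrite subr_ge0 expr_le1 // nc_ge0. Qed.

Lemma mob_lt1 a z : `‖a‖ < 1 -> `‖z‖ < 1 -> `‖mob a z‖ < 1.
Proof.
move=> a1 z1; rewrite -sqr_lt1.
have d0 : 0 < `‖1 - a^* * z‖ by rewrite nc_gt0 mob_den_neq0 // ltW.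
rewrite -(pmulr_lgt0 _ (exprn_gt0 2 d0)) nc_mob_id ?ltW //.
by rewrite mulr_gt0 // sqr_lt1.
Qed.

Lemma mob_self a : mob a a = 0.
Proof. by rewrite /mob subrr mul0r. Qed.

Lemma mob0 a : mob a 0 = - a.
Proof. by rewrite /mob mulr0 subr0 divr1 sub0r. Qed.

Lemma cjN z : (- z)^* = - z^*.
Proof. exact: rmorphN. Qed.

Lemma mobK a z : `‖a‖ < 1 -> `‖z‖ < 1 -> mob (- a) (mob a z) = z.
Proof.
move=> a1 z1; have d0 := mob_den_neq0 a1 (ltW z1).
have a2 : 1 - a^* * a != 0.
  by rewrite mulrC mul_conj one_sub_real -nc_eq0 nc_real normr_eq0 gt_eqF // sqr_lt1.
rewrite /mob cjN.
have -> : 1 - - a^* * ((z - a) / (1 - a^* * z)) = (1 - a^* * a) / (1 - a^* * z).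
  by field.
by field; rewrite d0 a2.
Qed.

Lemma cder_mob a z : `‖a‖ < 1 -> `‖z‖ < 1 ->
  cder (mob a) z ((1 - (`‖a‖ ^+ 2)%:C) / (1 - a^* * z) ^+ 2).
Proof.
move=> a1 z1; have d0 := mob_den_neq0 a1 (ltW z1).
have d1 := cderB (cder_id z) (cder_cst a z).
have d2 := cderB (cder_cst 1 z) (cderZ a^* (cder_id z)).
have := cderM d1 (cderV (g := fun w => 1 - a^* * w) d0 d2).
congr (cder _ _ _); rewrite -mul_conj.
by field.
Qed.

Lemma holo_mob a : `‖a‖ < 1 -> holo (mob a).
Proof. by move=> a1 z z1; eexists; exact: (cder_mob a1 z1). Qed.

Lemma mob_circle a : `‖a‖ < 1 -> `‖- a‖ < 1.
Proof. by rewrite nc_opp. Qed.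

(** Two-point Schwarz-Pick inequality for maps into the open disc: Schwarz's
   lemma between the automorphisms that move w and f w to the origin. *)
Lemma schwarz_pick_open f z w : holo f ->
  (forall z, `‖z‖ < 1 -> `‖f z‖ < 1) -> `‖z‖ < 1 -> `‖w‖ < 1 ->
  `‖mob (f w) (f z)‖ <= `‖mob w z‖.
Proof.
move=> hf f1 z1 w1; have nw := mob_circle w1.
pose F v := mob (f w) (f (mob (- w) v)).
have hF : holo F.
  apply: (holo_comp (f := mob (f w)) (g := fun v => f (mob (- w) v))).
  - by move=> v v1; apply/f1/mob_lt1.
  - exact/holo_mob/f1.
  - apply: (holo_comp (f := f) (g := mob (- w))) => //; last exact: holo_mob.
    by move=> v v1; exact: mob_lt1.
have F1 v : `‖v‖ < 1 -> `‖F v‖ <= 1.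
  by move=> v1; apply/ltW/mob_lt1; [exact: f1|exact/f1/mob_lt1].
have F0 : F 0 = 0 by rewrite /F mob0 opprK mob_self.
have v1 := mob_lt1 w1 z1.
have := schwarz hF F1 F0 v1; have := dquotE F 0 (mob w z).
rewrite {1}/F mobK // F0 add0r subr0 => -> h.
by rewrite normcM ler_piMr ?nc_ge0.
Qed.

(** The open-disc version applied to (1 - d) f, in the limit where d tends to 0;
   clearing denominators allows unimodular constants. *)
Lemma schwarz_pick f z w : holo f ->
  (forall z, `‖z‖ < 1 -> `‖f z‖ <= 1) -> `‖z‖ < 1 -> `‖w‖ < 1 ->
  `‖f z - f w‖ * `‖1 - w^* * z‖ <= `‖z - w‖ * `‖1 - (f w)^* * f z‖.
Proof.
move=> hf f1 z1 w1.
set X := `‖f z - f w‖ * _; set Y := `‖z - w‖.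
have X0 : 0 <= X by rewrite mulr_ge0 ?nc_ge0.
have Y0 : 0 <= Y := nc_ge0 _.
apply/ler_addgt0Pr => e e0.
pose d := Num.min (2^-1) (e / (X + Y * 2 + 1)).
have XY : 0 < X + Y * 2 + 1 by lra.
have d0 : 0 < d by rewrite lt_min invr_gt0 ltr0n divr_gt0.
have d1 : d < 1 by rewrite /d gt_min; apply/orP; left; lra.
pose l := 1 - d; have l0 : 0 < l by rewrite /l; lra.
have l1 : l < 1 by rewrite /l; lra.
pose g v := l%:C * f v.
have hg : holo g by exact: holoZ.
have g1 v : `‖v‖ < 1 -> `‖g v‖ < 1.
  move=> v1; rewrite normcM nc_realp ?(ltW l0) //.
  by have := ler_wpM2l (ltW l0) (f1 v v1); lra.
have := schwarz_pick_open hg g1 z1 w1.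
have n1 : 0 < `‖1 - (g w)^* * g z‖ by rewrite nc_gt0 mob_den_neq0 ?g1 // ltW ?g1.
have n2 : 0 < `‖1 - w^* * z‖ by rewrite nc_gt0 mob_den_neq0 // ltW.
rewrite !nc_div ler_pdivrMr // mulrAC ler_pdivlMr //.
rewrite -mulrBr normcM nc_realp ?(ltW l0) // -mulrA -/X -/Y => H.
have B : `‖1 - (g w)^* * g z‖ <= `‖1 - (f w)^* * f z‖ + 2 * d.
  rewrite (_ : 1 - (g w)^* * g z =
    (1 - (f w)^* * f z) + (1 - (l ^+ 2)%:C) * ((f w)^* * f z)); last first.
    by rewrite /g cjM cj_real rmorphXn /=; ring.
  apply: (le_trans (nc_triangle _ _)); rewrite lerD2l normcM.
  rewrite one_sub_real nc_realp; last by rewrite subr_ge0 expr_le1 // ltW.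
  have : `‖(f w)^* * f z‖ <= 1.
    by rewrite normcM nc_conj mulr_ile1 ?nc_ge0 // f1.
  have l2 : 0 <= 1 - l ^+ 2 by rewrite subr_ge0 expr_le1 // ltW.
  move=> /(ler_wpM2l l2) h; apply: (le_trans h); rewrite /l; nra.
have E : d * (X + Y * 2 + 1) <= e.
  by rewrite -ler_pdivlMr // /d ge_min lexx orbT.
have := ler_wpM2l Y0 B; rewrite /l in H.
by rewrite mulrDr; nra.
Qed.

Lemma tends_nc_le (T : Type) (F : set_system T) {FF : ProperFilter F}
    (p q : T -> R[i]) (a b : R[i]) : tends F p a -> tends F q b ->
  (\forall x \near F, `‖p x‖ <= `‖q x‖) -> `‖a‖ <= `‖b‖.
Proof.
move=> pa qb pq; apply/ler_addgt0Pl => e e0.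
have e2 : 0 < e / 2 by rewrite divr_gt0.
have [x [h1 [h2 h3]]] := filter_ex (filterI pq (filterI (pa _ e2) (qb _ e2))).
have := nc_sub_ge a (p x); have := nc_sub_ge (q x) b; rewrite (nc_subC a); lra.
Qed.

(** The two-point inequality in the limit where both points coincide. *)
Lemma schwarz_pick_deriv f w : holo f ->
  (forall z, `‖z‖ < 1 -> `‖f z‖ <= 1) -> `‖w‖ < 1 ->
  `‖derive1 f w‖ * (1 - `‖w‖ ^+ 2) <= 1 - `‖f w‖ ^+ 2.
Proof.
move=> hf f1 w1.
have ww : `‖1 - w^* * w‖ = 1 - `‖w‖ ^+ 2.
  by rewrite mulrC mul_conj one_sub_real nc_realp // sqr_le1 ltW.
have fw : `‖1 - (f w)^* * f w‖ = 1 - `‖f w‖ ^+ 2.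
  by rewrite mulrC mul_conj one_sub_real nc_realp // sqr_le1 f1.
rewrite -ww -fw -normcM.
have cd : cts (dquot f w) w by apply: holo_cts => //; exact: holo_dquot.
have t1 : tends (nbhs w) (fun z => dquot f w z * (1 - w^* * z)) (derive1 f w * (1 - w^* * w)).
  apply: tendsM; first by have := cd; rewrite /cts /dquot eqxx.
  by exact: (cder_cts (cderB (cder_cst 1 w) (cderZ w^* (cder_id w)))).
have t2 : tends (nbhs w) (fun z => 1 - (f w)^* * f z) (1 - (f w)^* * f w).
  have dfw := holo_cder hf w1.
  by exact: (cder_cts (cderB (cder_cst 1 w) (cderZ (f w)^* dfw))).
have dn (F : R[i] -> R[i]) l : tends (nbhs w) F l -> tends w^' F l.
  move=> H e e0.
  have : \forall z \near w, z != w -> `‖F z - l‖ < e by apply: filterS (H e e0).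
  by [].
apply: (tends_nc_le (FF := dnbhs_proper w) (dn _ _ t1) (dn _ _ t2)).
have : \forall z \near w, z != w -> `‖dquot f w z * (1 - w^* * z)‖ <= `‖1 - (f w)^* * f z‖.
  apply: filterS (near_ltr w1) => z z1 zw.
  have := schwarz_pick hf f1 z1 w1; rewrite /dquot (negPf zw) normcM nc_div.
  by rewrite mulrAC ler_pdivrMr ?nc_gt0 ?subr_eq0 // [X in _ -> _ <= X]mulrC.
by [].
Qed.

Lemma cder_lip f z (c : R[i]) (L : R) : cder f z c ->
  (\forall w \near z, `‖f w - f z‖ <= L * `‖w - z‖) -> `‖c‖ <= L.
Proof.
move=> [q [cq qz fq]] fL.
have dn : tends z^' q c.
  rewrite -qz => e e0.
  have : \forall w \near z, w != z -> `‖q w - q z‖ < e by apply: filterS (cq e e0).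
  by [].
have := @tends_bound R _ _ (dnbhs_proper z) q c 0 L dn; rewrite subr0; apply.
have : \forall w \near z, w != z -> `‖q w - 0‖ <= L.
  apply: filterS fL => w; rewrite fq addrC addKr normcM => h wz.
  by move: h; rewrite subr0 ler_pM2r // nc_gt0 subr_eq0.
by [].
Qed.

(** Schwarz-Pick for the rescaled function f(s z) / M. *)
Lemma lipschitz_bound r s : r < s -> 0 < s -> s < 1 -> exists2 C : R, 0 < C &
  forall f (M : R), holo f -> (forall z, `‖z‖ <= s -> `‖f z‖ <= M) ->
  forall z w, `‖z‖ <= r -> `‖w‖ <= r -> `‖f z - f w‖ <= C * M * `‖z - w‖.
Proof.
move=> rs s0 s1.
have [r0|r0] := ltP r 0.
  by exists 1 => // f M _ _ z w zr; have := nc_ge0 z; lra.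
pose q := r / s; have q0 : 0 <= q by rewrite divr_ge0 // ltW.
have q1 : q < 1 by rewrite /q ltr_pdivrMr // mul1r.
have q2 : 0 < 1 - q ^+ 2 by rewrite subr_gt0 expr_lt1.
exists (2 / (s * (1 - q ^+ 2))); first by rewrite divr_gt0 // mulr_gt0.
move=> f M hf fM z w zr wr.
have sn : s%:C != 0 :> R[i] by rewrite -nc_gt0 nc_realp ?ltW.
have M0 : 0 <= M by apply: le_trans (nc_ge0 (f 0)) (fM _ _); rewrite nc0 ltW.
have [M00|Mn] := eqVneq M 0.
  have E v : `‖v‖ <= r -> f v = 0.
    move=> vr; apply/eqP; rewrite -nc_eq0 eq_le nc_ge0 andbT -M00 fM //.
    by rewrite (le_trans vr) // ltW.
  by rewrite !E // subrr nc0 M00 mulr0 mul0r.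
have Mp : 0 < M by rewrite lt_def Mn.
pose g v := M^-1%:C * f (0 + s%:C * v).
have hg : holo g.
  apply: holoZ; apply: holo_affine => //; first exact: ltW.
  by rewrite nc0 add0r ltW.
have g1 v : `‖v‖ < 1 -> `‖g v‖ <= 1.
  move=> v1; rewrite normcM nc_realp ?invr_ge0 // ler_pdivrMl // mulr1.
  rewrite add0r; apply: fM; rewrite normcM nc_realp ?(ltW s0) //.
  by rewrite ler_piMr // ltW.
have sc v : `‖v‖ <= r -> `‖v / s%:C‖ <= q.
  by move=> vr; rewrite nc_div nc_realp ?(ltW s0) // ler_wpM2r // invr_ge0 ltW.
have gE v : g (v / s%:C) = M^-1%:C * f v by rewrite /g add0r [s%:C * _]mulrC divfK.
have := schwarz_pick hg g1 (le_lt_trans (sc z zr) q1) (le_lt_trans (sc w wr) q1).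
set d1 := `‖1 - (w / _)^* * _‖; set d2 := `‖1 - _‖.
have h1 : 1 - q ^+ 2 <= d1.
  apply: le_trans (mob_den_ge _ _); rewrite lerD2l lerN2 expr2.
  by apply: ler_pM; rewrite ?nc_ge0 ?sc.
have h2 : d2 <= 2.
  apply: (le_trans (nc_sub_le _ _)); rewrite nc1 normcM nc_conj.
  have : `‖g (w / s%:C)‖ * `‖g (z / s%:C)‖ <= 1.
    by rewrite mulr_ile1 ?nc_ge0 // g1 // (le_lt_trans (sc _ _) q1).
  lra.
rewrite !gE -mulrBr -mulrBl normcM nc_div [`‖s%:C‖]nc_realp ?(ltW s0) //.
rewrite nc_realp ?invr_ge0 // => H.
have H2 : M^-1 * `‖f z - f w‖ * (1 - q ^+ 2) <= `‖z - w‖ / s * 2.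
  apply: le_trans (ler_wpM2l _ h1) _; first by rewrite mulr_ge0 ?invr_ge0 ?nc_ge0.
  apply: (le_trans H); apply: ler_wpM2l => //.
  by rewrite divr_ge0 ?nc_ge0 // ltW.
rewrite -ler_pdivlMr // ler_pdivrMl // in H2; apply: (le_trans H2).
rewrite le_eqVlt; apply/orP; left; apply/eqP; field.
by rewrite !gt_eqF.
Qed.

Lemma selfmap_mob phi z : holo phi -> (forall z, `‖z‖ < 1 -> `‖phi z‖ < 1) ->
  `‖z‖ < 1 -> `‖mob (phi 0) (phi z)‖ <= `‖z‖.
Proof.
move=> hp p1 z1; have n0 : `‖0 : R[i]‖ < 1 by rewrite nc0.
have := schwarz_pick_open hp p1 z1 n0.
by rewrite /mob subr0 conjC0 mul0r subr0 divr1.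
Qed.

(** By Schwarz-Pick phi z stays at bounded pseudo-hyperbolic distance from
   phi 0; when the latter is close to the unit circle, so is phi z. *)
Lemma selfmap_escape r s : 0 <= r < 1 -> 0 <= s < 1 -> exists2 d : R, 0 < d &
  forall phi, holo phi -> (forall z, `‖z‖ < 1 -> `‖phi z‖ < 1) ->
    1 - d < `‖phi 0‖ -> forall z, `‖z‖ <= r -> s < `‖phi z‖.
Proof.
move=> /andP[r0 r1] /andP[s0 s1].
have c1 : 0 < 1 - r ^+ 2 by rewrite subr_gt0 expr_lt1.
have c2 : 0 < (1 - s) ^+ 2 by rewrite exprn_gt0 // subr_gt0.
exists ((1 - r ^+ 2) * (1 - s) ^+ 2 / 2); first by rewrite divr_gt0 // mulr_gt0.
move=> phi hp p1 pd z zr; rewrite ltNge; apply/negP => ps.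
have z1 : `‖z‖ < 1 := le_lt_trans zr r1.
have n0 : `‖0 : R[i]‖ < 1 by rewrite nc0.
have a1 := p1 _ n0; have y1 := p1 _ z1.
have I := nc_mob_id a1 (ltW y1).
have M := selfmap_mob hp p1 z1.
have M2 : `‖mob (phi 0) (phi z)‖ ^+ 2 <= r ^+ 2.
  by rewrite lerXn2r ?nnegrE ?nc_ge0 // (le_trans M).
have D : (1 - s) ^+ 2 <= `‖1 - (phi 0)^* * phi z‖ ^+ 2.
  rewrite lerXn2r ?nnegrE ?nc_ge0 ?subr_ge0 ?(ltW s1) //.
  apply: le_trans (mob_den_ge _ _); rewrite lerD2l lerN2.
  by apply: le_trans ps; rewrite ler_piMl ?nc_ge0 // ltW.
have : (1 - r ^+ 2) * (1 - s) ^+ 2 <= (1 - `‖phi 0‖ ^+ 2) * (1 - `‖phi z‖ ^+ 2).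
  rewrite -I; apply: ler_pM; [exact: ltW|exact: ltW|lra|exact: D].
have b0 : 0 <= 1 - `‖phi 0‖ ^+ 2 by rewrite sqr_le1 ltW.
have : (1 - `‖phi 0‖ ^+ 2) * (1 - `‖phi z‖ ^+ 2) <= 1 - `‖phi 0‖ ^+ 2.
  by rewrite ler_piMr // gerBl sqr_ge0.
have : 1 - `‖phi 0‖ ^+ 2 <= 2 * (1 - `‖phi 0‖).
  by have := nc_ge0 (phi 0); nra.
lra.
Qed.

Lemma selfmap_cball phi r : holo phi -> (forall z, `‖z‖ < 1 -> `‖phi z‖ < 1) ->
  0 <= r < 1 -> exists2 s, s < 1 & forall z, `‖z‖ <= r -> `‖phi z‖ <= s.
Proof.
move=> hp p1 /andP[r0 r1].
have [|z z1|z0 z0r zM] := @compact_nc_max R phi [set z | `‖z‖ <= r] (@compact_cball R r).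
- by exists 0; rewrite /= nc0.
- by apply: holo_cts => //; exact: le_lt_trans r1.
by exists `‖phi z0‖; [apply: p1; exact: le_lt_trans r1|].
Qed.

(** By injectivity f - f z0 is bounded below on a small circle around z0, and the
   minimum principle then gives a zero of f - y for every y near f z0. *)
Lemma injective_open f r z0 : holo f -> r <= 1 -> `‖z0‖ < r ->
  (forall z w, `‖z‖ < r -> `‖w‖ < r -> f z = f w -> z = w) ->
  \forall y \near f z0, exists2 z, `‖z‖ < r & f z = y.
Proof.
move=> hf r1 z0r finj; pose s1 := (r - `‖z0‖) / 2; pose s0 := s1 / 2.
have s10 : 0 < s1 by rewrite /s1; lra.
have s00 : 0 < s0 by rewrite /s0; lra.
have inr w : `‖w - z0‖ <= s1 -> `‖w‖ < r.
  by move=> h; have := nc_triangle (w - z0) z0; rewrite subrK /s1 in h *; lra.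
have s01 : s0 < s1 by rewrite /s0; lra.
have [c c0 cP] : exists2 c : R, 0 < c & forall w, `‖w - z0‖ = s0 -> c <= `‖f w - f z0‖.
  pose K := [set w : R[i] | `‖w - z0‖ = s0].
  have cK : compact K.
    apply: (subclosed_compact _ (@compact_cball R r)).
      have -> : K = [set w | `‖w - z0‖ <= s0] `&` [set w | s0 <= `‖w - z0‖].
        apply/seteqP; split => w /=; first by move=> ->; rewrite !lexx.
        by case=> h1 h2; apply/eqP; rewrite eq_le h1.
      apply: closedI; rewrite -openC openE => w /= /negP; rewrite -ltNge => h;
        apply/nbhsCP.
        exists (`‖w - z0‖ - s0); first by rewrite subr_gt0.
        move=> v vw /=; apply/negP; rewrite -ltNge.
        by have := nc_trans_sub v w z0; rewrite (nc_subC w v); lra.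
      exists (s0 - `‖w - z0‖); first by rewrite subr_gt0.
      move=> v vw /=; apply/negP; rewrite -ltNge.
      by have := nc_trans_sub w v z0; lra.
    by move=> w /= ws; apply/ltW/inr; rewrite ws ltW.
  have fK w : K w -> f w - f z0 != 0.
    move=> /= ws; rewrite subr_eq0; apply/eqP => /finj E.
    have : w = z0 by apply: E => //; apply: inr; rewrite ws ltW.
    by move=> wz; have := ws; rewrite /K /= wz subrr nc0 => h; move: s00; rewrite -h ltxx.
  have [||w Kw wP] := @compact_nc_max R (fun w => (f w - f z0)^-1) K cK.
  - by exists (z0 + s0%:C); rewrite /K /= addrC addKr nc_realp // ltW.
  - move=> w Kw; apply: tendsV; first exact: fK.
    apply: tendsB; last exact: tends_cst.
    apply: holo_cts => //; apply: (lt_le_trans _ r1); apply: inr.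
    by rewrite Kw ltW.
  exists `‖f w - f z0‖; first by rewrite nc_gt0 fK.
  move=> v Kv; have := wP v Kv; rewrite !normcV lef_pV2 ?posrE ?nc_gt0 //; exact: fK.
have c2 : 0 < c / 2 by rewrite divr_gt0.
apply/nbhsCP; exists (c / 2) => // y yc.
have hF : holo (fun w => f w - y) by apply: holoB hf _; exact: holo_cst.
have zs : `‖z0 - z0‖ < s0 by rewrite subrr nc0.
have as1 : `‖z0‖ + s1 <= 1 by rewrite /s1; lra.
have [||w ws /eqP] := min_modulus_zero (z := z0) (m := c / 2) hF as1 zs s01 _ _.
- by move=> w /cP /=; have := nc_trans_sub y (f w) (f z0); lra.
- by rewrite /= nc_subC.
- by rewrite subr_eq0 => /eqP <-; exists w => //; apply/inr/ltW.
Qed.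

End SchwarzPick.

(** * Runge approximation on disjoint conformal discs *)

Section PathInduction.
Variable R : realType.
Implicit Types (t a b : R).

(** The supremum of the points of the segment where P holds can be neither
   missed nor interior. *)
Lemma segment_induction (P : R -> Prop) a b : a <= b ->
  (forall t, a <= t <= b -> exists2 d : R, 0 < d & forall s1 s2,
     a <= s1 -> s1 <= t -> t <= s2 -> s2 <= b -> `|s1 - t| < d -> `|s2 - t| < d ->
     P s1 -> P s2) ->
  P a -> P b.
Proof.
move=> ab H Pa; pose S := [set t | a <= t <= b /\ P t].
have Sa : S a by split => //; rewrite lexx.
have Sb : ubound S b by move=> t [/andP[_ tb] _].
have hS : has_sup S by split; [exists a|exists b].
have ac : a <= sup S by apply: ub_le_sup => //; exists b.
have cb : sup S <= b by apply: ge_sup => //; exists a.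
have [d d0 dP] : exists2 d : R, 0 < d & forall s1 s2,
     a <= s1 -> s1 <= sup S -> sup S <= s2 -> s2 <= b ->
     `|s1 - sup S| < d -> `|s2 - sup S| < d -> P s1 -> P s2 by apply: H; rewrite ac.
have [s [/andP[sa sb] Ps] sd] := sup_adherent d0 hS.
have ss : s <= sup S by apply: ub_le_sup; [exists b|split => //; rewrite sa].
have s1d : `|s - sup S| < d by rewrite distrC ger0_norm ?subr_ge0 //; lra.
pose s2 := Num.min b (sup S + d / 2).
have s2s : sup S <= s2 by rewrite le_min cb /=; lra.
have s2b : s2 <= b by rewrite ge_min lexx.
have s2d : `|s2 - sup S| < d.
  rewrite ger0_norm; last by rewrite subr_ge0 le_min cb /= lerDl divr_ge0 // ltW.
  have : s2 <= sup S + d / 2 by rewrite ge_min lexx orbT.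
  lra.
have Ps2 := dP s s2 sa ss s2s s2b s1d s2d Ps.
suff -> : b = s2 by [].
apply/esym/min_idPl; rewrite leNgt; apply/negP => h.
have : s2 <= sup S.
  by apply: ub_le_sup; [exists b|split => //; rewrite s2b (le_trans sa) // (le_trans ss)].
have -> : s2 = sup S + d / 2 by apply/min_idPr/ltW.
lra.
Qed.

Lemma integ_refl (u : R -> R[i]) a : integ u a a = 0.
Proof. by rewrite /integ set_itv1 !Rintegral_set1. Qed.

Lemma convex_bounds (p q x y t : R) : 0 <= t <= 1 -> p < x < q -> p < y < q ->
  p < x + t * (y - x) < q.
Proof.
move=> /andP[t0 t1] /andP[px xq] /andP[py yq]; have t1' : 0 <= 1 - t by lra.
have a1 : 0 <= t * (y - p) by rewrite mulr_ge0 // subr_ge0 ltW.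
have a2 : 0 <= (1 - t) * (x - p) by rewrite mulr_ge0 // subr_ge0 ltW.
have a3 : 0 <= t * (q - y) by rewrite mulr_ge0 // subr_ge0 ltW.
have a4 : 0 <= (1 - t) * (q - x) by rewrite mulr_ge0 // subr_ge0 ltW.
have [t2|t2] := leP t 2^-1.
  have b2 : 0 < (1 - t) * (x - p) by apply: mulr_gt0; lra.
  have b4 : 0 < (1 - t) * (q - x) by apply: mulr_gt0; lra.
  by apply/andP; split; lra.
have b1 : 0 < t * (y - p) by apply: mulr_gt0; lra.
have b3 : 0 < t * (q - y) by apply: mulr_gt0; lra.
by apply/andP; split; lra.
Qed.

End PathInduction.

Section ZeroDerivative.
Variable R : realType.

Lemma cder_zero_const (f : R[i] -> R[i]) (z : R[i]) (d : R) :
  (forall w, `‖w - z‖ < d -> cder f w 0) ->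
  forall w, `‖w - z‖ < d -> f w = f z.
Proof.
move=> df w wz; apply/eqP; rewrite -subr_eq0 -nc_eq0 eq_le nc_ge0 andbT.
have [->|wn] := eqVneq w z; first by rewrite subrr nc0.
have h0 : 0 < `‖w - z‖ by rewrite nc_gt0 subr_eq0.
apply/ler_addgt0Pl => e e0; rewrite addr0.
pose c (t : R) : R[i] := z + t%:C * (w - z).
have cB s t : c s - c t = (s - t)%:C * (w - z) by rewrite rmorphB /c /=; ring.
have c1 : c 1 = w by rewrite /c mul1r addrC subrK.
have c0 : c 0 = z by rewrite /c mul0r addr0.
suff : `‖f (c 1) - f z‖ <= e * 1 by rewrite c1 mulr1.
apply: (@segment_induction R (fun t => `‖f (c t) - f z‖ <= e * t) 0 1 ler01);
  last by rewrite c0 subrr nc0 mulr0.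
move=> t /andP[t0 t1].
have dt : cder f (c t) 0.
  apply: df; rewrite -{1}c0 cB subr0 normcM nc_realp //.
  by apply: le_lt_trans wz; rewrite ler_piMl // nc_ge0.
have e1 : 0 < e / `‖w - z‖ by rewrite divr_gt0.
have /nbhsCP[k k0 kP] := (cder_eps _ _ _).1 dt _ e1.
exists (k / `‖w - z‖); first by rewrite divr_gt0.
have step s : `|s - t| < k / `‖w - z‖ -> `‖f (c s) - f (c t)‖ <= e * `|s - t|.
  rewrite ltr_pdivlMr // => sk.
  have := kP (c s); rewrite cB normcM nc_real => /(_ sk).
  by rewrite mul0r subr0 [X in _ <= X]mulrCA divfK ?gt_eqF // mulrC.
move=> s1 s2 _ s1t ts2 _ /step h1 /step h2 h3.
move: h1 h2; rewrite distrC !ger0_norm ?subr_ge0 // => h1 h2.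
have := nc_trans_sub (f (c t)) (f (c s2)) (f z).
have := nc_trans_sub (f (c s1)) (f (c t)) (f z).
rewrite (nc_subC (f (c t)) (f (c s1))); lra.
Qed.

End ZeroDerivative.

Section Runge.
Variables (R : realType) (I : finType).
Implicit Types (i j : I) (z w y : R[i]) (r t : R).

Lemma fin_bound (P : I -> R -> Prop) :
  (forall i (M N : R), M <= N -> P i M -> P i N) ->
  (forall i, exists M, P i M) -> exists M, 0 < M /\ forall i, P i M.
Proof.
move=> mono /choice[M MP].
exists (\sum_i `|M i| + 1); split.
  by rewrite ltr_wpDl // sumr_ge0.
move=> i; apply: mono (MP i); rewrite (bigD1 i) //=.
have : 0 <= \sum_(j | j != i) `|M j| by rewrite sumr_ge0.
have := ler_norm (M i); lra.
Qed.

Variables (psi : I -> R[i] -> R[i]) (r : R).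
Hypothesis r1 : 0 <= r < 1.
Hypothesis hpsi : forall i, holo (psi i).
Hypothesis ipsi : forall i z w, `‖z‖ < 1 -> `‖w‖ < 1 -> psi i z = psi i w -> z = w.
Hypothesis dpsi : forall i j z w, i != j -> `‖z‖ < 1 -> `‖w‖ < 1 -> psi i z <> psi j w.

Let E y := exists i z, `‖z‖ <= r /\ y = psi i z.

Let r_lt1 z : `‖z‖ <= r -> `‖z‖ < 1.
Proof. by move=> h; case/andP: r1 => _; apply: le_lt_trans. Qed.

Let E_bounded : exists M : R, 0 < M /\ forall y, E y -> `‖y‖ <= M.
Proof.
have [||M [M0 MP]] := @fin_bound (fun i M => forall z, `‖z‖ <= r -> `‖psi i z‖ <= M).
- by move=> i M N MN H z /H h; exact: le_trans MN.
- move=> i; case/andP: r1 => _ r1'.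
  by have [M _ MP] := cball_bound (hpsi i) r1'; exists M.
- by exists M; split => // y [i [z [zr ->]]]; exact: MP.
Qed.

Let E_dist w : ~ E w -> exists2 d : R, 0 < d & forall y, E y -> d <= `‖w - y‖.
Proof.
move=> Ew.
have nE i z : `‖z‖ <= r -> w - psi i z != 0.
  by move=> zr; rewrite subr_eq0; apply/eqP => wE; apply: Ew; exists i, z.
have [||M [M0 MP]] := @fin_bound (fun i M => forall z, `‖z‖ <= r -> `‖(w - psi i z)^-1‖ <= M).
- by move=> i M N MN H z /H h; exact: le_trans MN.
- move=> i.
  have [|z z1|z0 z0r zM] := @compact_nc_max R (fun z => (w - psi i z)^-1)
    [set z | `‖z‖ <= r] (@compact_cball R r).
  + by exists 0; rewrite /= nc0; case/andP: r1.
  + apply: tendsV; first exact: nE.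
    by apply: tendsB; [exact: tends_cst|exact: (holo_cts (hpsi i) (r_lt1 z1))].
  + by exists `‖(w - psi i z0)^-1‖ => z zr; exact: zM.
exists M^-1; first by rewrite invr_gt0.
move=> y [i [z [zr ->]]]; have := MP i z zr.
rewrite normcV => h; rewrite -[leRHS]invrK lef_pV2 ?posrE //.
by rewrite invr_gt0 nc_gt0 nE.
Qed.

Let appr (u : R[i] -> R[i]) := forall e : R, 0 < e ->
  exists p : {poly R[i]}, forall y, E y -> `‖p.[y] - u y‖ <= e.

Let appr_poly p : appr (fun y => p.[y]).
Proof. by move=> e e0; exists p => y _; rewrite subrr nc0 ltW. Qed.

Let poly_bounded (p : {poly R[i]}) : exists M : R, 0 < M /\ forall y, E y -> `‖p.[y]‖ <= M.
Proof.
have [B [B0 BP]] := E_bounded.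
elim/poly_ind: p => [|p c [M [M0 MP]]].
  by exists 1; split => // y _; rewrite horner0 nc0.
exists (M * B + `‖c‖ + 1); split.
  by rewrite ltr_wpDl // addr_ge0 ?nc_ge0 // mulr_ge0 // ltW.
move=> y Ey; rewrite hornerMXaddC; apply: (le_trans (nc_triangle _ _)).
rewrite normcM; have : `‖p.[y]‖ * `‖y‖ <= M * B.
  by apply: ler_pM; rewrite ?nc_ge0 // ?MP // BP.
lra.
Qed.

Let appr_bounded u : appr u -> exists M : R, 0 < M /\ forall y, E y -> `‖u y‖ <= M.
Proof.
move=> /(_ 1 ltr01)[p pP]; have [M [M0 MP]] := poly_bounded p.
exists (M + 1); split; first lra.
move=> y Ey; have := MP y Ey; have := pP y Ey; have := nc_sub_ge (u y) p.[y].
by rewrite (nc_subC (u y)); lra.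
Qed.

Let apprD u v : appr u -> appr v -> appr (fun y => u y + v y).
Proof.
move=> au av e e0; have e2 : 0 < e / 2 by rewrite divr_gt0.
have [[p pP] [q qP]] := (au _ e2, av _ e2); exists (p + q) => y Ey.
rewrite hornerD (_ : _ - _ = (p.[y] - u y) + (q.[y] - v y)); last by ring.
by rewrite (le_trans (nc_triangle _ _)) // [e]splitr lerD ?pP ?qP.
Qed.

Let apprM u v : appr u -> appr v -> appr (fun y => u y * v y).
Proof.
move=> au av e e0.
have [M [M0 MP]] := appr_bounded av.
have e1 : 0 < e / (2 * M) by rewrite divr_gt0 // mulr_gt0.
have [p pP] := au _ e1; have [N [N0 NP]] := poly_bounded p.
have e2 : 0 < e / (2 * N) by rewrite divr_gt0 // mulr_gt0.
have [q qP] := av _ e2; exists (p * q) => y Ey.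
rewrite hornerM (_ : _ - _ = p.[y] * (q.[y] - v y) + (p.[y] - u y) * v y); last by ring.
apply: (le_trans (nc_triangle _ _)); rewrite !normcM.
have -> : e = N * (e / (2 * N)) + e / (2 * M) * M.
  by field; rewrite !gt_eqF.
by apply: lerD; apply: ler_pM; rewrite ?nc_ge0 ?NP ?qP ?pP ?MP.
Qed.

Let appr_cst c : appr (fun=> c).
Proof. by move=> e e0; exists c%:P => y _; rewrite hornerC subrr nc0 ltW. Qed.

Let appr_ext u v : (forall y, E y -> u y = v y) -> appr u -> appr v.
Proof. by move=> uv au e /au[p pP]; exists p => y Ey; rewrite -uv ?pP. Qed.

Let appr_lim u : (forall e : R, 0 < e -> exists2 v, appr v &
  forall y, E y -> `‖v y - u y‖ <= e) -> appr u.
Proof.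
move=> H e e0; have e2 : 0 < e / 2 by rewrite divr_gt0.
have [v av vu] := H _ e2; have [p pP] := av _ e2; exists p => y Ey.
by rewrite (le_trans (nc_trans_sub (v y) _ _)) // [e]splitr lerD ?pP ?vu.
Qed.

(** The partial sums of the geometric series converge uniformly on E. *)
Let appr_geometric v : appr v -> (forall y, E y -> `‖v y‖ <= 2^-1) ->
  appr (fun y => (1 - v y)^-1).
Proof.
move=> av v2; pose g := fix g n y := if n is m.+1 then 1 + v y * g m y else 0.
have ag n : appr (g n).
  elim: n => [|n IH]; first exact: appr_cst.
  by apply: apprD; [exact: appr_cst|exact: apprM].
have nv y : E y -> 2^-1 <= `‖1 - v y‖.
  by move=> Ey; have := nc_sub_ge 1 (v y); rewrite nc1; have := v2 y Ey; lra.
have err n y : E y -> `‖g n y - (1 - v y)^-1‖ <= 2^-1 ^+ n * 2.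
  move=> Ey; have n0 : 0 < `‖1 - v y‖ by apply: lt_le_trans (nv y Ey).
  elim: n => [|n IH].
    rewrite /= sub0r nc_opp normcV mul1r -[leRHS]invrK lef_pV2 ?posrE ?nv //.
  rewrite /= (_ : _ - _ = v y * (g n y - (1 - v y)^-1)); last first.
    by field; rewrite -nc_gt0.
  rewrite normcM exprS -mulrA; apply: ler_pM; rewrite ?nc_ge0 ?v2 //.
apply: appr_lim => e e0.
have i1 : `|2^-1 : R| < 1 by rewrite ger0_norm ?invr_ge0 // invf_lt1 // ltr1n.
have /cvgrPdist_lt H := cvg_expr i1.
have e2 : 0 < e / 2 by rewrite divr_gt0.
have [n _ /(_ n (leqnn n))] := H _ e2.
rewrite /= sub0r normrN ger0_norm; last by rewrite exprn_ge0 // invr_ge0.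
move=> hn; exists (g n) => // y Ey; apply: (le_trans (err n y Ey)); lra.
Qed.

(** The set of admissible poles.  It is locally constant off E, by expansion of
   one Cauchy kernel in powers of another. *)
Let W w := ~ E w /\ appr (fun y => (w - y)^-1).

Let W_move w0 w : W w0 -> ~ E w ->
  (forall y, E y -> 2 * `‖w - w0‖ <= `‖w0 - y‖) -> W w.
Proof.
move=> [E0 a0] Ew H; split => //.
have n0 y : E y -> w0 - y != 0.
  by move=> Ey; rewrite subr_eq0; apply/eqP => h; apply: E0; rewrite h.
have n1 y : E y -> w - y != 0.
  by move=> Ey; rewrite subr_eq0; apply/eqP => h; apply: Ew; rewrite h.
have av : appr (fun y => (w0 - w) * (w0 - y)^-1) by apply: apprM => //; exact: appr_cst.
have v2 y : E y -> `‖(w0 - w) * (w0 - y)^-1‖ <= 2^-1.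
  move=> Ey; rewrite nc_div ler_pdivrMr ?nc_gt0 ?n0 // nc_subC.
  by have := H y Ey; lra.
have := apprM a0 (appr_geometric av v2); apply: appr_ext => y Ey.
rewrite (_ : 1 - _ = (w - y) / (w0 - y)); last by field; rewrite n0.
by rewrite invf_div mulrA mulVf ?n0 // mul1r.
Qed.

Let W_loc w : ~ E w -> exists2 d : R, 0 < d & forall w1 w2,
  `‖w1 - w‖ < d -> `‖w2 - w‖ < d -> [/\ ~ E w1, ~ E w2 & W w1 -> W w2].
Proof.
move=> /E_dist[D D0 DP]; exists (D / 5); first by rewrite divr_gt0.
move=> w1 w2 h1 h2.
have far v : `‖v - w‖ < D / 5 -> forall y, E y -> 4 * (D / 5) <= `‖v - y‖.
  move=> hv y Ey; have := DP y Ey; have := nc_trans_sub v w y.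
  by rewrite (nc_subC w v); lra.
have nE v : `‖v - w‖ < D / 5 -> ~ E v.
  by move=> hv Ev; have := far v hv v Ev; rewrite subrr nc0; lra.
split; [exact: nE|exact: nE|] => Ww1; apply: (W_move Ww1); first exact: nE.
move=> y Ey; have := far w1 h1 y Ey; have := nc_trans_sub w w2 w1.
by rewrite (nc_subC w w1); lra.
Qed.

(** For a pole far away from E the Cauchy kernel is a geometric series in y. *)
Let W_big : exists w, W w.
Proof.
have [B [B0 BP]] := E_bounded.
have [b nb] : exists b : R[i], `‖b‖ = 2 * B.
  by exists (2 * B)%:C; rewrite nc_realp // mulr_ge0 // ltW.
exists b.
have Eb : ~ E b by move=> /BP; rewrite nb; lra.
have bn : b != 0 by rewrite -nc_gt0 nb mulr_gt0.
split => //.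
have av : appr (fun y => b^-1 * y).
  by apply: apprM; [exact: appr_cst|have := appr_poly 'X; apply: appr_ext => y _; rewrite hornerX].
have v2 y : E y -> `‖b^-1 * y‖ <= 2^-1.
  move=> /BP yB; rewrite normcM normcV nb mulrC ler_pdivrMr ?mulr_gt0 //; lra.
have := apprM (appr_cst b^-1) (appr_geometric av v2); apply: appr_ext => y Ey.
have n1 : b - y != 0.
  by rewrite subr_eq0; apply/eqP => h; apply: Eb; rewrite h.
rewrite (_ : 1 - _ = (b - y) / b); last by field.
by rewrite invf_div mulrA mulVf // mul1r.
Qed.

Lemma loc_const_path (V : R[i] -> Prop) (c : R -> R[i]) : ctsR c ->
  (forall t, 0 <= t <= 1 -> exists2 d : R, 0 < d & forall w1 w2,
     `‖w1 - c t‖ < d -> `‖w2 - c t‖ < d -> V w1 -> V w2) ->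
  V (c 0) -> V (c 1).
Proof.
move=> cc H; apply: (@segment_induction R (fun t => V (c t)) 0 1 ler01) => // t t01.
have [d d0 dP] := H t t01.
have /nbhs_ballP[e /= e0 eP] := cc t d d0.
exists e => // s1 s2 _ _ _ _ h1 h2; apply: dP; apply: eP; rewrite /ball /= distrC //.
Qed.

Lemma polar z : exists t, z = circ `‖z‖ t.
Proof.
have [->|z0] := eqVneq z 0; first by exists 0; rewrite nc0 /circ mul0r.
have nz : 0 < `‖z‖ by rewrite nc_gt0.
case: z z0 nz => a b z0 nz; set n := normc (a +i* b) in nz *.
have n2 : n ^+ 2 = a ^+ 2 + b ^+ 2 by rewrite /n nc_sqr.
have nV : `|n^-1| = n^-1 by rewrite ger0_norm // invr_ge0 ltW.
have x1 : -1 <= a / n <= 1.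
  rewrite -ler_norml normrM nV ler_pdivrMr // mul1r.
  exact: (nc_Re (a +i* b)).
have cE : cos (acos (a / n)) = a / n by apply: acosK; rewrite in_itv.
have sE : sin (acos (a / n)) = `|b| / n.
  rewrite sin_acos // expr_div_n (_ : 1 - _ = (b / n) ^+ 2); last first.
    by rewrite expr_div_n n2; field; rewrite -n2 expf_neq0 // gt_eqF.
  by rewrite sqrtr_sqr normrM nV.
have nn : n != 0 by rewrite gt_eqF.
have [b0|b0] := leP 0 b.
  exists (acos (a / n)); apply: eqC; rewrite /circ /cis cE sE (ger0_norm b0) /=; field;
    by rewrite nn.
exists (- acos (a / n)); apply: eqC; rewrite /circ /cis cosN sinN cE sE (ltr0_norm b0) /=; field;
  by rewrite nn.
Qed.

Let not_E_annulus i z : r < `‖z‖ -> `‖z‖ < 1 -> ~ E (psi i z).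
Proof.
move=> rz z1 [j [w [wr zw]]]; have w1 := r_lt1 wr.
have [ij|ij] := eqVneq i j; last exact: (dpsi ij z1 w1 zw).
rewrite -ij in zw; have := ipsi z1 w1 zw => zw'.
by move: rz; rewrite zw' ltNge wr.
Qed.

(** The collar r < |z| < 1 is connected: interpolate moduli and arguments. *)
Let annulus_W i z w : r < `‖z‖ -> `‖z‖ < 1 -> r < `‖w‖ -> `‖w‖ < 1 ->
  W (psi i z) -> W (psi i w).
Proof.
move=> rz z1 rw w1; have [a zE] := polar z; have [b wE] := polar w.
pose m t : R := `‖z‖ + t * (`‖w‖ - `‖z‖).
pose c t : R[i] := circ (m t) (a + t * (b - a)).
have m_in t : 0 <= t <= 1 -> r < m t < 1.
  by rewrite /m => t01; apply: convex_bounds; rewrite ?rz ?rw.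
have cm : continuous m.
  by move=> t; apply: cvgD; [exact: cvg_cst|apply: cvgM; [exact: cvg_id|exact: cvg_cst]].
have ca : continuous (fun t => a + t * (b - a)).
  by move=> t; apply: cvgD; [exact: cvg_cst|apply: cvgM; [exact: cvg_id|exact: cvg_cst]].
have cc : ctsR c.
  apply: ctsRM; first by move=> t; apply: tends_real; exact: cm.
  apply: ctsR_part => t /=.
    exact: (cvg_comp _ _ (ca t) (@continuous_cos R _)).
  exact: (cvg_comp _ _ (ca t) (@continuous_sin R _)).
have c0 : c 0 = z by rewrite /c /m !mul0r !addr0 -zE.
have c1 : c 1 = w by rewrite /c /m !mul1r ![_ + (_ - _)]addrC !subrK -wE.
have cin t : 0 <= t <= 1 -> r < `‖c t‖ < 1.
  move=> /m_in mt; rewrite nc_circ_abs ger0_norm //.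
  by case/andP: mt => rm _; case/andP: r1 => r0 _; rewrite ltW // (le_lt_trans r0).
rewrite -{1}c0 -c1.
apply: (@segment_induction R (fun t => W (psi i (c t))) 0 1 ler01) => // t t01.
have /andP[ct1 ct2] := cin t t01.
have [d d0 dP] := @W_loc (psi i (c t)) (@not_E_annulus i _ ct1 ct2).
have cpc : tends (nbhs t) (fun s => psi i (c s)) (psi i (c t)).
  by apply: (tends_comp (g := psi i)) (cc t); exact: holo_cts.
have /nbhs_ballP[e /= e0 eP] := cpc d d0.
exists e => // s1 s2 _ _ _ _ h1 h2.
by have [] := dP (psi i (c s1)) (psi i (c s2)); rewrite //; apply: eP; rewrite /ball /= distrC.
Qed.

(** The complement of E is connected.  Filling in those discs whose collar
   consists of admissible poles turns W into a clopen nonempty subset of the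
   plane: near a point of a disc the whole neighbourhood lies in the image of
   the slightly larger disc, by openness of injective holomorphic maps. *)
Let collar_W i z : r < `‖z‖ -> `‖z‖ < 1 -> W (psi i z).
Proof.
pose full i := forall z, r < `‖z‖ -> `‖z‖ < 1 -> W (psi i z).
pose V w := W w \/ exists j v, [/\ `‖v‖ <= r, w = psi j v & full j].
have own j v : `‖v‖ < 1 -> V (psi j v) -> full j.
  move=> v1; have [rv|vr] := ltP r `‖v‖.
    case=> [Wv x rx x1|[k [u [ur uv _]]]]; first exact: annulus_W Wv.
    by case: (not_E_annulus (i := j) rv v1); exists k, u.
  case=> [[nE _]|[k [u [ur uv fk]]]]; first by case: nE; exists j, v.
  have [jk|jk] := eqVneq j k; first by rewrite jk.
  by case: (dpsi jk v1 (r_lt1 ur) uv).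
have own' j v : `‖v‖ < 1 -> full j -> V (psi j v).
  move=> v1 fj; have [rv|vr] := ltP r `‖v‖; first by left; exact: fj.
  by right; exists j, v.
have loc w : exists2 d : R, 0 < d & forall w1 w2,
    `‖w1 - w‖ < d -> `‖w2 - w‖ < d -> V w1 -> V w2.
  have [[j [v [vr ->]]]|nE] := EM (E w).
    have v1 := r_lt1 vr.
    have /nbhsCP[d d0 dP] := injective_open (hpsi j) (lexx 1) v1 (@ipsi j).
    exists d => // w1 w2 /dP[z1 z11 <-] /dP[z2 z21 <-] V1.
    by apply: own' => //; exact: own V1.
  have [d d0 dP] := W_loc nE; exists d => // w1 w2 h1 h2.
  have [n1 _ W12] := dP w1 w2 h1 h2.
  case=> [/W12|[j [v [vr w1E _]]]]; first by left.
  by case: n1; exists j, v.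
move=> rz z1; suff : V (psi i 0) by move=> /own; rewrite nc0; apply.
have [w0 Ww0] := W_big.
pose c t : R[i] := w0 + t%:C * (psi i 0 - w0).
have c0 : c 0 = w0 by rewrite /c mul0r addr0.
have c1 : c 1 = psi i 0 by rewrite /c mul1r addrC subrK.
rewrite -c1; apply: (@loc_const_path V c); rewrite ?c0.
- apply: ctsRD; first exact: ctsR_cst.
  apply: ctsRM; last exact: ctsR_cst.
  by move=> t; apply: tends_real; exact: cvg_id.
- by move=> t _; exact: loc.
- by left.
Qed.

(** The integral is a limit of Riemann sums of Cauchy kernels with admissible
   poles; continuous induction on the upper end adds one short interval at a
   time, with an error proportional to its length. *)
Let appr_integ (k c : R -> R[i]) (L : R) : 0 <= L -> ctsR k -> ctsR c ->
  (forall t, W (c t)) -> appr (fun y => integ (fun t => k t / (c t - y)) 0 L).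
Proof.
move=> L0 ck cc Wc; apply: appr_lim => e e0.
pose e1 := e / (L + 1); have L1 : 0 < L + 1 by lra.
have e10 : 0 < e1 by rewrite divr_gt0.
have nc t y : E y -> c t - y != 0.
  by move=> Ey; rewrite subr_eq0; apply/eqP => h; case: (Wc t) => nE _; apply: nE; rewrite h.
have cu y : E y -> ctsR (fun t => k t / (c t - y)).
  move=> Ey; apply: ctsRM => //; apply: ctsRV; first by move=> t; exact: nc.
  by apply: ctsRB => //; exact: ctsR_cst.
suff [v av vP] : exists2 v, appr v &
    forall y, E y -> `‖v y - integ (fun t => k t / (c t - y)) 0 L‖ <= e1 * L.
  exists v => // y Ey; apply: (le_trans (vP y Ey)).
  by rewrite /e1 mulrAC ler_pdivrMr // ler_pM2l //; lra.
apply: (@segment_induction R (fun b => exists2 v, appr v &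
    forall y, E y -> `‖v y - integ (fun t => k t / (c t - y)) 0 b‖ <= e1 * b) 0 L L0).
  move=> t _; have [nE at_] := Wc t.
  have [D D0 DP] := E_dist nE.
  pose h := Num.min (D / 2) (e1 * D ^+ 2 / (4 * (`‖k t‖ + 1))).
  have kt0 := nc_ge0 (k t).
  have kt1 : 0 < `‖k t‖ + 1 by rewrite ltr_wpDl.
  have h0 : 0 < h.
    rewrite lt_min divr_gt0 //=; apply: divr_gt0; apply: mulr_gt0 => //.
    exact: exprn_gt0.
  have h1 : h <= D / 2 by rewrite ge_min lexx.
  have h2 : h * (`‖k t‖ + 1) <= e1 * D ^+ 2 / 4.
    have : h <= e1 * D ^+ 2 / (4 * (`‖k t‖ + 1)) by rewrite ge_min lexx orbT.
    by rewrite -ler_pdivlMr ?ltr_wpDl // invfM mulrA.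
  have g0 : 0 < e1 * D / 4 by rewrite divr_gt0 // mulr_gt0.
  have /nbhs_ballP[d1 /= d10 d1P] := cc t h h0.
  have /nbhs_ballP[d2 /= d20 d2P] := ck t _ g0.
  have close s y : `|s - t| < Num.min d1 d2 -> E y ->
      `‖k s / (c s - y) - k t / (c t - y)‖ <= e1.
    rewrite lt_min => /andP[sd1 sd2] Ey.
    have c1 : `‖c s - c t‖ < h by apply: d1P; rewrite /ball /= distrC.
    have k1 : `‖k s - k t‖ < e1 * D / 4 by apply: d2P; rewrite /ball /= distrC.
    have n1 := DP y Ey.
    have n2 : D / 2 <= `‖c s - y‖.
      by have := nc_trans_sub (c s) (c t) y; rewrite (nc_subC (c t) (c s)); lra.
    have p1 : 0 < `‖c t - y‖ by lra.
    have p2 : 0 < `‖c s - y‖ by lra.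
    rewrite (_ : _ - _ = (k s - k t) / (c s - y) - k t * (c s - c t) / ((c s - y) * (c t - y)));
      last by field; rewrite !nc.
    apply: (le_trans (nc_sub_le _ _)); rewrite !nc_div !normcM.
    have -> : e1 = e1 / 2 + e1 / 2 by field.
    apply: lerD; rewrite ler_pdivrMr ?mulr_gt0 //.
      have : e1 / 2 * (D / 2) <= e1 / 2 * `‖c s - y‖ by rewrite ler_wpM2l // divr_ge0 // ltW.
      lra.
    have m1 : `‖k t‖ * `‖c s - c t‖ <= e1 * D ^+ 2 / 4.
      apply: le_trans h2; rewrite [leRHS]mulrC; apply: ler_pM; rewrite ?nc_ge0 //; lra.
    have m2 : D / 2 * D <= `‖c s - y‖ * `‖c t - y‖ by apply: ler_pM => //; lra.
    apply: (le_trans m1); apply: (@le_trans _ _ (e1 / 2 * (D / 2 * D))).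
      by rewrite le_eqVlt; apply/orP; left; apply/eqP; field.
    by rewrite ler_wpM2l // divr_ge0 // ltW.
  exists (Num.min d1 d2); first by rewrite lt_min d10.
  move=> s1 s2 s10 s1t ts2 s2L t1 t2 [v av vP]; have s12 := le_trans s1t ts2.
  exists (fun y => v y + (s2 - s1)%:C * (k t * (c t - y)^-1)).
    apply: apprD => //; apply: apprM; first exact: appr_cst.
    by apply: apprM => //; exact: appr_cst.
  move=> y Ey; rewrite -(integ_add s10 s12 (cu y Ey)).
  have cd : ctsR (fun s => k s / (c s - y) - k t / (c t - y)).
    by apply: ctsRB; [exact: cu|exact: ctsR_cst].
  have I1 : integ (fun s => k s / (c s - y) - k t / (c t - y)) s1 s2 =
     integ (fun s => k s / (c s - y)) s1 s2 - k t / (c t - y) * (s2 - s1)%:C.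
    by rewrite integB // ?integ_cst //; [exact: cu|exact: ctsR_cst].
  rewrite (_ : _ - _ = (v y - integ (fun s => k s / (c s - y)) 0 s1) -
     integ (fun s => k s / (c s - y) - k t / (c t - y)) s1 s2); last by rewrite I1; ring.
  apply: (le_trans (nc_sub_le _ _)).
  have -> : e1 * s2 = e1 * s1 + e1 * (s2 - s1) by ring.
  apply: lerD; first exact: vP.
  apply: integ_le => // s /andP[ss1 ss2]; apply: close => //.
  by move: t1 t2; rewrite !ltr_norml => /andP[? ?] /andP[? ?]; apply/andP; split; lra.
exists (fun=> 0); first exact: appr_cst.
by move=> y Ey; rewrite integ_refl subrr nc0 mulr0.
Qed.

Let rho : R := (1 + r) / 2.

Let rho_bounds : [/\ 0 < rho, r < rho & rho < 1].
Proof. by case/andP: r1 => ? ?; rewrite /rho; split; lra. Qed.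

(** With w = psi i zeta this is the Cauchy integral of g composed with the inverse
   of psi i, along the boundary of the image of the disc of radius rho. *)
Let residue i (g : R[i] -> R[i]) y : R[i] :=
  integ (fun t => g (circ rho t) * derive1 (psi i) (circ rho t) * circ rho t / (2 * pi)%:C
                  / (psi i (circ rho t) - y)) 0 (2 * pi).

Let nc_rho t : `‖circ rho t : R[i]‖ = rho.
Proof. by case: rho_bounds => h _ _; rewrite nc_circ_abs gtr0_norm. Qed.

(** The integrand is holomorphic in the whole disc and vanishes at 0. *)
Let residue_other i g y : holo g -> (forall w, `‖w‖ < 1 -> psi i w <> y) ->
  residue i g y = 0.
Proof.
move=> hg ny; have [p0 _ p1] := rho_bounds.
pose G w := g w * derive1 (psi i) w * w / (2 * pi)%:C / (psi i w - y).
have hG : holo G.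
  apply: holoM; last first.
    apply: holoV; first by move=> w w1; rewrite subr_eq0; apply/eqP; exact: ny.
    by apply: holoB => //; exact: holo_cst.
  apply: holoM; last exact: holo_cst.
  by apply: holoM (@holo_id R); apply: holoM => //; exact: holo_derive1.
have r01 : 0 <= rho < 1 by rewrite (ltW p0).
have G0 : G 0 = 0 by rewrite /G !mulr0 !mul0r.
have := mean_value hG r01; rewrite G0 mul0r => <-.
by apply: eq_integ => t _.
Qed.

(** If the derivative does not vanish at z this is Cauchy's formula for
   g psi' divided by the divided difference of psi, which has no zeros because
   psi is injective. *)
Let residue_regular i g z : holo g -> `‖z‖ < rho -> derive1 (psi i) z != 0 ->
  residue i g (psi i z) = g z.
Proof.
move=> hg zr dz; have [p0 _ p1] := rho_bounds; have z1 := lt_trans zr p1.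
have q0 w : `‖w‖ < 1 -> dquot (psi i) z w != 0.
  move=> w1; rewrite /dquot; case: (eqVneq w z) => // wz.
  rewrite -nc_gt0 nc_div divr_gt0 // nc_gt0 subr_eq0 //.
  by apply: contra_neq wz; exact: ipsi.
pose k w := g w * derive1 (psi i) w * (dquot (psi i) z w)^-1.
have hk : holo k.
  apply: holoM; first by apply: holoM => //; exact: holo_derive1.
  by apply: holoV => //; exact: holo_dquot.
have kz : k z = g z by rewrite /k /dquot eqxx mulfK.
rewrite -[RHS]kz (cauchy_formula hk zr p1) /residue /cauchy_int.
apply: eq_integ => t _; rewrite /cauchy_density /k.
have c1 : `‖circ rho t : R[i]‖ < 1 by rewrite nc_rho.
have -> : psi i (circ rho t) - psi i z = (circ rho t - z) * dquot (psi i) z (circ rho t).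
  by rewrite (dquotE (psi i) z (circ rho t)) addrC addKr.
have n1 := q0 _ c1; have n2 := circ_sub_neq0 t zr.
move: ((2 * pi)%:C) (@two_pi_neq0 R) => P Pn.
by field; rewrite n1 n2 Pn.
Qed.

(** The exceptional points are removed by continuity: the derivative of an
   injective map cannot vanish identically near a point. *)
Let residue_self i g z : holo g -> `‖z‖ < rho -> residue i g (psi i z) = g z.
Proof.
move=> hg zr; have [p0 _ p1] := rho_bounds; have z1 := lt_trans zr p1.
pose k t := g (circ rho t) * derive1 (psi i) (circ rho t) * circ rho t / (2 * pi)%:C.
have p1' : `|rho| < 1 by rewrite gtr0_norm.
have ck : ctsR k.
  apply: ctsRM; last exact: ctsR_cst.
  apply: ctsRM (ctsR_circ rho); apply: ctsRM; apply: ctsR_circ_comp => // w w1.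
    exact: holo_cts.
  by apply: holo_cts => //; exact: holo_derive1.
have cp : ctsR (fun t => psi i (circ rho t)).
  by apply: ctsR_circ_comp => // w w1; exact: holo_cts.
have nz t w : `‖w‖ < rho -> psi i (circ rho t) - psi i w != 0.
  move=> wr; rewrite subr_eq0; apply/eqP => /ipsi zw.
  have : circ rho t = w by apply: zw; [rewrite nc_rho|exact: lt_trans p1].
  by move=> h; move: wr; rewrite -h nc_rho ltxx.
have cK w : `‖w‖ < rho -> ctsR (fun t => k t / (psi i (circ rho t) - psi i w)).
  move=> wr; apply: ctsRM => //; apply: ctsRV; first by move=> t; exact: nz.
  by apply: ctsRB => //; exact: ctsR_cst.
have cres : tends (nbhs z) (fun w => residue i g (psi i w)) (residue i g (psi i z)).
  apply: tends_integ; [exact: two_pi_ge0| |exact: cK|].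
    by apply: filterS (near_ltr zr) => w; exact: cK.
  move=> t _; apply: tendsM; first exact: (tends_fst (ck t)).
  apply: tendsV; first exact: nz.
  apply: tendsB; first exact: (tends_fst (cp t)).
  exact: (@tends_snd R R R[i] (nbhs t) (nbhs z) _ _ (psi i) _ (holo_cts (hpsi i) z1)).
apply/eqP; rewrite -subr_eq0; apply: contrapT => /negP Fz.
have tF : tends (nbhs z) (fun w => residue i g (psi i w) - g w) (residue i g (psi i z) - g z).
  exact: (tendsB cres (holo_cts hg z1)).
have cF : \forall w \near z, `‖residue i g (psi i z) - g z‖ / 2 < `‖residue i g (psi i w) - g w‖.
  exact: (tends_away Fz tF).
have /nbhsCP[d d0 dP] : \forall w \near z,
    `‖residue i g (psi i z) - g z‖ / 2 < `‖residue i g (psi i w) - g w‖ /\ `‖w‖ < rho.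
  exact: (filterI cF (near_ltr zr)).
have dz w : `‖w - z‖ < d -> cder (psi i) w 0.
  move=> /dP[Fw wr]; have w1 := lt_trans wr p1.
  have := holo_cder (hpsi i) w1.
  have [->//|dw] := eqVneq (derive1 (psi i) w) 0.
  exfalso; move: Fw; rewrite (residue_regular hg wr dw) subrr nc0.
  by have := nc_ge0 (residue i g (psi i z) - g z); lra.
pose w := z + (d / 2)%:C.
have wz : `‖w - z‖ = d / 2 by rewrite /w addrC addKr nc_realp // divr_ge0 // ltW.
have wd : `‖w - z‖ < d by rewrite wz; lra.
have w1 : `‖w‖ < 1 by have [_ h] := dP w wd; exact: lt_trans p1.
have := ipsi w1 z1 (cder_zero_const dz wd).
move=> /eqP; rewrite -subr_eq0 -nc_eq0 wz; apply/negP.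
by rewrite gt_eqF // divr_gt0.
Qed.

(** On the image of psi i the sum of all the Cauchy integrals reduces to the i-th
   term, and each of them is approximable since its poles lie in the collars. *)
Lemma runge_unit (g : I -> R[i] -> R[i]) (e : R) : (forall i, holo (g i)) ->
  0 < e -> exists p : {poly R[i]}, forall i z, `‖z‖ <= r ->
    `‖p.[psi i z] - g i z‖ <= e.
Proof.
move=> hg e0; have [p0 rp p1] := rho_bounds.
have p1' : `|rho| < 1 by rewrite gtr0_norm.
have ares i : appr (residue i (g i)).
  apply: appr_integ; first exact: two_pi_ge0.
  - apply: ctsRM; last exact: ctsR_cst.
    apply: ctsRM (ctsR_circ rho); apply: ctsRM; apply: ctsR_circ_comp => // w w1.
      exact: holo_cts.
    by apply: holo_cts => //; exact: holo_derive1.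
  - by apply: ctsR_circ_comp => // w w1; exact: holo_cts.
  - by move=> t; apply: collar_W; rewrite nc_rho.
have asum (s : seq I) : appr (fun y => \sum_(i <- s) residue i (g i) y).
  elim: s => [|i s IH].
    by apply: appr_ext (appr_cst 0) => y _; rewrite big_nil.
  by apply: appr_ext (apprD (ares i) IH) => y _; rewrite big_cons.
have [p pP] := asum (index_enum I) e e0; exists p => j z zr.
have zE : E (psi j z) by exists j, z.
have := pP _ zE; rewrite (bigD1 j) //= big1 ?addr0.
  by rewrite residue_self // (le_lt_trans zr).
move=> i ij; apply: residue_other => // w w1 h.
exact: (dpsi ij w1 (r_lt1 zr) h).
Qed.

End Runge.

Section RungeRescaled.
Variables (R : realType) (I : finType).

(** Rescaling by s reduces to maps that are injective on the whole unit disc. *)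
Lemma runge_discs (psi g : I -> R[i] -> R[i]) (r s e : R) :
  0 <= r -> r < s -> s <= 1 ->
  (forall i, holo (psi i)) -> (forall i, holo (g i)) ->
  (forall i z w, `‖z‖ < s -> `‖w‖ < s -> psi i z = psi i w -> z = w) ->
  (forall i j z w, i != j -> `‖z‖ < s -> `‖w‖ < s -> psi i z <> psi j w) ->
  0 < e ->
  exists p : {poly R[i]}, forall i z, `‖z‖ <= r -> `‖p.[psi i z] - g i z‖ <= e.
Proof.
move=> r0 rs s1 hpsi hg ipsi dpsi e0.
have s0 : 0 < s := le_lt_trans r0 rs.
have sn : s%:C != 0 :> R[i] by rewrite -nc_gt0 nc_realp ?ltW.
pose sc (f : R[i] -> R[i]) w := f (0 + s%:C * w).
have hsc f : holo f -> holo (sc f).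
  by move=> hf; apply: holo_affine => //; [exact: ltW|rewrite nc0 add0r].
have in_s z : `‖z‖ < 1 -> `‖0 + s%:C * z‖ < s.
  by move=> z1; rewrite add0r normcM nc_realp ?(ltW s0) // gtr_pMr.
have q1 : 0 <= r / s < 1 by rewrite divr_ge0 ?(ltW s0) //= ltr_pdivrMr // mul1r.
have [||||p pP] := @runge_unit R I (fun i => sc (psi i)) (r / s) q1 _ _ _ (fun i => sc (g i)) e _ e0.
- by move=> i; exact: hsc.
- move=> i z w z1 w1 /ipsi zw; have := zw (in_s z z1) (in_s w w1).
  by rewrite !add0r => /(mulfI sn).
- by move=> i j z w ij z1 w1; apply: dpsi => //; exact: in_s.
- by move=> i; exact: hsc.
exists p => i z zr; have := pP i (z / s%:C).
rewrite /sc add0r [s%:C * _]mulrC divfK //; apply.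
by rewrite nc_div nc_realp ?(ltW s0) // ler_wpM2r // invr_ge0 ltW.
Qed.

End RungeRescaled.

(** * Gluing bounded functions *)

Section Transition.
Variable R : realType.
Implicit Types (q z w a b : R[i]) (t : R) (N : nat).

Lemma nc_sum (T : Type) (s : seq T) (f : T -> R[i]) :
  `‖\sum_(i <- s) f i‖ <= \sum_(i <- s) `‖f i‖.
Proof.
elim: s => [|x s IH]; first by rewrite !big_nil nc0.
by rewrite !big_cons (le_trans (nc_triangle _ _)) // lerD2l.
Qed.

Lemma half_plane_sqr q t : 0 < Re q -> 0 < t ->
  `‖q‖ ^+ 2 + t ^+ 2 <= `‖q + t%:C‖ ^+ 2.
Proof.
case: q => a b /= a0 t0; rewrite !nc_sqr /=.
have : 0 <= a * t by rewrite mulr_ge0 // ltW.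
by lra.
Qed.

Lemma half_plane_ge_t q t : 0 < Re q -> 0 < t -> t <= `‖q + t%:C‖.
Proof.
move=> q0 t0; rewrite -ler_sqr ?nnegrE ?nc_ge0 ?(ltW t0) //.
by apply: le_trans (half_plane_sqr q0 t0); rewrite lerDr exprn_ge0 ?nc_ge0.
Qed.

Lemma half_plane_ge_q q t : 0 < Re q -> 0 < t -> `‖q‖ <= `‖q + t%:C‖.
Proof.
move=> q0 t0; rewrite -ler_sqr ?nnegrE ?nc_ge0 //.
by apply: le_trans (half_plane_sqr q0 t0); rewrite lerDl exprn_ge0 // ltW.
Qed.

(** The cost of one transition at scale t is a telescoping difference in the
   dyadic scale, so that N transitions cost at most a constant in total. *)
Lemma transition_cost q t : 0 < Re q -> 0 < t ->
  `‖q / (q + t%:C)‖ + `‖t%:C / (q + t%:C)‖ <=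
  1 + 7 * ((2 * t) / (`‖q‖ + 2 * t) - t / (`‖q‖ + t)).
Proof.
move=> q0 t0; have S := half_plane_sqr q0 t0.
have d0 : 0 < `‖q + t%:C‖ by exact: lt_le_trans (half_plane_ge_t q0 t0).
have r0 : 0 < `‖q‖ by exact: lt_le_trans q0 (le_trans (ler_norm _) (nc_Re q)).
rewrite !nc_div nc_realp ?(ltW t0) // -mulrDl.
set r := `‖q‖ in S r0 *; set d := `‖q + _‖ in S d0 *.
have rt : 0 < r ^+ 2 + t ^+ 2 by rewrite addr_gt0 ?exprn_gt0.
have A : (r + t) / d <= 1 + 2 * r * t / (r ^+ 2 + t ^+ 2).
  have [h|h] := leP ((r + t) / d) 1.
    by apply: (le_trans h); rewrite lerDl divr_ge0 ?mulr_ge0 // ltW.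
  apply: (@le_trans _ _ (((r + t) / d) ^+ 2)).
    by rewrite expr2 ler_peMl ?divr_ge0 ?addr_ge0 // ltW.
  rewrite expr_div_n ler_pdivrMr ?exprn_gt0 //.
  have -> : 1 + 2 * r * t / (r ^+ 2 + t ^+ 2) = (r + t) ^+ 2 / (r ^+ 2 + t ^+ 2).
    by field; rewrite gt_eqF.
  by rewrite mulrAC ler_pdivlMr // ler_wpM2l // exprn_ge0 // addr_ge0 // ltW.
apply: (le_trans A); rewrite lerD2l.
have -> : 2 * t / (r + 2 * t) - t / (r + t) = r * t / ((r + 2 * t) * (r + t)).
  by field; rewrite !gt_eqF // ?addr_gt0 // ?mulr_gt0.
have p0 : 0 < (r + 2 * t) * (r + t) by rewrite mulr_gt0 ?addr_gt0 ?mulr_gt0.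
rewrite mulrA ler_pdivlMr // mulrAC ler_pdivrMr //.
have rt0 : 0 < r * t by rewrite mulr_gt0.
have key : 2 * ((r + 2 * t) * (r + t)) <= 7 * (r ^+ 2 + t ^+ 2).
  have : 0 <= (r - t) ^+ 2 by rewrite sqr_ge0.
  have : 0 <= r ^+ 2 by rewrite sqr_ge0.
  lra.
have := ler_wpM2l (ltW rt0) key; lra.
Qed.

(** Average of the transition functions q/(q + t) over dyadic scales t: a
   holomorphic interpolation between 0 near q = 0 and 1 near infinity, with
   values almost in the segment [0, 1]. *)
Definition transition t N q : R[i] :=
  (N%:R^-1)%:C * \sum_(k < N) q / (q + (t * 2 ^+ k)%:C).

Section Bounds.
Variables (t : R) (N : nat) (q : R[i]).
Hypotheses (t0 : 0 < t) (N0 : (0 < N)%N) (q0 : 0 < Re q).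

Let tk (k : nat) : 0 < t * 2 ^+ k. Proof. by rewrite mulr_gt0 // exprn_gt0. Qed.

Let N0' : 0 < N%:R :> R. Proof. by rewrite ltr0n. Qed.

Lemma transition_compl :
  1 - transition t N q = (N%:R^-1)%:C * \sum_(k < N) (t * 2 ^+ k)%:C / (q + (t * 2 ^+ k)%:C).
Proof.
rewrite /transition (_ : 1 = (N%:R^-1)%:C * \sum_(k < N) (1 : R[i])); last first.
  rewrite sumr_const card_ord -[1 *+ N]/(N%:R) -(rmorph_nat (real_complex R)).
  by rewrite -[_%:C * _]rmorphM mulVf // gt_eqF.
rewrite -mulrBr -sumrB; congr (_ * _); apply: eq_bigr => k _.
have n0 : q + (t * 2 ^+ k)%:C != 0.
  by rewrite -nc_gt0; exact: lt_le_trans (half_plane_ge_t q0 (tk k)).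
by move: n0; move: ((t * 2 ^+ k)%:C) => x n0; field.
Qed.

Let avg_le (f : 'I_N -> R[i]) (M : R) : (forall k, `‖f k‖ <= M) ->
  `‖(N%:R^-1)%:C * \sum_(k < N) f k‖ <= M.
Proof.
move=> fM; rewrite normcM nc_realp ?invr_ge0 ?(ltW N0') // ler_pdivrMl //.
apply: (le_trans (nc_sum _ _)); apply: (@le_trans _ _ (\sum_(k < N) M)).
  by apply: ler_sum => k _; exact: fM.
by rewrite sumr_const card_ord mulr_natl.
Qed.

Lemma transition_near0 : `‖transition t N q‖ <= `‖q‖ / t.
Proof.
apply: avg_le => k; rewrite nc_div ler_wpM2l ?nc_ge0 // lef_pV2 ?posrE //.
  apply: le_trans (half_plane_ge_t q0 (tk k)).
  by rewrite ler_peMr ?(ltW t0) // exprn_ege1 // ler1n.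
exact: lt_le_trans (half_plane_ge_t q0 (tk k)).
Qed.

Let qn : 0 < `‖q‖.
Proof. exact: lt_le_trans q0 (le_trans (ler_norm _) (nc_Re q)). Qed.

Lemma transition_nearoo : `‖1 - transition t N q‖ <= t * 2 ^+ N / `‖q‖.
Proof.
rewrite transition_compl; apply: avg_le => k.
rewrite nc_div nc_realp ?(ltW (tk k)) //.
apply: ler_pM; rewrite ?invr_ge0 ?nc_ge0 ?(ltW (tk k)) //.
  by rewrite ler_pM2l // ler_weXn2l ?ler1n // ltnW.
rewrite lef_pV2 ?posrE //; first exact: half_plane_ge_q.
exact: lt_le_trans (half_plane_ge_t q0 (tk k)).
Qed.

Lemma transition_flat :
  `‖transition t N q‖ + `‖1 - transition t N q‖ <= 1 + 7 / N%:R.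
Proof.
rewrite transition_compl /transition !normcM nc_realp ?invr_ge0 ?(ltW N0') // -mulrDr.
rewrite ler_pdivrMl // mulrDr mulr1 mulrCA mulfV ?gt_eqF // mulr1.
apply: (le_trans (lerD (nc_sum _ _) (nc_sum _ _))); rewrite -big_split /=.
pose f k : R := 7 * (t * 2 ^+ k / (`‖q‖ + t * 2 ^+ k)).
apply: (@le_trans _ _ (\sum_(k < N) (1 + (f k.+1 - f k)))).
  apply: ler_sum => k _; apply: (le_trans (transition_cost q0 (tk k))).
  by rewrite /f exprS mulrCA mulrBr.
rewrite big_split /= sumr_const card_ord -[1 *+ N]/(N%:R) lerD2l.
rewrite -(big_mkord xpredT (fun k => f k.+1 - f k)) telescope_sumr //.
have f0 : 0 <= f 0%N.
  by rewrite mulr_ge0 // divr_ge0 ?addr_ge0 ?nc_ge0 // ltW.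
have : f N <= 7.
  rewrite /f ler_piMr // ler_pdivrMr ?addr_gt0 // mul1r lerDr nc_ge0 //.
lra.
Qed.

End Bounds.

Lemma cder_transition t N q : 0 < t -> 0 < Re q ->
  exists c, cder (transition t N) q c.
Proof.
move=> t0 q0.
have H (s : seq 'I_N) : exists c, cder (fun q => \sum_(k <- s) q / (q + (t * 2 ^+ k)%:C)) q c.
  elim: s => [|k s [c IH]].
    exists 0; apply: cder_near (cder_cst 0 q); apply: nearCW => w.
    by rewrite big_nil.
  have tk : 0 < t * 2 ^+ k by rewrite mulr_gt0 // exprn_gt0.
  have n0 : q + (t * 2 ^+ k)%:C != 0.
    by rewrite -nc_gt0; exact: lt_le_trans (half_plane_ge_t q0 tk).
  have d1 := cderD (cder_id q) (cder_cst (t * 2 ^+ k)%:C q).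
  have d2 := cderM (cder_id q) (cderV (g := fun w => w + (t * 2 ^+ k)%:C) n0 d1).
  eexists; apply: cder_near (cderD d2 IH); apply: nearCW => w.
  by rewrite big_cons.
by have [c dc] := H (index_enum 'I_N); eexists; exact: cderZ dc.
Qed.

(** The Cayley transform, onto the right half-plane; 0 goes to 1 and 1 to
   infinity. *)
Definition cayley z : R[i] := (1 + z) / (1 - z).

Lemma one_sub_neq0 z : `‖z‖ < 1 -> 1 - z != 0.
Proof.
by move=> z1; rewrite subr_eq0; apply/eqP => h; move: z1; rewrite -h nc1 ltxx.
Qed.

Lemma cayley_Re z : `‖z‖ < 1 -> 0 < Re (cayley z).
Proof.
move=> z1; have n0 := one_sub_neq0 z1.
have -> : cayley z = (`‖1 - z‖ ^- 2)%:C * ((1 + z) * (1 - z)^*).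
  have m := mul_conj (1 - z); have c0 : (1 - z)^* != 0 by rewrite -nc_gt0 nc_conj nc_gt0.
  have r0 : (`‖1 - z‖ ^+ 2)%:C != 0 :> R[i] by rewrite -m mulf_neq0.
  have -> : (`‖1 - z‖ ^- 2)%:C = (`‖1 - z‖ ^+ 2)%:C^-1 :> R[i].
    by rewrite -[LHS]/(real_complex _ _) fmorphV.
  rewrite -m /cayley; move: ((1 - z)^*) c0 => Y c0.
  by field; rewrite n0 c0.
case: z z1 n0 => a b z1 n0.
have : 0 < 1 - `‖a +i* b‖ ^+ 2 by rewrite sqr_lt1.
rewrite -[(_ - _)^*]/((1 - a) +i* - (0 - b)) nc_sqr /= => h.
rewrite !mul0r !subr0; apply: mulr_gt0; last by lra.
by rewrite invr_gt0 exprn_gt0 // nc_gt0.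
Qed.

Lemma nc_cayley_le z r : `‖z‖ <= r -> r < 1 -> `‖cayley z‖ <= (1 + r) / (1 - r).
Proof.
move=> zr r1; have := nc_triangle 1 z; have := nc_sub_ge 1 z; rewrite nc1 => h1 h2.
have n0 : 0 < 1 - r by lra.
rewrite nc_div; apply: ler_pM; rewrite ?invr_ge0 ?nc_ge0 //; first lra.
by rewrite lef_pV2 ?posrE; lra.
Qed.

Lemma nc_cayley_ge z r : `‖z‖ <= r -> r < 1 -> (1 - r) / (1 + r) <= `‖cayley z‖.
Proof.
move=> zr r1; have := nc_triangle 1 (- z); have := nc_sub_ge 1 (- z).
rewrite opprK nc_opp nc1 => h1 h2; have z0 := nc_ge0 z.
have n0 : 0 < `‖1 - z‖ by rewrite nc_gt0 one_sub_neq0 //; lra.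
rewrite nc_div; apply: ler_pM; rewrite ?invr_ge0 ?nc_ge0 //; [lra|lra|lra|].
by rewrite lef_pV2 ?posrE; lra.
Qed.

Definition bdd1 (f : R[i] -> R[i]) := forall z, `‖z‖ < 1 -> `‖f z‖ <= 1.

(** Gluing in the unit ball of bounded functions.  When p and q are far apart in
   the pseudo-hyperbolic metric, a transition function separates large
   pseudo-hyperbolic discs around them, and since its values almost lie in
   [0, 1] the interpolation between F and G stays almost in the unit ball. *)
Lemma glue (r e : R) : 0 <= r < 1 -> 0 < e -> exists2 s : R, s < 1 &
  forall p q, `‖p‖ < 1 -> `‖q‖ < 1 -> s < `‖mob p q‖ ->
  forall F G, holo F -> holo G -> bdd1 F -> bdd1 G ->
  exists H, [/\ holo H /\ bdd1 H,
    forall z, `‖z‖ < 1 -> `‖mob p z‖ <= r -> `‖H z - F z‖ <= e,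
    forall z, `‖z‖ < 1 -> `‖mob q z‖ <= r -> `‖H z - G z‖ <= e &
    forall z, `‖z‖ < 1 -> `‖H z - F z‖ <= `‖F z - G z‖ + e].
Proof.
move=> /andP[r0 r1] e0.
have [N N0 Ne] : exists2 N, (0 < N)%N & 7 / N%:R <= e / 4 :> R.
  have e28 : 0 < 28 / e by rewrite divr_gt0.
  have B := archi_boundP (ltW e28); exists (Num.bound (28 / e)).
    by rewrite -(ltr0n R) (lt_trans e28).
  rewrite ler_pdivrMr ?(lt_trans e28) //.
  by move/ltW: B; rewrite ler_pdivrMr // => B; lra.
pose M := (1 + r) / (1 - r); have M0 : 0 < M by rewrite divr_gt0; lra.
pose t := M * 4 / e; have t0 : 0 < t by rewrite divr_gt0 // mulr_gt0.
pose K := 4 * M * t * 2 ^+ N / e.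
have K0 : 0 < K.
  apply: divr_gt0 => //; apply: mulr_gt0; last exact: exprn_gt0.
  by apply: mulr_gt0 => //; exact: mulr_gt0.
exists (Num.max 0 (1 - K^-1)).
  by rewrite gt_max ltr01 gtrBl invr_gt0.
move=> p q p1 q1; rewrite gt_max => /andP[rho0 rhoK] F G hF hG F1 G1.
set rho := normc _ in rho0 rhoK.
have rho1 : rho < 1 by exact: mob_lt1.
have rhon : rho%:C != 0 :> R[i] by rewrite -nc_gt0 nc_realp // ltW.
pose c := mob p q / rho%:C.
have c1 : `‖c‖ = 1 by rewrite nc_div nc_realp ?(ltW rho0) // mulfV // gt_eqF.
have cc : c^* * c = 1 by rewrite mulrC mul_conj c1 expr1n.
have cq : mob p q = c * rho%:C by rewrite /c divfK.
pose x z := c^* * mob p z.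
have nx z : `‖x z‖ = `‖mob p z‖ by rewrite normcM nc_conj c1 mul1r.
have x1 z : `‖z‖ < 1 -> `‖x z‖ < 1 by move=> z1; rewrite nx mob_lt1.
have hx : holo x by apply: holoZ; exact: holo_mob.
pose Q z := cayley (x z).
have Q0 z : `‖z‖ < 1 -> 0 < Re (Q z) by move=> z1; exact/cayley_Re/x1.
have hQ : holo Q.
  apply: holoM; first by apply: holoD => //; exact: holo_cst.
  apply: holoV; first by move=> z z1; exact/one_sub_neq0/x1.
  by apply: holoB => //; exact: holo_cst.
pose u z := transition t N (Q z).
have hu : holo u.
  move=> z z1; have [d dt] := cder_transition N t0 (Q0 z z1).
  by have [k dk] := hQ z z1; eexists; exact: (cder_comp dt dk).
pose d : R := 7 / N%:R; have d0 : 0 < d by rewrite divr_gt0 // ltr0n.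
have flat z : `‖z‖ < 1 -> `‖u z‖ + `‖1 - u z‖ <= 1 + d.
  by move=> z1; exact: (transition_flat t0 N0 (Q0 z z1)).
have near_p z : `‖z‖ < 1 -> `‖mob p z‖ <= r -> `‖u z‖ <= e / 4.
  move=> z1 zr; apply: (le_trans (transition_near0 t0 N0 (Q0 z z1))).
  rewrite ler_pdivrMr // (_ : e / 4 * t = M); first by rewrite /Q nc_cayley_le // nx.
  by rewrite /t; field; rewrite gt_eqF.
have near_q z : `‖z‖ < 1 -> `‖mob q z‖ <= r -> `‖1 - u z‖ <= e / 4.
  move=> z1 zr; apply: (le_trans (transition_nearoo t0 N0 (Q0 z z1))).
  pose y := (x z - rho%:C) / (1 - rho%:C * x z).
  have n1 : 1 - rho%:C * x z != 0.
    apply: one_sub_neq0; rewrite normcM nc_realp ?(ltW rho0) //.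
    by rewrite mulr_ilt1 ?nc_ge0 ?(ltW rho0) // x1.
  have yr : `‖y‖ <= r.
    have -> : `‖y‖ = `‖mob (mob p q) (mob p z)‖.
      rewrite cq /mob cjM cj_real -/(mob p z) /y /x.
      have -> : c^* * mob p z - rho%:C = c^* * (mob p z - c * rho%:C).
        by rewrite mulrBr [c^* * (c * _)]mulrA cc mul1r.
      rewrite !nc_div normcM nc_conj c1 mul1r; congr (_ / normc (1 - _)); ring.
    apply: le_trans zr; apply: schwarz_pick_open => //; first exact: holo_mob.
    by move=> v v1; exact: mob_lt1.
  have n2 := one_sub_neq0 (le_lt_trans yr r1).
  have n3 : 1 - rho%:C != 0 :> R[i].
    by apply: one_sub_neq0; rewrite nc_realp // ltW.
  have n4 := one_sub_neq0 (x1 z z1).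
  have QE : Q z = (1 + rho%:C) / (1 - rho%:C) * cayley y.
    move: n2; rewrite /Q /cayley /y; move: (x z) (rho%:C) n1 n3 n4 => X P n1 n3 n4 n2.
    have n5 : 1 - P * X - (X - P) != 0.
      rewrite (_ : _ - _ = (1 - (X - P) / (1 - P * X)) * (1 - P * X)); last by field.
      by rewrite mulf_neq0.
    by field; rewrite n1 n3 n4 n5.
  have rho11 : 0 < 1 - rho by rewrite subr_gt0.
  have Qge : K / M <= `‖Q z‖.
    rewrite QE normcM nc_div one_sub_real [`‖(1 - rho)%:C‖]nc_realp ?(ltW rho11) //.
    rewrite (_ : 1 + rho%:C = (1 + rho)%:C); last by apply: eqC => /=; ring.
    rewrite nc_realp; last by rewrite addr_ge0 // ltW.
    apply: ler_pM; rewrite ?invr_ge0 ?(ltW K0) ?(ltW M0) //; last first.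
      by rewrite /M invf_div nc_cayley_ge.
    rewrite ler_pdivlMr //; apply: (@le_trans _ _ 1); last by rewrite lerDl ltW.
    rewrite -ler_pdivlMl // mulr1; lra.
  have KM0 : 0 < K / M by rewrite divr_gt0.
  rewrite ler_pdivrMr; last exact: lt_le_trans Qge.
  apply: (@le_trans _ _ (e / 4 * (K / M))); last first.
    by rewrite ler_wpM2l // divr_ge0 // ltW.
  rewrite le_eqVlt; apply/orP; left; apply/eqP; rewrite /K; field.
  by rewrite !gt_eqF.
pose H z := ((1 + d)^-1)%:C * ((1 - u z) * F z + u z * G z).
have d1 : 0 < 1 + d by lra.
have nH z w : `‖((1 + d)^-1)%:C * (z - (1 + d)%:C * w)‖ = `‖z - (1 + d)%:C * w‖ / (1 + d).
  by rewrite normcM nc_realp ?invr_ge0 ?(ltW d1) // mulrC.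
have dn : (1 + d)%:C != 0 :> R[i] by rewrite -nc_gt0 nc_realp ?ltW.
have HB z w : H z - w = ((1 + d)^-1)%:C * ((1 - u z) * F z + u z * G z - (1 + d)%:C * w).
  rewrite mulrBr mulrA -[_%:C * _%:C]rmorphM mulVf ?gt_eqF //.
  by rewrite [X in _ - X * _]/(1%:C) mul1r.
have d4 : d <= e / 4 by [].
have dC : (1 + d)%:C = 1 + d%:C :> R[i] by apply: eqC => /=; ring.
have unit_le z : `‖z‖ < 1 -> `‖F z - G z‖ <= 2.
  move=> z1; apply: (le_trans (nc_sub_le _ _)).
  by have := F1 z z1; have := G1 z z1; lra.
have HF z : `‖z‖ < 1 -> `‖H z - F z‖ <= (`‖u z‖ * `‖F z - G z‖ + d) / (1 + d).
  move=> z1; rewrite HB nH ler_pM2r ?invr_gt0 //.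
  rewrite (_ : _ - _ = u z * (G z - F z) - d%:C * F z); last by rewrite dC; ring.
  apply: (le_trans (nc_sub_le _ _)); rewrite !normcM (nc_subC (G z)) lerD2l.
  by rewrite nc_realp ?(ltW d0) // ler_piMr ?F1 // ltW.
have HG z : `‖z‖ < 1 -> `‖H z - G z‖ <= (`‖1 - u z‖ * `‖F z - G z‖ + d) / (1 + d).
  move=> z1; rewrite HB nH ler_pM2r ?invr_gt0 //.
  rewrite (_ : _ - _ = (1 - u z) * (F z - G z) - d%:C * G z); last by rewrite dC; ring.
  apply: (le_trans (nc_sub_le _ _)); rewrite !normcM lerD2l.
  by rewrite nc_realp ?(ltW d0) // ler_piMr ?G1 // ltW.
have small (a b : R) : 0 <= a <= e / 4 -> 0 <= b <= 2 -> (a * b + d) / (1 + d) <= e.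
  move=> /andP[a0 a1] /andP[b0 b2]; rewrite ler_pdivrMr //.
  have : a * b <= e / 4 * 2 by apply: ler_pM.
  have : 0 <= e * d by rewrite mulr_ge0 // ltW.
  lra.
exists H; split.
- split.
    apply: holoZ; apply: holoD; apply: holoM => //.
    by apply: holoB => //; exact: holo_cst.
  move=> z z1; rewrite /H normcM nc_realp ?invr_ge0 ?(ltW d1) //.
  rewrite ler_pdivrMl // mulr1; apply: le_trans (flat z z1).
  apply: (le_trans (nc_triangle _ _)); rewrite (normcM (1 - u z)) (normcM (u z)) [leRHS]addrC.
  by apply: lerD; rewrite ler_piMr ?nc_ge0 ?F1 ?G1.
- move=> z z1 zr; apply: (le_trans (HF z z1)); apply: small.
    by rewrite nc_ge0 near_p.
  by rewrite nc_ge0 unit_le.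
- move=> z z1 zr; apply: (le_trans (HG z z1)); apply: small.
    by rewrite nc_ge0 near_q.
  by rewrite nc_ge0 unit_le.
- move=> z z1; apply: (le_trans (HF z z1)); rewrite ler_pdivrMr //.
  have ul : `‖u z‖ <= 1 + d.
    by have := flat z z1; have := nc_ge0 (1 - u z); lra.
  have := ler_wpM2r (nc_ge0 (F z - G z)) ul.
  have : 0 <= e * d by rewrite mulr_ge0 // ltW.
  lra.
Qed.

End Transition.

(** * Self-maps with hyperbolic derivative close to 1 *)

Section NearRotation.
Variable R : realType.
Implicit Types (f g h phi : R[i] -> R[i]) (z w a c : R[i]) (r s e : R).

Definition selfmap phi := holo phi /\ forall z, `‖z‖ < 1 -> `‖phi z‖ < 1.

Definition hyp0 phi : R := `‖derive1 phi 0‖ / (1 - `‖phi 0‖ ^+ 2).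

Lemma zero_lt1 : `‖0 : R[i]‖ < 1.
Proof. by rewrite nc0. Qed.

Lemma hyp0_le1 phi : selfmap phi -> hyp0 phi <= 1.
Proof.
move=> [hp p1]; have := schwarz_pick_deriv hp _ zero_lt1.
move=> /(_ (fun z lz => ltW (p1 z lz))).
rewrite nc0 expr0n subr0 mulr1 /hyp0 => h.
by rewrite ler_pdivrMr ?mul1r // sqr_lt1 p1 // nc0.
Qed.

(** After moving phi 0 to the origin, phi is z h(z) with h bounded by one and
   of almost unit modulus at 0; Schwarz-Pick for h makes it almost constant. *)
Lemma near_rotation r e : 0 <= r < 1 -> 0 < e -> exists2 d : R, 0 < d &
  forall phi, selfmap phi -> 1 - d < hyp0 phi ->
  exists c h, [/\ `‖c‖ = 1, holo h /\ bdd1 h,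
    forall z, `‖z‖ < 1 -> mob (phi 0) (phi z) = z * h z,
    forall z, `‖z‖ <= r -> `‖h z - c‖ <= e &
    forall z w, `‖z‖ <= r -> `‖w‖ <= r -> `‖h z - h w‖ <= e * `‖z - w‖].
Proof.
move=> /andP[r0 r1] e0.
have rr : 0 < 1 - r by rewrite subr_gt0.
have r2 : 0 < 1 - r ^+ 2 by rewrite subr_gt0 expr_lt1.
have r21 : 1 - r ^+ 2 <= 1 by rewrite gerBl sqr_ge0.
pose k := e * (1 - r ^+ 2) / 2; have k0 : 0 < k by rewrite divr_gt0 // mulr_gt0.
have ke : k <= e / 2.
  by rewrite /k ler_pM2r ?invr_gt0 // ler_piMr // ltW.
pose d := Num.min 2^-1 (k * (1 - r) / 3).
have d0 : 0 < d by rewrite lt_min invr_gt0 ltr0n divr_gt0 // mulr_gt0.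
have d2 : d <= 2^-1 by rewrite ge_min lexx.
have dk : d <= k * (1 - r) / 3 by rewrite ge_min lexx orbT.
exists d => // phi [hp p1] hd.
have a1 := p1 _ zero_lt1; set a := phi 0 in a1 *.
pose psi z := mob a (phi z).
have hpsi : holo psi by apply: (holo_comp (f := mob a) p1 (holo_mob a1) hp).
have psi1 z : `‖z‖ < 1 -> `‖psi z‖ <= 1.
  by move=> z1; apply/ltW/mob_lt1 => //; exact: p1.
have psi0 : psi 0 = 0 by rewrite /psi mob_self.
pose h := dquot psi 0.
have hh : holo h := holo_dquot zero_lt1 hpsi.
have h1 : bdd1 h by exact: schwarz.
have psiE z : psi z = z * h z by rewrite (dquotE psi 0 z) psi0 add0r subr0.
have c0E : `‖h 0‖ = hyp0 phi.
  have D : 0 < 1 - `‖a‖ ^+ 2 by rewrite sqr_lt1.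
  rewrite /h /dquot eqxx.
  rewrite (derive1_cder (cder_comp (cder_mob a1 a1) (holo_cder hp zero_lt1))).
  rewrite mulrC normcM nc_div ncX (mulrC a^*) mul_conj !one_sub_real.
  rewrite nc_realp ?(ltW D) // /hyp0 -/a; move: (1 - `‖a‖ ^+ 2) D => X D.
  by field; rewrite gt_eqF.
set c0 := h 0 in c0E *.
have c01 : `‖c0‖ <= 1 by apply: h1; exact: zero_lt1.
have c0d : 1 - d < `‖c0‖ by rewrite c0E.
have c0p : 0 < `‖c0‖ by lra.
pose c := c0 / `‖c0‖%:C.
have nn : `‖c0‖%:C != 0 :> R[i] by rewrite -nc_gt0 nc_realp // ltW.
have c1 : `‖c‖ = 1 by rewrite nc_div nc_realp ?(ltW c0p) // mulfV // gt_eqF.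
have cc0 : `‖c0 - c‖ <= d.
  rewrite (_ : c0 - c = c * (`‖c0‖%:C - 1)); last by rewrite /c; field.
  rewrite normcM c1 mul1r nc_subC one_sub_real nc_realp; lra.
have A z : `‖z‖ <= r -> `‖h z - c0‖ <= 2 * d / (1 - r).
  move=> zr; have z1 : `‖z‖ < 1 := le_lt_trans zr r1.
  have := schwarz_pick hh h1 z1 zero_lt1.
  rewrite conjC0 mul0r !subr0 nc1 mulr1 -/c0 => S.
  rewrite ler_pdivlMr //.
  have B : `‖1 - c0^* * h z‖ <= 2 * d + `‖h z - c0‖.
    rewrite (_ : 1 - _ = (1 - c0^* * c0) - c0^* * (h z - c0)); last by ring.
    apply: (le_trans (nc_sub_le _ _)); apply: lerD.
      rewrite mulrC mul_conj one_sub_real nc_realp ?sqr_le1 //.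
      by have := nc_ge0 c0; nra.
    by rewrite normcM nc_conj ler_piMl ?nc_ge0.
  have := ler_wpM2l (nc_ge0 z) B.
  have : `‖z‖ * (2 * d + `‖h z - c0‖) <= r * (2 * d + `‖h z - c0‖).
    by rewrite ler_wpM2r // addr_ge0 ?nc_ge0 // mulr_ge0 // ltW.
  have : r * (2 * d) <= 2 * d by rewrite ler_piMl ?mulr_ge0 // ltW.
  lra.
have Ak z : `‖z‖ <= r -> `‖h z - c‖ <= k.
  move=> zr; have := nc_trans_sub c0 (h z) c; have := A z zr.
  have e1 : 2 * d / (1 - r) <= 2 / 3 * k by rewrite ler_pdivrMr //; lra.
  have e2 : d <= k / 3.
    apply: (le_trans dk); rewrite ler_pM2r ?invr_gt0 // ler_piMr ?(ltW k0) //; lra.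
  lra.
exists c, h; split => //.
- by move=> z _; exact: psiE.
- by move=> z zr; apply: (le_trans (Ak z zr)); lra.
- move=> z w zr wr; have z1 := le_lt_trans zr r1; have w1 := le_lt_trans wr r1.
  have S := schwarz_pick hh h1 z1 w1.
  have D : 1 - r ^+ 2 <= `‖1 - w^* * z‖.
    apply: le_trans (mob_den_ge _ _); rewrite lerD2l lerN2 expr2.
    by apply: ler_pM; rewrite ?nc_ge0.
  have B : `‖1 - (h w)^* * h z‖ <= 2 * k.
    rewrite (_ : 1 - _ = c^* * (c - h z) + (c - h w)^* * h z); last first.
      have -> : 1 = c^* * c by rewrite mulrC mul_conj c1 expr1n.
      by rewrite cjB; ring.
    apply: (le_trans (nc_triangle _ _)); rewrite !normcM !nc_conj c1 mul1r.
    rewrite mulr_natl mulr2n; apply: lerD; first by rewrite nc_subC Ak.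
    apply: (@le_trans _ _ (k * 1)); last by rewrite mulr1.
    by apply: ler_pM; rewrite ?nc_ge0 ?h1 // nc_subC Ak.
  have : `‖h z - h w‖ * (1 - r ^+ 2) <= `‖z - w‖ * (2 * k).
    apply: le_trans (ler_wpM2l (nc_ge0 _) D) _; apply: (le_trans S).
    by rewrite ler_wpM2l ?nc_ge0.
  rewrite -ler_pdivlMr // => /le_trans; apply.
  rewrite le_eqVlt; apply/orP; left; apply/eqP; rewrite /k; field.
  by rewrite gt_eqF.
Qed.

(** Where phi is close to a rotation with a small Lipschitz error, the error
   cannot compensate the displacement of the rotation. *)
Lemma hyp0_injective r : 0 <= r < 1 -> exists2 d : R, 0 < d &
  forall phi, selfmap phi -> 1 - d < hyp0 phi ->
  forall z w, `‖z‖ <= r -> `‖w‖ <= r -> phi z = phi w -> z = w.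
Proof.
move=> r01; have e0 : 0 < 3^-1 :> R by [].
have [d d0 dP] := near_rotation r01 e0; exists d => // phi sp hd z w zr wr zw.
have [c [h [c1 _ hE hc hl]]] := dP phi sp hd.
have r1 : r < 1 by case/andP: r01.
have z1 := le_lt_trans zr r1; have w1 := le_lt_trans wr r1.
have E : (z - w) * h z = w * (h w - h z).
  by rewrite mulrBl -(hE z z1) zw (hE w w1) mulrBr.
apply/eqP; rewrite -subr_eq0 -nc_eq0 eq_le nc_ge0 andbT.
have := congr1 (@normc R) E; rewrite !normcM => F.
have n1 : 2 / 3 <= `‖h z‖.
  by have := hc z zr; have := nc_sub_ge c (h z); rewrite (nc_subC c) c1; lra.
have n2 : `‖w‖ * `‖h w - h z‖ <= 3^-1 * `‖z - w‖.
  apply: (@le_trans _ _ (1 * (3^-1 * `‖w - z‖))); last by rewrite mul1r nc_subC.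
  by apply: ler_pM; rewrite ?nc_ge0 ?hl // ltW.
have := ler_wpM2l (nc_ge0 (z - w)) n1; lra.
Qed.

(** If T is the automorphism sending phi 0 to 0, then T o phi is close to a rotation
   rho on compact discs, so that g o rho^-1 o T composed with phi is close to g. *)
Lemma hyp0_pullback r e g : 0 <= r < 1 -> 0 < e -> holo g -> bdd1 g ->
  exists2 d : R, 0 < d & forall phi, selfmap phi -> 1 - d < hyp0 phi ->
  exists G, [/\ holo G, bdd1 G & forall z, `‖z‖ <= r -> `‖G (phi z) - g z‖ <= e].
Proof.
move=> r01 e0 hg g1; have [r0 r1] := andP r01.
have [s rs s1] := between r1; have s0 := le_lt_trans r0 rs.
have [C C0 CP] := lipschitz_bound rs s0 s1.
have k0 : 0 < e / C by rewrite divr_gt0.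
have [d d0 dP] := near_rotation r01 k0; exists d => // phi sp hd.
have [c [h [c1 [hh h1] hE hc hl]]] := dP phi sp hd.
have [hp p1] := sp; have a1 := p1 _ zero_lt1.
have cT z : `‖z‖ < 1 -> `‖c^* * mob (phi 0) z‖ < 1.
  by move=> z1; rewrite normcM nc_conj c1 mul1r mob_lt1.
exists (fun y => g (c^* * mob (phi 0) y)); split.
- by apply: (holo_comp (f := g) cT hg); apply: holoZ; exact: holo_mob.
- by move=> z z1; apply: g1; exact: cT.
move=> z zr; have z1 := le_lt_trans zr r1; rewrite hE //.
have wr : `‖c^* * (z * h z)‖ <= r.
  rewrite !normcM nc_conj c1 mul1r; apply: le_trans zr.
  by rewrite ler_piMr ?nc_ge0 ?h1.
have gs w : `‖w‖ <= s -> `‖g w‖ <= 1 by move=> ws; apply: g1; exact: le_lt_trans s1.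
apply: (le_trans (CP g 1 hg gs _ _ wr zr)).
have -> : c^* * (z * h z) - z = c^* * z * (h z - c).
  have : c^* * c = 1 by rewrite mulrC mul_conj c1 expr1n.
  by move=> cc; rewrite mulrBr -[c^* * z * c]mulrAC cc mul1r mulrA.
rewrite !normcM nc_conj c1 mul1r mulr1.
have : `‖z‖ * `‖h z - c‖ <= 1 * (e / C) by apply: ler_pM; rewrite ?nc_ge0 ?hc // ltW.
rewrite mul1r => /(ler_wpM2l (ltW C0)) /le_trans; apply.
by rewrite mulrC divfK // gt_eqF.
Qed.

(** In the coordinate centred at phi 0 the map is close to a rotation, hence large
   on a circle of radius above r; the minimum principle then solves phi z = w. *)
Lemma hyp0_covers r : 0 <= r < 1 -> exists s, [/\ 0 <= s, s < 1 &
  exists2 d : R, 0 < d & forall phi, selfmap phi -> 1 - d < hyp0 phi ->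
  forall w, `‖w‖ < 1 -> `‖mob (phi 0) w‖ <= r -> exists2 z, `‖z‖ <= s & phi z = w].
Proof.
move=> /andP[r0 r1].
pose s0 := (2 + r) / 3; pose s := (5 + r) / 6; pose e := (1 - r) / 6.
have s01 : 0 <= s < 1 by rewrite /s; apply/andP; split; lra.
have e0 : 0 < e by rewrite /e; lra.
have [d d0 dP] := near_rotation s01 e0.
have [sn s1] := andP s01.
exists s; split => //; exists d => // phi sp hd w w1 wr.
have [c [h [c1 [hh h1] hE hc hl]]] := dP phi sp hd.
have [hp p1] := sp; have a1 := p1 _ zero_lt1.
pose y := mob (phi 0) w.
pose z0 := c^* * y.
have nz0 : `‖z0‖ <= r by rewrite normcM nc_conj c1 mul1r.
have cc : c * c^* = 1 by rewrite mul_conj c1 expr1n.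
have hF : holo (fun z => z * h z - y).
  by apply: holoB; [apply: holoM => //; exact: holo_id|exact: holo_cst].
have z0s : `‖z0 - 0‖ < s0 by rewrite subr0 /s0; lra.
have s0s : s0 < s by rewrite /s0 /s; lra.
have s1' : `‖0 : R[i]‖ + s <= 1 by rewrite nc0 add0r ltW.
have [||z] := min_modulus_zero (z := z0) (m := 2 * e) hF s1' z0s s0s.
- move=> v; rewrite subr0 => vs.
  have hv : 1 - e <= `‖h v‖.
    have vr : `‖v‖ <= s by rewrite vs ltW.
    by have := hc v vr; have := nc_sub_ge c (h v); rewrite (nc_subC c) c1; lra.
  apply: le_trans (nc_sub_ge _ _); rewrite normcM vs.
  have : s0 * (1 - e) <= s0 * `‖h v‖ by rewrite ler_wpM2l // /s0; lra.
  have : s0 * e <= e by rewrite ler_piMl ?(ltW e0) // /s0; lra.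
  have : `‖y‖ <= r by [].
  by rewrite /s0 /e; lra.
- rewrite /= (_ : _ - _ = z0 * (h z0 - c)); last first.
    by rewrite mulrBr; congr (_ - _); rewrite /z0 mulrC mulrA cc mul1r.
  have z0r : `‖z0‖ <= s by rewrite /s; lra.
  rewrite normcM; have : `‖z0‖ * `‖h z0 - c‖ <= 1 * e.
    by apply: ler_pM; rewrite ?nc_ge0 ?hc //; lra.
  lra.
rewrite subr0 => zs /eqP; rewrite subr_eq0 => /eqP zy.
have z1 := lt_trans zs s1; exists z; first exact: ltW.
rewrite -hE // in zy.
by rewrite -(mobK a1 (p1 z z1)) zy mobK.
Qed.

End NearRotation.

(** * A universality criterion *)

Section PolynomialDensity.
Variable R : realType.
Implicit Types (f g : R[i] -> R[i]) (z : R[i]) (r e : R).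

(** Polynomials with coefficients in Q(i), coded by lists of pairs so that they
   form a countable type. *)
Fixpoint qpoly (s : seq (rat * rat)) z : R[i] :=
  if s is (a, b) :: s' then (ratr a +i* ratr b) + z * qpoly s' z else 0.

Lemma rat_dense (x e : R) : 0 < e -> exists q : rat, `|ratr q - x| <= e.
Proof.
move=> e0; have xx : x - e < x + e by lra.
have [q] := rat_in_itvoo xx; rewrite in_itv /= => /andP[h1 h2]; exists q.
by rewrite ler_norml; lra.
Qed.

Lemma qpoly_dense (p : {poly R[i]}) e : 0 < e ->
  exists s, forall z, `‖z‖ <= 1 -> `‖qpoly s z - p.[z]‖ <= e.
Proof.
elim/poly_ind: p e => [|p c IH] e e0.
  by exists [::] => z _; rewrite horner0 subrr nc0 ltW.
have e2 : 0 < e / 2 by rewrite divr_gt0.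
have e4 : 0 < e / 4 by rewrite divr_gt0.
have [s sP] := IH _ e2; have [a aP] := rat_dense (Re c) e4.
have [b bP] := rat_dense (Im c) e4.
exists ((a, b) :: s) => z z1 /=; rewrite hornerMXaddC.
rewrite (_ : _ - _ = ((ratr a +i* ratr b) - c) + z * (qpoly s z - p.[z])); last by ring.
apply: (le_trans (nc_triangle _ _)).
have h1 : `‖(ratr a +i* ratr b) - c‖ <= e / 4 + e / 4.
  by apply: (le_trans (nc_ReIm _)); rewrite ReB ImB lerD.
have h2 : `‖z * (qpoly s z - p.[z])‖ <= 1 * (e / 2).
  by rewrite normcM; apply: ler_pM; rewrite ?nc_ge0 ?sP.
lra.
Qed.

(** Polynomials are dense by the one-disc case of Runge's theorem. *)
Lemma holo_qpoly_dense f r e : holo f -> r < 1 -> 0 < e ->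
  exists s, forall z, `‖z‖ <= r -> `‖qpoly s z - f z‖ <= e.
Proof.
move=> hf r1 e0; have e2 : 0 < e / 2 by rewrite divr_gt0.
pose r' := Num.max 0 r; have r0 : 0 <= r' by rewrite le_max lexx.
have r'1 : r' < 1 by rewrite gt_max ltr01.
have [|||i j z w|p pP] := @runge_discs R unit (fun _ z => z) (fun _ => f) r' 1 (e / 2) r0 r'1 (lexx 1) _ _ _ _ e2.
- by move=> _; exact: holo_id.
- by move=> _; exact: hf.
- by [].
- by case: i j => [] [].
have [s sP] := qpoly_dense p e2; exists s => z zr.
have zr' : `‖z‖ <= r' by rewrite le_max zr orbT.
have := pP tt z zr'; have := sP z (le_trans zr' (ltW r'1)).
by have := nc_trans_sub p.[z] (qpoly s z) (f z); lra.
Qed.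

Lemma half_pow_small e : 0 < e ->
  exists K, forall k, (K <= k)%N -> 2^-1 ^+ k <= e.
Proof.
move=> e0; have i1 : `|2^-1 : R| < 1 by rewrite ger0_norm ?invr_ge0 // invf_lt1 // ltr1n.
have /cvgrPdist_lt H := cvg_expr i1.
have [K _ KP] := H _ e0; exists K => k /KP /=.
rewrite sub0r normrN ger0_norm; last by rewrite exprn_ge0 // invr_ge0.
exact: ltW.
Qed.

Lemma real_nested (lo hi : nat -> R) : (forall k m, lo k <= hi m) ->
  exists l, forall k, lo k <= l <= hi k.
Proof.
move=> H; exists (sup (range lo)) => k; apply/andP; split.
  by apply: ub_le_sup; [exists (hi 0%N) => _ [m _ <-]|exists k].
by apply: ge_sup; [exists (lo 0%N); exists 0%N|move=> _ [m _ <-]].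
Qed.

Lemma complex_nested (a : nat -> R[i]) (b : nat -> R) :
  (forall k m, (k <= m)%N -> `‖a m - a k‖ <= b k) -> (forall k, 0 <= b k) ->
  exists l, forall k, `‖l - a k‖ <= 2 * b k.
Proof.
move=> ab b0.
have H (p : R[i] -> R) : (forall z w, `|p z - p w| <= `‖z - w‖) ->
    exists l, forall k, p (a k) - b k <= l <= p (a k) + b k.
  move=> pL; apply: real_nested => k m.
  have dist k' m' : `|p (a k') - p (a m')| <= b (minn k' m').
    apply: (le_trans (pL _ _)); have [h|/ltnW h] := leqP k' m'.
      by rewrite nc_subC ab.
    by rewrite ab.
  have := dist k m; rewrite ler_norml => /andP[_].
  have [h|/ltnW h] := leqP k m.
    by have := b0 m; lra.
  by have := b0 k; lra.
have [x xP] := H _ (@Re_lip R); have [y yP] := H _ (@Im_lip R).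
exists (x +i* y) => k; apply: (le_trans (nc_ReIm _)); rewrite ReB ImB /=.
have /andP[x1 x2] := xP k; have /andP[y1 y2] := yP k.
rewrite mulr_natl mulr2n; apply: lerD; rewrite ler_norml; apply/andP; split; lra.
Qed.

End PolynomialDensity.

Section Universality.
Variables (R : realType) (X : (R[i] -> R[i]) -> Prop).
Variables (phi1 phi2 : nat -> R[i] -> R[i]).
Implicit Types (f g h : R[i] -> R[i]) (z : R[i]) (r e : R).

Definition near_on r e f g := forall z, `‖z‖ <= r -> `‖f z - g z‖ <= e.

Definition uc_closed := forall f, (forall r e, r < 1 -> 0 < e ->
  exists2 g, X g & near_on r e g f) -> X f.

Hypothesis Xholo : forall f, X f -> holo f.
Hypothesis Xclosed : uc_closed.
Hypotheses (sp1 : forall n, selfmap (phi1 n)) (sp2 : forall n, selfmap (phi2 n)).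
Hypothesis step : forall f g h r e, X f -> X g -> X h -> 0 <= r < 1 -> 0 < e ->
  exists F n, [/\ X F, near_on r e F f, near_on r e (F \o phi1 n) g &
                  near_on r e (F \o phi2 n) h].

(** Universality criterion.  Starting from any function, one corrects it
   infinitely often: the k-th correction is tiny on a disc that contains all
   images used so far, and it realizes the k-th pair of a dense sequence. *)
Lemma universality f0 : X f0 -> exists2 f, X f & forall g h r e, X g -> X h ->
  r < 1 -> 0 < e -> exists n, near_on r e (f \o phi1 n) g /\ near_on r e (f \o phi2 n) h.
Proof.
move=> X0.
(* the error allowed at stage k; its successors add up to as much *)
pose hk k : R := 2^-1 ^+ k.
have hk0 k : 0 < hk k by rewrite exprn_gt0 // invr_gt0.
have hk1 k : hk k <= 1 by rewrite exprn_ile1 ?invr_ge0 // invf_le1 // ler1n.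
have hkS k : hk k.+1 = hk k / 2 by rewrite /hk exprSr.
(* D (s, j) is an element of X close to the polynomial s up to 2^-j, if any *)
have [D DP] := choice (fun sj : seq (rat * rat) * nat => (
  match pselect (exists2 g, X g & near_on (1 - hk sj.2) (hk sj.2) g (qpoly sj.1)) with
  | left H => let: ex_intro2 g Xg gs := H in
     ex_intro (fun g => X g /\ ((exists2 g', X g' & near_on (1 - hk sj.2) (hk sj.2) g' (qpoly sj.1)) ->
        near_on (1 - hk sj.2) (hk sj.2) g (qpoly sj.1))) g (conj Xg (fun _ => gs))
  | right nH => ex_intro _ f0 (conj X0 (fun H => False_ind _ (nH H)))
  end)).
have Ddense g r e : X g -> r < 1 -> 0 < e -> exists J, forall j, (J <= j)%N ->
    exists s, near_on r e (D (s, j)) g.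
  move=> Xg r1 e0; have r1' : 0 < 1 - r by rewrite subr_gt0.
  have [J1 J1P] := half_pow_small r1'.
  have e2 : 0 < e / 2 by rewrite divr_gt0.
  have [J2 J2P] := half_pow_small e2.
  exists (maxn J1 J2) => j; rewrite geq_max => /andP[/J1P j1 /J2P j2].
  have q1 : 1 - hk j < 1 by rewrite gtrBl.
  have [s sP] := holo_qpoly_dense (Xholo Xg) q1 (hk0 j); exists s => z zr.
  have zj : `‖z‖ <= 1 - hk j by rewrite /hk; lra.
  have [_ N] := DP (s, j).
  have := N _ z zj; have := sP z zj.
  have := nc_trans_sub (qpoly s z) (D (s, j) z) (g z); rewrite /= /hk.
  move=> h1 h2 h3; apply: (le_trans h1).
  have : `‖D (s, j) z - qpoly s z‖ <= 2^-1 ^+ j.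
    by apply: h3; exists g => // w wj; rewrite nc_subC; exact: sP.
  lra.
pose code := (seq (rat * rat) * seq (rat * rat) * nat)%type.
(* every code c is the 2-adic valuation of arbitrarily large k, so each pair of
   targets comes up again at stages with arbitrarily small errors *)
pose target k := if unpickle (logn 2 k) is Some (s1, s2, j) then
  (D (s1, j), D (s2, j)) else (f0, f0).
have Xtarget k : X (target k).1 /\ X (target k).2.
  rewrite /target; case: (unpickle _ : option code) => [[[s1 s2] j]|] //.
  by split; [exact: (DP (s1, j)).1|exact: (DP (s2, j)).1].
(* a state consists of the current function, a radius below which it is almost
   frozen from now on, and the last index used *)
have stepk (st : nat * ((R[i] -> R[i]) * R * nat)) : exists st' : (R[i] -> R[i]) * R * nat,
    X st.2.1.1 -> 0 <= st.2.1.2 < 1 ->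
    [/\ X st'.1.1 /\ near_on st.2.1.2 (hk st.1) st'.1.1 st.2.1.1,
        [/\ st.2.1.2 <= st'.1.2, 1 - hk st.1 <= st'.1.2 & st'.1.2 < 1],
        near_on (1 - hk st.1) (hk st.1) (st'.1.1 \o phi1 st'.2) (target st.1).1,
        near_on (1 - hk st.1) (hk st.1) (st'.1.1 \o phi2 st'.2) (target st.1).2 &
        forall z, `‖z‖ <= 1 - hk st.1 -> `‖phi1 st'.2 z‖ <= st'.1.2 /\ `‖phi2 st'.2 z‖ <= st'.1.2].
  case: st => k [[F r] n0] /=.
  have [[XF /andP[r0 r1]]|nH] := EM (X F /\ 0 <= r < 1); last first.
    by exists (F, r, n0) => h1 h2; case: nH.
  pose r' := Num.max r (1 - hk k).
  have r'1 : 0 <= r' < 1.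
    by rewrite le_max r0 gt_max r1 gtrBl hk0.
  have [F' [n [XF' FF' F1 F2]]] := step XF (Xtarget k).1 (Xtarget k).2 r'1 (hk0 k).
  have [s1 s11 s1P] := selfmap_cball (sp1 n).1 (sp1 n).2 r'1.
  have [s2 s21 s2P] := selfmap_cball (sp2 n).1 (sp2 n).2 r'1.
  exists (F', Num.max r' (Num.max s1 s2), n) => _ _ /=; split.
  - by split => // z zr; apply: FF'; rewrite le_max zr.
  - rewrite !le_max !lexx !orbT; split => //.
    by rewrite !gt_max r1 gtrBl hk0 s11.
  - by move=> z zr; apply: F1; rewrite le_max zr orbT.
  - by move=> z zr; apply: F2; rewrite le_max zr orbT.
  - move=> z zr; have zr' : `‖z‖ <= r' by rewrite le_max zr orbT.
    by split; rewrite !le_max ?(s1P z zr') ?(s2P z zr') !orbT.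
have [nxt nxtP] := choice stepk.
pose S := fix S k := if k is m.+1 then nxt (m, S m) else (f0, 0, 0%N).
pose F k := (S k).1.1; pose r_ k := (S k).1.2; pose n_ k := (S k.+1).2.
have inv k : X (F k) /\ 0 <= r_ k < 1.
  elim: k => [|k [IH1 IH2]]; first by split => //; rewrite /r_ /= lexx ltr01.
  have [[XF _] [rr _ r1] _ _ _] := nxtP (k, S k) IH1 IH2.
  split => //; apply/andP; split => //.
  by case/andP: IH2 => h _; exact: le_trans rr.
have SP k := nxtP (k, S k) (inv k).1 (inv k).2.
have rS k : r_ k <= r_ k.+1 by have [_ [h _ _] _ _ _] := SP k.
have rmono k m : (k <= m)%N -> r_ k <= r_ m.
  by move=> /subnK <-; elim: (m - k)%N => [//|j IH]; exact: le_trans (rS _).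
have rhk k : 1 - hk k <= r_ k.+1 by have [_ [_ h _] _ _ _] := SP k.
have FS k : near_on (r_ k) (hk k) (F k.+1) (F k) by have [[_ h] _ _ _ _] := SP k.
have Fdist k j z : `‖z‖ <= r_ k -> `‖F (k + j)%N z - F k z‖ <= 2 * hk k - 2 * hk (k + j)%N.
  move=> zk; elim: j => [|j IH]; first by rewrite addn0 !subrr nc0.
  rewrite addnS hkS; have := FS (k + j)%N z (le_trans zk (rmono _ _ (leq_addr _ _))).
  by have := nc_trans_sub (F (k + j)%N z) (F (k + j).+1 z) (F k z); lra.
have limF z : exists l, forall k, `‖z‖ <= r_ k -> `‖l - F k z‖ <= 4 * hk k.
  have [ex|nex] := EM (exists k, `‖z‖ <= r_ k); last first.
    by exists 0 => k zk; case: nex; exists k.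
  case: (ex_minnP ex) => k0 zk0 k0min.
  have [|k|l lP] := @complex_nested R (fun j => F (k0 + j)%N z) (fun j => 2 * hk (k0 + j)%N).
  - move=> k m /subnKC <-; rewrite addnA.
    have zk : `‖z‖ <= r_ (k0 + k)%N by apply: (le_trans zk0); rewrite rmono // leq_addr.
    by apply: (le_trans (Fdist _ _ _ zk)); rewrite gerBl mulr_ge0 // ltW.
  - by rewrite mulr_ge0 // ltW.
  - exists l => k /k0min /subnKC <-; apply: (le_trans (lP _)).
    by rewrite mulrA -natrM.
have [f fP] := choice limF.
have fnear k : near_on (r_ k) (4 * hk k) (F k) f.
  by move=> z zk; rewrite nc_subC fP.
have Xf : X f.
  apply: Xclosed => r e r1 e0; have r1' : 0 < 1 - r by rewrite subr_gt0.
  have [J1 J1P] := half_pow_small r1'.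
  have e4 : 0 < e / 4 by rewrite divr_gt0.
  have [J2 J2P] := half_pow_small e4.
  pose j := maxn J1 J2; have j1 := J1P j (leq_maxl _ _).
  have j2 := J2P j.+1 (leqW (leq_maxr _ _)).
  exists (F j.+1); first exact: (inv _).1.
  move=> z zr; have zj : `‖z‖ <= r_ j.+1 by apply: le_trans (rhk j); rewrite /hk; lra.
  by apply: (le_trans (fnear _ _ zj)); rewrite /hk; lra.
exists f => // g h r e Xg Xh r1 e0.
have e2 : 0 < e / 2 by rewrite divr_gt0.
have [J1 J1P] := Ddense g r _ Xg r1 e2; have [J2 J2P] := Ddense h r _ Xh r1 e2.
pose j := maxn J1 J2; have [s1 s1P] := J1P j (leq_maxl _ _).
have [s2 s2P] := J2P j (leq_maxr _ _).
pose c := pickle ((s1, s2, j) : code).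
have r1' : 0 < 1 - r by rewrite subr_gt0.
have [K1 K1P] := half_pow_small r1'.
have e6 : 0 < e / 6 by rewrite divr_gt0.
have [K2 K2P] := half_pow_small e6.
pose K := maxn K1 K2; pose k := (2 ^ c * (2 * K).+1)%N.
have Kk : (K <= k)%N.
  rewrite /k -[X in (X <= _)%N]mul1n; apply: leq_mul; first by rewrite expn_gt0.
  by rewrite leqW // mul2n -addnn leq_addr.
have ck : logn 2 k = c.
  rewrite /k lognM ?expn_gt0 // pfactorK // [logn 2 _.+1]logn_coprime ?addn0 //.
  by rewrite coprime2n /= mul2n odd_double.
have tk : target k = (D (s1, j), D (s2, j)) by rewrite /target ck pickleK.
have k1 : hk k <= 1 - r by apply: K1P; exact: leq_trans (leq_maxl _ _) Kk.
have k2 : hk k <= e / 6 by apply: K2P; exact: leq_trans (leq_maxr _ _) Kk.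
have [_ _ T1 T2 rP] := SP k; rewrite tk in T1 T2.
have conclude (phi : R[i] -> R[i]) u v z : `‖phi z‖ <= r_ k.+1 ->
    `‖F k.+1 (phi z) - u‖ <= hk k -> `‖u - v‖ <= e / 2 -> `‖f (phi z) - v‖ <= e.
  move=> /(fnear k.+1 (phi z)); rewrite hkS => h1 h2 h3.
  have := nc_trans_sub (F k.+1 (phi z)) (f (phi z)) v.
  have := nc_trans_sub u (F k.+1 (phi z)) v.
  by rewrite (nc_subC (f (phi z)) (F k.+1 (phi z))); lra.
exists (n_ k); split=> z zr; have zk : `‖z‖ <= 1 - hk k by lra.
  exact: (conclude _ _ _ _ (rP z zk).1 (T1 z zk) (s1P z zr)).
exact: (conclude _ _ _ _ (rP z zk).2 (T2 z zk) (s2P z zr)).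
Qed.

End Universality.

(** * Uniform convergence on compact subsets of the disc *)

Section DiscTopology.
Variable R : realType.
Implicit Types (f g h : R[i] -> R[i]) (z : R[i]) (r e : R).

Lemma entourageCP (E : set (R[i] * R[i])) : entourage E <->
  exists2 e : R, 0 < e & forall z w, `‖z - w‖ < e -> E (z, w).
Proof.
rewrite -entourage_from_ballE; split.
  move=> [e /= e0 eE]; case: e e0 eE => er ei; rewrite ltcE /= => /andP[/eqP -> e0] eE.
  exists er => // z w zw; apply: eE => /=.
  by rewrite -ball_normE /= normCE ltcE /= eqxx.
move=> [e e0 eE]; exists e%:C; first by rewrite /= ltcR.
move=> [z w] /=; rewrite -ball_normE /= normCE ltcR; exact: eE.
Qed.

Lemma disc_compacts_cball r : r < 1 -> disc_compacts [set z : R[i] | `‖z‖ <= r].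
Proof.
move=> r1; split; first exact: compact_cball.
by move=> z /= zr; rewrite /unit_disc /= normCE ltcR; exact: le_lt_trans r1.
Qed.

Lemma disc_compacts_sub (K : set R[i]) : disc_compacts K ->
  exists2 r, 0 <= r < 1 & forall z, K z -> `‖z‖ <= r.
Proof.
move=> [cK KD]; have [K0|/set0P/negP/negPn/eqP K0] := pselect (K !=set0); last first.
  by exists 0 => [|z]; rewrite ?K0 // lexx ltr01.
have [z0 Kz0 zM] := @compact_nc_max R id K cK K0 (fun z _ => @cts_id R z).
exists `‖z0‖ => //; rewrite nc_ge0 /=.
by have := KD _ Kz0; rewrite /unit_disc /= normCE ltcR.
Qed.

Lemma disc_fun_nbhs_near f r e : r < 1 -> 0 < e ->
  nbhs (f : disc_fun R) [set u | near_on r e u f].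
Proof.
move=> r1 e0.
have entE : entourage [set xy : R[i] * R[i] | `‖xy.2 - xy.1‖ <= e].
  by apply/entourageCP; exists e => // z w /=; rewrite nc_subC => /ltW.
exact: (@fam_nbhs _ _ _ _ _ (f : disc_fun R) entE (disc_compacts_cball r1)).
Qed.

(** The sets of functions close to f on discs generate a filter converging to f
   uniformly on compact sets, hence finer than the neighbourhood filter. *)
Lemma disc_fun_nbhsP f (P : set (disc_fun R)) : nbhs (f : disc_fun R) P ->
  exists r e, [/\ r < 1, 0 < e & forall u, near_on r e u f -> P u].
Proof.
pose G : set_system (R[i] -> R[i]) :=
  [set P | exists r e, [/\ r < 1, 0 < e & forall u, near_on r e u f -> P u]].
have FG : Filter G.
  split.
  - by exists 0, 1; split.
  - move=> A B [r [e [r1 e0 rA]]] [s [d [s1 d0 sB]]].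
    exists (Num.max r s), (Num.min e d); split.
    + by rewrite gt_max r1.
    + by rewrite lt_min e0.
    + move=> u ur; split; [apply: rA|apply: sB] => z zr.
        by have := ur z; rewrite le_max zr le_min => /(_ isT)/andP[].
      by have := ur z; rewrite le_max zr orbT le_min => /(_ isT)/andP[].
  - move=> A B AB [r [e [r1 e0 rA]]]; exists r, e; split => // u /rA; exact: AB.
have GF : {family @disc_compacts R, G --> f}.
  apply/fam_cvgP => K dK Q /uniform_nbhs[E [/entourageCP[e e0 eE] EQ]].
  have [r /andP[_ r1] rK] := disc_compacts_sub dK.
  have e2 : 0 < e / 2 by rewrite divr_gt0.
  exists r, (e / 2); split => // u ur; apply: EQ => z Kz; apply: eE.
  by rewrite nc_subC; apply: (le_lt_trans (ur z (rK z Kz))); lra.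
by move=> /GF.
Qed.

Lemma disjointly_universalP (X : set (disc_fun R)) (phi1 phi2 : nat -> R[i] -> R[i]) :
  disjointly_universal X (fun n => comp_op (phi1 n)) (fun n => comp_op (phi2 n)) <->
  exists2 f, X f & forall g h r e, X g -> X h -> r < 1 -> 0 < e ->
    exists n, near_on r e (f \o phi1 n) g /\ near_on r e (f \o phi2 n) h.
Proof.
split=> [[f Xf cl]|[f Xf H]]; exists f => //.
  move=> g h r e Xg Xh r1 e0.
  have [] := cl (g, h) (conj Xg Xh)
    ([set u | near_on r e u g] `*` [set u | near_on r e u h]).
    exists ([set u | near_on r e u g], [set u | near_on r e u h]) => //=.
    by split; exact: disc_fun_nbhs_near.
  by move=> _ [[n _ <-] [/= n1 n2]]; exists n.
move=> [g h] [/= Xg Xh] B [[P Q] /= [gP hQ] PQ].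
have [r [e [r1 e0 rP]]] := disc_fun_nbhsP gP.
have [s [d [s1 d0 sQ]]] := disc_fun_nbhsP hQ.
have [||n [n1 n2]] := H g h (Num.max r s) (Num.min e d) Xg Xh.
- by rewrite gt_max r1.
- by rewrite lt_min e0.
exists (comp_op (phi1 n) f, comp_op (phi2 n) f); split; first by exists n.
apply: PQ; split => /=.
  apply: rP => z zr.
  by have := n1 z; rewrite le_max zr le_min => /(_ isT)/andP[].
apply: sQ => z zr.
by have := n2 z; rewrite le_max zr orbT le_min => /(_ isT)/andP[].
Qed.

Lemma unit_discE z : unit_disc z <-> `‖z‖ < 1.
Proof. by rewrite /unit_disc /= normCE ltcR. Qed.

Lemma holo_selfmapP f : holo_selfmap f <-> selfmap f.
Proof.
split=> [[/holomorphic_discP hf f1]|[hf f1]]; split => //.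
- by move=> z /unit_discE/f1/unit_discE.
- exact/holomorphic_discP.
- by move=> z /unit_discE/f1/unit_discE.
Qed.

Lemma BDP f : BD (f : disc_fun R) <-> holo f /\ bdd1 f.
Proof.
split=> [[/holomorphic_discP hf f1]|[hf f1]]; split => //.
- by move=> z /unit_discE/f1; rewrite normCE lecR.
- exact/holomorphic_discP.
- by move=> z /unit_discE/f1; rewrite normCE lecR.
Qed.

Lemma HDP f : HD (f : disc_fun R) <-> holo f.
Proof. exact: holomorphic_discP. Qed.

Lemma hyp_deriv0E f : selfmap f -> hyp_deriv0 f = (hyp0 f)%:C.
Proof.
move=> [hf f1]; rewrite /hyp_deriv0 /hyp0 !normCE.
rewrite -[_%:C ^+ 2](rmorphXn (real_complex R)) /= one_sub_real.
by rewrite -[_%:C^-1](fmorphV (real_complex R)) -rmorphM.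
Qed.

Lemma pseudo_hypE z w : pseudo_hyp z w = `‖mob z w‖%:C.
Proof.
rewrite /pseudo_hyp normCE; congr (_%:C).
by rewrite /mob !nc_div nc_subC.
Qed.

Lemma cvg1_lower (u : nat -> R) : (forall k, u k <= 1) ->
  ((u k)%:C @[k --> \oo] --> (1 : R[i])) <->
  forall d, 0 < d -> exists K, forall k, (K <= k)%N -> 1 - d < u k.
Proof.
move=> u1; split=> [/cvg_tendsP H d d0|H].
  have [K _ KP] := H d d0; exists K => k /KP /=.
  by rewrite nc_subC one_sub_real nc_realp ?subr_ge0 //; lra.
apply/cvg_tendsP => d d0; have [K KP] := H d d0.
exists K => // k /KP h /=.
by rewrite nc_subC one_sub_real nc_realp ?subr_ge0 //; lra.
Qed.

End DiscTopology.

(** * Hyperbolic derivatives, separation and disjoint images *)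

Section Equivalences.
Variable R : realType.
Implicit Types (f g h phi : R[i] -> R[i]) (z w : R[i]) (r e d : R).

Lemma extract_subsequence (P : nat -> nat -> Prop) :
  (forall k N, exists2 n, (N <= n)%N & P k n) ->
  exists2 s, subsequence s & forall k, P k (s k).
Proof.
move=> H; have [nx nxP] := choice (fun kN : nat * nat =>
  let: ex_intro2 n h1 h2 := H kN.1 kN.2 in
  ex_intro (fun n => (kN.2 <= n)%N /\ P kN.1 n) n (conj h1 h2)).
pose s := fix s k := if k is m.+1 then nx (m.+1, (s m).+1) else nx (0%N, 0%N).
exists s; last by case=> [|k]; [exact: (nxP (0%N, 0%N)).2|exact: (nxP (k.+1, (s k).+1)).2].
apply: homo_ltn; first exact: ltn_trans.
by move=> k; exact: (nxP (k.+1, (s k).+1)).1.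
Qed.

Lemma subsequence_ge s k : subsequence s -> (k <= s k)%N.
Proof.
move=> hs; elim: k => [//|k IH]; apply: (leq_ltn_trans IH); exact: hs.
Qed.

Lemma eventually_subsequence (P : nat -> Prop) s : subsequence s ->
  (exists K, forall n, (K <= n)%N -> P n) -> exists K, forall k, (K <= k)%N -> P (s k).
Proof.
by move=> hs [K KP]; exists K => k Kk; apply: KP; exact: leq_trans (subsequence_ge k hs).
Qed.

Lemma eventuallyI (P Q : nat -> Prop) : (exists K, forall n, (K <= n)%N -> P n) ->
  (exists K, forall n, (K <= n)%N -> Q n) ->
  exists K, forall n, (K <= n)%N -> P n /\ Q n.
Proof.
move=> [K KP] [L LQ]; exists (maxn K L) => n; rewrite geq_max => /andP[h1 h2].
by split; [exact: KP|exact: LQ].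
Qed.

Lemma boundary_escape (phi : nat -> R[i] -> R[i]) (a : R[i]) d :
  boundary_selfmaps phi a -> 0 < d ->
  exists K, forall n, (K <= n)%N -> 1 - d < `‖phi n 0‖.
Proof.
move=> [_ a1 /cvg_tendsP H] d0; have [K _ KP] := H d d0; exists K => n /KP /=.
have na : `‖a‖ = 1 by move: a1; rewrite /unit_circle /= normCE => -[].
by have := nc_sub_ge a (phi n 0); rewrite (nc_subC a) na; lra.
Qed.

Lemma nc_mobC z w : `‖mob z w‖ = `‖mob w z‖.
Proof.
rewrite /mob !nc_div nc_subC; congr (_ / _).
by rewrite -nc_conj cjB cjM conjCK cj1 mulrC.
Qed.

(** In the coordinate centred at p, a common point y of the two pseudo-hyperbolic
   discs lies in the disc of radius r, and q within pseudo-hyperbolic distance r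
   of it, so that q stays away from the unit circle. *)
Lemma far_discs_disjoint r : 0 <= r < 1 -> exists2 d : R, 0 < d &
  forall p q y, `‖p‖ < 1 -> `‖q‖ < 1 -> `‖y‖ < 1 ->
    `‖mob p y‖ <= r -> `‖mob q y‖ <= r -> `‖mob p q‖ <= 1 - d.
Proof.
move=> /andP[r0 r1].
have c1 : 0 < 1 - r ^+ 2 by rewrite subr_gt0 expr_lt1.
have c2 : 0 < (1 - r) ^+ 2 by rewrite exprn_gt0 // subr_gt0.
exists ((1 - r ^+ 2) * (1 - r) ^+ 2 / 2); first by rewrite divr_gt0 // mulr_gt0.
move=> p q y p1 q1 y1 py qy.
pose x := mob p y; pose v := mob p q.
have x1 : `‖x‖ < 1 by exact: mob_lt1.
have v1 : `‖v‖ < 1 by exact: mob_lt1.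
have M : `‖mob x v‖ <= r.
  apply: le_trans qy; rewrite nc_mobC.
  rewrite [X in X <= _]nc_mobC [X in _ <= X]nc_mobC.
  apply: schwarz_pick_open => //; first exact: holo_mob.
  by move=> z z1; exact: mob_lt1.
have I := nc_mob_id x1 (ltW v1).
have M2 : `‖mob x v‖ ^+ 2 <= r ^+ 2 by rewrite lerXn2r ?nnegrE ?nc_ge0.
have D : (1 - r) ^+ 2 <= `‖1 - x^* * v‖ ^+ 2.
  rewrite lerXn2r ?nnegrE ?nc_ge0 ?subr_ge0 ?(ltW r1) //.
  apply: le_trans (mob_den_ge _ _); rewrite lerD2l lerN2.
  by apply: le_trans py; rewrite ler_piMr ?nc_ge0 // ltW.
have : (1 - r ^+ 2) * (1 - r) ^+ 2 <= (1 - `‖x‖ ^+ 2) * (1 - `‖v‖ ^+ 2).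
  rewrite -I; apply: ler_pM; [exact: ltW|exact: ltW|lra|exact: D].
have : (1 - `‖x‖ ^+ 2) * (1 - `‖v‖ ^+ 2) <= 1 - `‖v‖ ^+ 2.
  by rewrite ler_piMl ?sqr_le1 ?(ltW v1) // gerBl sqr_ge0.
have : 1 - `‖v‖ ^+ 2 <= 2 * (1 - `‖v‖) by have := nc_ge0 v; nra.
rewrite -/v; lra.
Qed.

Section Sequences.
Variables (phi1 phi2 : nat -> R[i] -> R[i]).
Hypotheses (sp1 : forall n, selfmap (phi1 n)) (sp2 : forall n, selfmap (phi2 n)).

Let c1 n : `‖phi1 n 0‖ < 1. Proof. by apply: (sp1 n).2; rewrite nc0. Qed.
Let c2 n : `‖phi2 n 0‖ < 1. Proof. by apply: (sp2 n).2; rewrite nc0. Qed.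

Definition tends1 (u : nat -> R) :=
  forall d, 0 < d -> exists K, forall k, (K <= k)%N -> 1 - d < u k.

Lemma hyp_deriv_separatedP : hyp_deriv_separated phi1 phi2 <->
  exists2 s, subsequence s &
    [/\ tends1 (fun k => hyp0 (phi1 (s k))), tends1 (fun k => hyp0 (phi2 (s k))) &
        tends1 (fun k => `‖mob (phi1 (s k) 0) (phi2 (s k) 0)‖)].
Proof.
have E1 (s : nat -> nat) : (fun k => hyp_deriv0 (phi1 (s k))) = (fun k => (hyp0 (phi1 (s k)))%:C).
  by apply/funext => k; exact: hyp_deriv0E.
have E2 (s : nat -> nat) : (fun k => hyp_deriv0 (phi2 (s k))) = (fun k => (hyp0 (phi2 (s k)))%:C).
  by apply/funext => k; exact: hyp_deriv0E.
have E3 (s : nat -> nat) : (fun k => pseudo_hyp (phi1 (s k) 0) (phi2 (s k) 0)) =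
    (fun k => `‖mob (phi1 (s k) 0) (phi2 (s k) 0)‖%:C).
  by apply/funext => k; exact: pseudo_hypE.
have L1 (s : nat -> nat) k : hyp0 (phi1 (s k)) <= 1 by exact: hyp0_le1.
have L2 (s : nat -> nat) k : hyp0 (phi2 (s k)) <= 1 by exact: hyp0_le1.
have L3 (s : nat -> nat) k : `‖mob (phi1 (s k) 0) (phi2 (s k) 0)‖ <= 1.
  by apply/ltW/mob_lt1; [exact: c1|exact: c2].
split=> -[s hs]; [rewrite E1 E2 E3 => -[h1 h2 h3]|move=> [h1 h2 h3]]; exists s => //.
  by split; [exact: ((cvg1_lower (L1 s)).1 h1)|exact: ((cvg1_lower (L2 s)).1 h2)|exact: ((cvg1_lower (L3 s)).1 h3)].
rewrite E1 E2 E3.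
by split; [exact: ((cvg1_lower (L1 s)).2 h1)|exact: ((cvg1_lower (L2 s)).2 h2)|exact: ((cvg1_lower (L3 s)).2 h3)].
Qed.

Definition disjoint_on s := forall r, 0 <= r < 1 -> exists K, forall k, (K <= k)%N ->
  forall z w, `‖z‖ <= r -> `‖w‖ <= r -> phi1 (s k) z <> phi2 (s k) w.

Lemma disjoint_onP s : disjoint_on s <->
  forall K, disc_compacts K -> exists k0, forall k, (k0 <= k)%N ->
    phi1 (s k) @` K `&` phi2 (s k) @` K = set0.
Proof.
split=> [H K /disc_compacts_sub[r r01 Kr]|H r /andP[_ r1]].
  have [k0 k0P] := H r r01; exists k0 => k /k0P h.
  by apply/seteqP; split => // y [[z Kz zy] [w Kw wy]]; case: (h z w); rewrite ?Kr // zy wy.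
have [k0 k0P] := H _ (disc_compacts_cball r1); exists k0 => k /k0P h z w zr wr zw.
suff : set0 (phi1 (s k) z) by [].
by rewrite -h; split; [exists z|exists w].
Qed.

Lemma hyp_deriv_disjointP : hyp_deriv_disjoint phi1 phi2 <->
  exists2 s, subsequence s &
    [/\ tends1 (fun k => hyp0 (phi1 (s k))), tends1 (fun k => hyp0 (phi2 (s k))) &
        disjoint_on s].
Proof.
have E1 (s : nat -> nat) : (fun k => hyp_deriv0 (phi1 (s k))) = (fun k => (hyp0 (phi1 (s k)))%:C).
  by apply/funext => k; exact: hyp_deriv0E.
have E2 (s : nat -> nat) : (fun k => hyp_deriv0 (phi2 (s k))) = (fun k => (hyp0 (phi2 (s k)))%:C).
  by apply/funext => k; exact: hyp_deriv0E.
have L1 (s : nat -> nat) k : hyp0 (phi1 (s k)) <= 1 by exact: hyp0_le1.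
have L2 (s : nat -> nat) k : hyp0 (phi2 (s k)) <= 1 by exact: hyp0_le1.
split=> -[s hs]; [rewrite E1 E2 => -[h1 h2 h3]|move=> [h1 h2 h3]]; exists s => //.
  by split; [exact: ((cvg1_lower (L1 s)).1 h1)|exact: ((cvg1_lower (L2 s)).1 h2)|exact/disjoint_onP].
rewrite E1 E2.
by split; [exact: ((cvg1_lower (L1 s)).2 h1)|exact: ((cvg1_lower (L2 s)).2 h2)|exact/disjoint_onP].
Qed.

(** By Schwarz-Pick the images of a disc lie in pseudo-hyperbolic discs around
   phi1 n 0 and phi2 n 0, disjoint once the centres are far apart.  Conversely,
   if the centres stayed close then phi1 n, which covers pseudo-hyperbolic discs
   around its centre, would take the value phi2 n 0. *)
Lemma separated_iff_disjoint :
  hyp_deriv_separated phi1 phi2 <-> hyp_deriv_disjoint phi1 phi2.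
Proof.
rewrite hyp_deriv_separatedP hyp_deriv_disjointP.
split=> -[s hs [h1 h2 h3]]; exists s => //; split => //.
  move=> r r01; have [d d0 dP] := far_discs_disjoint r01.
  have [K KP] := h3 d d0; exists K => k /KP hk z w zr wr zw.
  have r1 : r < 1 by case/andP: r01.
  have z1 := le_lt_trans zr r1; have w1 := le_lt_trans wr r1.
  suff : `‖mob (phi1 (s k) 0) (phi2 (s k) 0)‖ <= 1 - d by rewrite leNgt hk.
  apply: (dP _ _ (phi1 (s k) z)) => //; first exact: (sp1 _).2.
    exact: le_trans (selfmap_mob (sp1 _).1 (sp1 _).2 z1) zr.
  by rewrite zw; exact: le_trans (selfmap_mob (sp2 _).1 (sp2 _).2 w1) wr.
move=> d d0; pose r := Num.max 0 (1 - d).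
have r01 : 0 <= r < 1 by rewrite le_max lexx gt_max ltr01 gtrBl.
have [t [t0 t1 [d' d'0 d'P]]] := hyp0_covers r01.
have t01 : 0 <= t < 1 by rewrite t0.
have [K KP] := eventuallyI (h1 d' d'0) (h3 t t01).
exists K => k /KP[/(d'P _ (sp1 _)) cov dis]; rewrite ltNge; apply/negP => near.
have [|z zt zE] := cov (phi2 (s k) 0) (c2 _); first by rewrite le_max near orbT.
by apply: (dis z 0 zt) => //; rewrite nc0.
Qed.

Lemma disjoint_imp_univalent :
  hyp_deriv_disjoint phi1 phi2 -> univalent_disjoint phi1 phi2.
Proof.
rewrite hyp_deriv_disjointP => -[s hs [h1 h2 h3]]; exists s => // K dK.
have [r r01 Kr] := disc_compacts_sub dK.
have [d d0 dP] := hyp0_injective r01.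
have [k1 k1P] := eventuallyI (h1 d d0) (h2 d d0).
have [k2 k2P] := (disjoint_onP s).1 h3 K dK.
exists (maxn k1 k2) => k; rewrite geq_max => /andP[/k1P[i1 i2] /k2P i3].
split => // z w /set_mem Kz /set_mem Kw; apply: dP => //; exact: Kr.
Qed.

End Sequences.

(** Schwarz-Pick for f at the point phi 0. *)
Lemma comp_deriv_le f phi : holo f -> bdd1 f -> selfmap phi ->
  `‖derive1 (f \o phi) 0‖ <= hyp0 phi * (1 - `‖f (phi 0)‖ ^+ 2).
Proof.
move=> hf f1 [hp p1]; have a1 := p1 _ (zero_lt1 R).
rewrite (derive1_cder (cder_comp (holo_cder hf a1) (holo_cder hp (zero_lt1 R)))).
have := schwarz_pick_deriv hf f1 a1; rewrite normcM /hyp0 => h.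
have D : 0 < 1 - `‖phi 0‖ ^+ 2 by rewrite sqr_lt1.
rewrite mulrAC ler_pdivlMr // mulrAC mulrC; apply: le_trans (ler_wpM2l (nc_ge0 _) h).
by rewrite mulrA.
Qed.

(** The Lipschitz bound for the difference of f o phi and the automorphism makes
   the derivative of f o phi at 0 close to 1 - c^2, and comp_deriv_le bounds it by
   hyp0 phi times a number close to 1 - c^2. *)
Lemma hyp0_lower (c d : R) : 0 <= c < 1 -> 0 < d -> exists2 e : R, 0 < e &
  forall f phi, holo f -> bdd1 f -> selfmap phi ->
  near_on 2^-1 e (f \o phi) (mob (- c%:C)) -> 1 - d < hyp0 phi.
Proof.
move=> /andP[c0 c1] d0.
have h4 : 4^-1 < 2^-1 :> R by lra.
have h2 : 0 < 2^-1 :> R by rewrite invr_gt0.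
have h1 : 2^-1 < 1 :> R by lra.
have [C C0 CP] := lipschitz_bound h4 h2 h1.
have D : 0 < 1 - c ^+ 2 by rewrite subr_gt0 expr_lt1.
pose e := d * (1 - c ^+ 2) / (2 * (C + 2)).
have e0 : 0 < e by rewrite divr_gt0 ?mulr_gt0 //; lra.
exists e => // f phi hf f1 [hp p1] H.
have nc : `‖- c%:C‖ = c by rewrite nc_opp nc_realp.
have c1' : `‖- c%:C‖ < 1 by rewrite nc.
have hG := holo_mob c1'.
have hF : holo (f \o phi) by exact: (holo_comp p1).
pose E z := (f \o phi) z - mob (- c%:C) z.
have hE : holo E by exact: holoB.
have dE : cder E 0 (derive1 (f \o phi) 0 - (1 - c%:C ^+ 2)).
  apply: cderB; first exact: holo_cder (zero_lt1 R).
  have := cder_mob c1' (zero_lt1 R); rewrite mulr0 subr0 expr1n divr1 nc.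
  by rewrite (rmorphXn (real_complex R)).
have LE : `‖derive1 (f \o phi) 0 - (1 - c%:C ^+ 2)‖ <= C * e.
  apply: (cder_lip dE).
  have n0 : `‖0 : R[i]‖ < 4^-1 by rewrite nc0 invr_gt0.
  apply: filterS (near_ltr n0) => w w4.
  by apply: CP => //; [exact: ltW|rewrite nc0 invr_ge0].
have F0 : c - e <= `‖f (phi 0)‖.
  have z2 : `‖0 : R[i]‖ <= 2^-1 by rewrite nc0 ltW.
  have := H 0 z2; rewrite /= mob0 opprK => h.
  by have := nc_sub_ge c%:C (f (phi 0)); rewrite (nc_subC c%:C) nc_realp //; lra.
have := comp_deriv_le hf f1 (conj hp p1).
have : 1 - c ^+ 2 - C * e <= `‖derive1 (f \o phi) 0‖.
  have := nc_sub_ge (1 - c%:C ^+ 2) (derive1 (f \o phi) 0).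
  rewrite nc_subC -(rmorphXn (real_complex R)) /= one_sub_real.
  rewrite [`‖(1 - c ^+ 2)%:C‖]nc_realp ?(ltW D) //.
  move: LE; rewrite -(rmorphXn (real_complex R)) /= one_sub_real; lra.
have Ds : 1 - `‖f (phi 0)‖ ^+ 2 <= 1 - c ^+ 2 + 2 * e.
  have f01 : `‖f (phi 0)‖ <= 1 by apply: f1; exact/p1/zero_lt1.
  have f00 := nc_ge0 (f (phi 0)).
  have [h|h] := leP c `‖f (phi 0)‖; nra.
move=> A B; rewrite ltNge; apply/negP => hd.
have T0 : 0 <= 1 - `‖f (phi 0)‖ ^+ 2 by rewrite sqr_le1 f1 // p1 // nc0.
have hyp00 : 0 <= hyp0 phi.
  by rewrite /hyp0 divr_ge0 ?nc_ge0 // sqr_le1 ltW // p1 // nc0.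
have X : hyp0 phi * (1 - `‖f (phi 0)‖ ^+ 2) <= hyp0 phi * (1 - c ^+ 2 + 2 * e).
  by rewrite ler_wpM2l.
have Y : hyp0 phi * (1 - c ^+ 2 + 2 * e) <= (1 - d) * (1 - c ^+ 2 + 2 * e).
  by rewrite ler_wpM2r //; lra.
have eE : e * (C + 2) = d * (1 - c ^+ 2) / 2.
  by rewrite /e; field; rewrite gt_eqF //; lra.
have : 0 < d * (1 - c ^+ 2) by rewrite mulr_gt0.
have : 0 < d * e by rewrite mulr_gt0.
lra.
Qed.

Lemma finite_max_lt1 (u : nat -> R) N : (forall n, u n < 1) ->
  exists2 m : R, m < 1 & forall n, (n < N)%N -> u n <= m.
Proof.
move=> u1; elim: N => [|N [m m1 mP]]; first by exists 0.
exists (Num.max m (u N)); first by rewrite gt_max m1 u1.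
move=> n; rewrite ltnS leq_eqVlt => /predU1P[->|/mP h]; rewrite le_max.
  by rewrite lexx orbT.
by rewrite h.
Qed.

(** A universal f comes close to the identity after phi1 n and to an automorphism
   with value c at 0 after phi2 n, for c as close to 1 as desired.  Automorphisms
   have hyperbolic derivative 1 and f contracts, so both hyp0 are close to 1; and
   f maps phi1 n 0 and phi2 n 0 close to 0 and c, so these points are far apart.
   Taking c beyond all the distances with index below N forces N <= n. *)
Lemma universal_BD_separated (phi1 phi2 : nat -> R[i] -> R[i]) :
  (forall n, selfmap (phi1 n)) -> (forall n, selfmap (phi2 n)) ->
  disj_universal_BD phi1 phi2 -> hyp_deriv_separated phi1 phi2.
Proof.
move=> sp1 sp2 /disjointly_universalP[f /BDP[hf f1] H].
have c1 n : `‖phi1 n 0‖ < 1 by apply: (sp1 n).2; rewrite nc0.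
have c2 n : `‖phi2 n 0‖ < 1 by apply: (sp2 n).2; rewrite nc0.
suff freq d N : 0 < d -> exists2 n, (N <= n)%N &
    [/\ 1 - d < hyp0 (phi1 n), 1 - d < hyp0 (phi2 n) &
        1 - d < `‖mob (phi1 n 0) (phi2 n 0)‖].
  have pw k : 0 < 2^-1 ^+ k :> R by rewrite exprn_gt0 // invr_gt0.
  have [s hs sP] := extract_subsequence (fun k N => freq _ N (pw k)).
  apply/(hyp_deriv_separatedP sp1 sp2); exists s => //.
  by split=> d d0; have [K KP] := half_pow_small d0; exists K => k /KP h;
    have [] := sP k; lra.
move=> d0; pose u n := `‖mob (phi1 n 0) (phi2 n 0)‖.
have [m m1 mP] := @finite_max_lt1 u N (fun n => mob_lt1 (c1 n) (c2 n)).
pose b := Num.max 0 (Num.max m (1 - d)).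
have b0 : 0 <= b by rewrite le_max lexx.
have b1 : b < 1 by rewrite !gt_max ltr01 m1 gtrBl.
have [c bc cc1] := between b1.
have c01 : 0 <= c < 1 by rewrite cc1 (le_trans b0) // ltW.
have z01 : (0 : R) <= (0 : R) < (1 : R) by rewrite lexx ltr01.
have [e1 e10 e1P] := hyp0_lower z01 d0.
have [e2 e20 e2P] := hyp0_lower c01 d0.
pose e := Num.min (Num.min e1 e2) (Num.min 2^-1 ((c - b) / 4)).
have e0 : 0 < e by rewrite !lt_min e10 e20 invr_gt0 ltr0n divr_gt0 // subr_gt0.
have ee1 : e <= e1 by rewrite !ge_min lexx.
have ee2 : e <= e2 by rewrite !ge_min lexx !orbT.
have e3 : e <= (c - b) / 4 by rewrite !ge_min lexx !orbT.
have n0 : `‖- (0 : R)%:C‖ < 1 by rewrite nc_opp nc_real normr0.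
have nc : `‖- c%:C‖ < 1 by rewrite nc_opp nc_realp //; case/andP: c01.
have XB a : `‖a‖ < 1 -> BD (mob a : disc_fun R).
  by move=> a1; apply/BDP; split; [exact: holo_mob|move=> z z1; exact/ltW/mob_lt1].
have h2 : 2^-1 < 1 :> R by lra.
have [n [N1 N2]] := H _ _ _ _ (XB _ n0) (XB _ nc) h2 e0.
have bm : b < `‖mob (phi1 n 0) (phi2 n 0)‖.
  have z2 : `‖0 : R[i]‖ <= 2^-1 by rewrite nc0 invr_ge0.
  have U : `‖f (phi1 n 0)‖ <= e.
    by have := N1 0 z2; rewrite /= mob0 opprK (_ : (0 : R)%:C = 0) ?subr0.
  have V : `‖f (phi2 n 0) - c%:C‖ <= e by have := N2 0 z2; rewrite /= mob0 opprK.
  have f11 : `‖f (phi2 n 0)‖ <= 1 := f1 _ (c2 n).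
  have := schwarz_pick hf f1 (c2 n) (c1 n).
  move: (f (phi1 n 0)) (f (phi2 n 0)) U V f11 => x v U V v1 SP.
  have D : 0 < `‖1 - (phi1 n 0)^* * phi2 n 0‖.
    apply: lt_le_trans (mob_den_ge _ _); rewrite subr_gt0.
    by have := c1 n; have := c2 n; have := nc_ge0 (phi1 n 0); have := nc_ge0 (phi2 n 0); nra.
  have K1 : c - 2 * e <= `‖v - x‖.
    have := nc_sub_ge v x; have := nc_sub_ge c%:C v.
    rewrite (nc_subC c%:C) nc_realp; last by case/andP: c01.
    lra.
  have K2 : `‖1 - x^* * v‖ <= 1 + e.
    apply: (le_trans (nc_sub_le _ _)); rewrite nc1 lerD2l normcM nc_conj.
    by apply: le_trans U; rewrite ler_piMr ?nc_ge0.
  have M1 : `‖mob (phi1 n 0) (phi2 n 0)‖ < 1 by exact: mob_lt1.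
  have E : `‖v - x‖ <= `‖mob (phi1 n 0) (phi2 n 0)‖ * `‖1 - x^* * v‖.
    by rewrite /mob nc_div mulrAC ler_pdivlMr.
  have := ler_wpM2l (nc_ge0 (mob (phi1 n 0) (phi2 n 0))) K2.
  have : `‖mob (phi1 n 0) (phi2 n 0)‖ * e <= e by rewrite ler_piMl ?(ltW M1) // ltW.
  lra.
have mb : m <= b by rewrite /b !le_max lexx orbT.
have db : 1 - d <= b by rewrite /b !le_max lexx !orbT.
exists n; last split.
- rewrite leqNgt; apply/negP => /mP; rewrite /u; lra.
- by apply: (e1P f _ hf f1 (sp1 n)) => z zr; exact: le_trans (N1 z zr) ee1.
- by apply: (e2P f _ hf f1 (sp2 n)) => z zr; exact: le_trans (N2 z zr) ee2.
- exact: le_lt_trans bm.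
Qed.

End Equivalences.

(** * Construction of universal functions *)

Section SufficiencyBounded.
Variable R : realType.
Implicit Types (f g h phi : R[i] -> R[i]) (z w : R[i]) (r e d : R).

Lemma uc_closed_bounded : uc_closed (fun f : R[i] -> R[i] => holo f /\ bdd1 f).
Proof.
move=> f H; split.
  apply: holo_approx => r e r1 e0; have [g [hg _] fg] := H r e r1 e0.
  by exists g.
move=> z z1; rewrite leNgt; apply/negP => h.
have e0 : 0 < (`‖f z‖ - 1) / 2 by lra.
have [g [_ g1] fg] := H _ _ z1 e0.
have := fg z (lexx _); have := g1 z z1; have := nc_sub_ge (f z) (g z).
by rewrite nc_subC; lra.
Qed.

Lemma mob_zero z : mob 0 z = z.
Proof. by rewrite /mob subr0 conjC0 mul0r subr0 divr1. Qed.

Variables (phi1 phi2 : nat -> R[i] -> R[i]).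
Hypotheses (sp1 : forall n, selfmap (phi1 n)) (sp2 : forall n, selfmap (phi2 n)).
Hypotheses (esc1 : tends1 (fun n => `‖phi1 n 0‖)) (esc2 : tends1 (fun n => `‖phi2 n 0‖)).

(** The two targets are pulled back to G1 and G2, which live near phi1 n 0 and
   phi2 n 0; the base points 0, phi1 n 0 and phi2 n 0 are pairwise far apart, so
   three gluings produce one function with all three prescribed behaviours. *)
Lemma separated_universal_BD :
  hyp_deriv_separated phi1 phi2 -> disj_universal_BD phi1 phi2.
Proof.
move=> /(hyp_deriv_separatedP sp1 sp2)[s hs [h1 h2 h3]].
apply/disjointly_universalP.
pose X f := holo f /\ bdd1 f.
have Xholo f : X f -> holo f by case.
have X0 : X (fun=> 0).
  by split; [exact: holo_cst|move=> z _; rewrite nc0].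
suff step : forall f g h r e, X f -> X g -> X h -> 0 <= r < 1 -> 0 < e ->
    exists F n, [/\ X F, near_on r e F f, near_on r e (F \o phi1 n) g &
                  near_on r e (F \o phi2 n) h].
  have [f Xf fP] := universality Xholo uc_closed_bounded sp1 sp2 step X0.
  by exists f; [exact/BDP|move=> g h r e /BDP Xg /BDP Xh; exact: fP].
move=> f g h r e [hf f1] [hg g1] [hh hh1] r01 e0.
have r1 : r < 1 by case/andP: r01.
have e4 : 0 < e / 4 by rewrite divr_gt0.
have [d1 d10 d1P] := hyp0_pullback r01 e4 hg g1.
have [d2 d20 d2P] := hyp0_pullback r01 e4 hh hh1.
have [t t1 tP] := glue r01 e4.
have t0 : 0 < 1 - t by rewrite subr_gt0.
have [K KP] := eventuallyI (eventuallyI (h1 _ d10) (h2 _ d20))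
  (eventuallyI (h3 _ t0) (eventuallyI (eventually_subsequence hs (esc1 t0))
                                      (eventually_subsequence hs (esc2 t0)))).
have [[/= A1 A2] [A3 [A4 A5]]] := KP K (leqnn K).
rewrite subKr in A3 A4 A5; move: (s K) A1 A2 A3 A4 A5 => n A1 A2 A3 A4 A5.
have a1 : `‖phi1 n 0‖ < 1 by apply: (sp1 n).2; rewrite nc0.
have a2 : `‖phi2 n 0‖ < 1 by apply: (sp2 n).2; rewrite nc0.
have [G1 [hG1 G11 G1P]] := d1P _ (sp1 n) A1.
have [G2 [hG2 G21 G2P]] := d2P _ (sp2 n) A2.
have m1 : t < `‖mob 0 (phi1 n 0)‖ by rewrite mob_zero.
have m2 : t < `‖mob 0 (phi2 n 0)‖ by rewrite mob_zero.
have [F1 [[hF1 F11] F1f F1G _]] := tP _ _ (zero_lt1 R) a1 m1 f G1 hf hG1 f1 G11.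
have [F2 [[hF2 F21] F2F1 F2G _]] := tP _ _ a1 a2 A3 F1 G2 hF1 hG2 F11 G21.
have [F3 [XF3 F3F1 F3F2 F31]] := tP _ _ (zero_lt1 R) a2 m2 F1 F2 hF1 hF2 F11 F21.
exists F3, n; split => // z zr; have z1 := le_lt_trans zr r1.
- have zr' : `‖mob 0 z‖ <= r by rewrite mob_zero.
  have := nc_trans_sub (F1 z) (F3 z) (f z).
  by have := F3F1 z z1 zr'; have := F1f z z1 zr'; lra.
- have p1 := (sp1 n).2 z z1.
  have pr := le_trans (selfmap_mob (sp1 n).1 (sp1 n).2 z1) zr.
  have := nc_trans_sub (F1 (phi1 n z)) (F3 (phi1 n z)) (g z).
  have := nc_trans_sub (G1 (phi1 n z)) (F1 (phi1 n z)) (g z).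
  have := G1P z zr; have := F1G _ p1 pr; have := F2F1 _ p1 pr.
  have := F31 _ p1; rewrite (nc_subC (F1 _) (F2 _)) /=; lra.
- have p1 := (sp2 n).2 z z1.
  have pr := le_trans (selfmap_mob (sp2 n).1 (sp2 n).2 z1) zr.
  have := nc_trans_sub (F2 (phi2 n z)) (F3 (phi2 n z)) (h z).
  have := nc_trans_sub (G2 (phi2 n z)) (F2 (phi2 n z)) (h z).
  by have := G2P z zr; have := F2G _ p1 pr; have := F3F2 _ p1 pr; rewrite /=; lra.
Qed.

End SufficiencyBounded.

Section UniversalityHolomorphic.
Variable R : realType.
Implicit Types (f g h phi : R[i] -> R[i]) (z w : R[i]) (r e d : R).
Variables (phi1 phi2 : nat -> R[i] -> R[i]).
Hypotheses (sp1 : forall n, selfmap (phi1 n)) (sp2 : forall n, selfmap (phi2 n)).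

Lemma nat_bound (u : nat -> R) N : exists M, forall n, (n < N)%N -> u n <= M.
Proof.
elim: N => [|N [M MP]]; first by exists 0.
exists (Num.max M (u N)) => n; rewrite ltnS leq_eqVlt => /predU1P[->|/MP h].
  by rewrite le_max lexx orbT.
by rewrite le_max h.
Qed.

(** Translates of the identity are approximated: the orbit is then injective
   by the Lipschitz estimate for the error, distinct translates make the images
   disjoint, and a large translation rules out small indices. *)
Lemma universal_HD_univalent :
  disj_universal_HD phi1 phi2 -> univalent_disjoint phi1 phi2.
Proof.
move=> /disjointly_universalP[f /HDP hf H].
suff freq r N : 0 <= r < 1 -> exists2 n, (N <= n)%N &
    [/\ forall z w, `‖z‖ <= r -> `‖w‖ <= r -> phi1 n z = phi1 n w -> z = w,
        forall z w, `‖z‖ <= r -> `‖w‖ <= r -> phi2 n z = phi2 n w -> z = w &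
        forall z w, `‖z‖ <= r -> `‖w‖ <= r -> phi1 n z <> phi2 n w].
  have rk k : 0 <= 1 - (2^-1 : R) ^+ k < 1.
    rewrite gtrBl exprn_gt0 ?invr_gt0 // subr_ge0 andbT.
    by rewrite exprn_ile1 ?invr_ge0 // invf_le1 // ler1n.
  have [s hs sP] := extract_subsequence (fun k N => freq _ N (rk k)).
  exists s => // K /disc_compacts_sub[r /andP[_ r1] Kr].
  have r1' : 0 < 1 - r by rewrite subr_gt0.
  have [k0 k0P] := half_pow_small r1'; exists k0 => k /k0P hk.
  have Kk z : K z -> `‖z‖ <= 1 - 2^-1 ^+ k by move=> /Kr; lra.
  have [i1 i2 i3] := sP k; split.
  - by move=> z w /set_mem Kz /set_mem Kw; apply: i1; exact: Kk.
  - by move=> z w /set_mem Kz /set_mem Kw; apply: i2; exact: Kk.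
  - apply/seteqP; split => // y [[z Kz zy] [w Kw wy]].
    by case: (i3 z w); rewrite ?Kk // zy wy.
move=> /andP[r0 r1]; have [s rs s1] := between r1.
have s0 := le_lt_trans r0 rs.
have [C C0 CP] := lipschitz_bound rs s0 s1.
have [M MP] := nat_bound (fun n => `‖f (phi1 n 0)‖) N.
pose c := `|M| + 2.
pose e := Num.min (2 * C)^-1 4^-1.
have e0 : 0 < e by rewrite lt_min !invr_gt0 mulr_gt0 ?ltr0n.
have eC : C * e <= 2^-1.
  have : e <= (2 * C)^-1 by rewrite ge_min lexx.
  move=> /(ler_wpM2l (ltW C0)) /le_trans; apply.
  by rewrite invfM mulrCA divff ?mulr1 // gt_eqF.
have e4 : e <= 4^-1 by rewrite ge_min lexx orbT.
have T (x : R) : HD ((fun z => z + x%:C) : disc_fun R).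
  by apply/HDP; apply: holoD; [exact: holo_id|exact: holo_cst].
have [n [N1 N2]] := H _ _ _ _ (T c) (T (c + 3)) s1 e0.
have inj (phi : R[i] -> R[i]) (x : R) : selfmap phi ->
    near_on s e (f \o phi) (fun z => z + x%:C) ->
    forall z w, `‖z‖ <= r -> `‖w‖ <= r -> phi z = phi w -> z = w.
  move=> [hp p1] A z w zr wr E.
  have hE : holo (fun z => (f \o phi) z - (z + x%:C)).
    apply: holoB; first exact: (holo_comp p1).
    by apply: holoD; [exact: holo_id|exact: holo_cst].
  have := CP _ _ hE A z w zr wr; rewrite /= E.
  rewrite (_ : _ - _ = w - z); last by ring.
  rewrite (nc_subC w z) => L; apply/eqP; rewrite -subr_eq0 -nc_eq0 eq_le nc_ge0 andbT.
  have := ler_wpM2r (nc_ge0 (z - w)) eC; lra.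
exists n; last split.
- rewrite leqNgt; apply/negP => /MP h.
  have z0s : `‖0 : R[i]‖ <= s by rewrite nc0 ltW.
  have := N1 0 z0s; rewrite /= add0r => h'.
  have := nc_sub_ge c%:C (f (phi1 n 0)); rewrite (nc_subC c%:C) nc_realp.
    by have := ler_norm M; move: h'; rewrite /c; lra.
  by rewrite /c addr_ge0.
- exact: inj N1.
- exact: inj N2.
- move=> z w zr wr E.
  have zs : `‖z‖ <= s by rewrite (le_trans zr) // ltW.
  have ws : `‖w‖ <= s by rewrite (le_trans wr) // ltW.
  have := N1 z zs; have := N2 w ws; rewrite /= -E => B A.
  have := nc_trans_sub (f (phi1 n z)) (w + (c + 3)%:C) (z + c%:C).
  rewrite (nc_subC _ (f _)).
  have -> : w + (c + 3)%:C - (z + c%:C) = 3%:C - (z - w).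
    by rewrite (rmorphD (real_complex R)) /=; ring.
  have := nc_sub_ge 3%:C (z - w); rewrite nc_realp //.
  by have := nc_sub_le z w; lra.
Qed.

Lemma holo_horner (p : {poly R[i]}) : holo (fun z => p.[z]).
Proof.
elim/poly_ind: p => [|p c IH].
  rewrite (_ : (fun _ => _) = fun=> 0); first exact: holo_cst.
  by apply/funext => z; rewrite horner0.
rewrite (_ : (fun _ => _) = fun z => p.[z] * z + c); last first.
  by apply/funext => z; rewrite hornerMXaddC.
by apply: holoD; [apply: holoM => //; exact: holo_id|exact: holo_cst].
Qed.

Hypotheses (esc1 : tends1 (fun n => `‖phi1 n 0‖)) (esc2 : tends1 (fun n => `‖phi2 n 0‖)).

(** Runge approximation on three disjoint conformal discs: the disc itself and
   its images under phi1 n and phi2 n, which have escaped to the boundary. *)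
Lemma univalent_universal_HD :
  univalent_disjoint phi1 phi2 -> disj_universal_HD phi1 phi2.
Proof.
move=> [s hs univ]; apply/disjointly_universalP.
have closed : uc_closed (@holo R).
  move=> f H; apply: holo_approx => r e r1 e0; have [g hg fg] := H r e r1 e0.
  by exists g.
have hid f : holo f -> holo f by [].
suff step : forall f g h r e, holo f -> holo g -> holo h -> 0 <= r < 1 -> 0 < e ->
    exists F n, [/\ holo F, near_on r e F f, near_on r e (F \o phi1 n) g &
                  near_on r e (F \o phi2 n) h].
  have [f hf fP] := universality hid closed sp1 sp2 step (@holo_cst R 0).
  by exists f; [exact/HDP|move=> g h r e /HDP hg /HDP hh; exact: fP].
move=> f g h r e hf hg hh /andP[r0 r1] e0.
have [t rt t1] := between r1.
have t01 : 0 <= t < 1 by rewrite t1 (le_trans r0) // ltW.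
have [d d0 dP] := selfmap_escape t01 t01.
have [K KP] := eventuallyI (univ _ (disc_compacts_cball t1))
  (eventuallyI (eventually_subsequence hs (esc1 d0))
               (eventually_subsequence hs (esc2 d0))).
have [[i1 i2 i3] [A1 A2]] := KP K (leqnn K).
move: (s K) i1 i2 i3 A1 A2 => n i1 i2 i3 A1 A2.
have far1 z w : `‖z‖ <= t -> `‖w‖ <= t -> phi1 n z <> w.
  move=> zt wt E; have := dP _ (sp1 n).1 (sp1 n).2 A1 z zt.
  by rewrite E ltNge wt.
have far2 z w : `‖z‖ <= t -> `‖w‖ <= t -> phi2 n z <> w.
  move=> zt wt E; have := dP _ (sp2 n).1 (sp2 n).2 A2 z zt.
  by rewrite E ltNge wt.
have far12 z w : `‖z‖ <= t -> `‖w‖ <= t -> phi1 n z <> phi2 n w.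
  move=> zt wt E; suff : set0 (phi1 n z) by [].
  by rewrite -i3; split; [exists z|exists w].
pose psi (i : option bool) := if i is Some b then (if b then phi1 n else phi2 n) else id.
pose tg (i : option bool) := if i is Some b then (if b then g else h) else f.
have [|||i j z w|p pP] := @runge_discs R _ psi tg r t e r0 rt (ltW t1) _ _ _ _ e0.
- by case=> [[]|]; [exact: (sp1 n).1|exact: (sp2 n).1|exact: holo_id].
- by case=> [[]|].
- case=> [[]|] z w /ltW zt /ltW wt //.
    by apply: i1; apply/mem_set.
  by apply: i2; apply/mem_set.
- move=> ij /ltW zt /ltW wt; case: i j ij => [[]|] [[]|] //= _ E.
  + exact: (far12 z w).
  + exact: (far1 z w).
  + exact: (far12 w z).
  + exact: (far2 z w).
  + exact: (far1 w z).
  + exact: (far2 w z).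
exists (fun z => p.[z]), n; split.
- exact: holo_horner.
- exact: (pP None).
- exact: (pP (Some true)).
- exact: (pP (Some false)).
Qed.

End UniversalityHolomorphic.

(** * Maps of bounded hyperbolic size escaping to the boundary *)

Section Shrinking.
Variable R : realType.
Implicit Types (z w : R[i]) (n k : nat).

Definition half_pow n : R := 2^-1 ^+ n.+1.

(** The image of the disc is the disc of radius h / 2 centred at distance h from
   the unit circle, where h tends to 0: the maps are injective with images near e,
   but those images keep a bounded hyperbolic size. *)
Definition shrinking (e : R[i]) n z : R[i] :=
  e * ((1 - half_pow n)%:C + (half_pow n / 2)%:C * z).

Lemma half_pow_gt0 n : 0 < half_pow n.
Proof. by rewrite exprn_gt0 // invr_gt0. Qed.

Lemma half_pow_le n : half_pow n <= 2^-1.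
Proof. by rewrite /half_pow exprS ler_piMr ?invr_ge0 // exprn_ile1 ?invr_ge0 // invf_le1 // ler1n. Qed.

Lemma shrinking_dist e n z : `‖e‖ = 1 -> `‖z‖ < 1 ->
  `‖shrinking e n z - e * (1 - half_pow n)%:C‖ < half_pow n / 2.
Proof.
move=> e1 z1; have h0 := half_pow_gt0 n.
have h2 : 0 < half_pow n / 2 by rewrite divr_gt0.
rewrite /shrinking mulrDr (addrC (e * _)) addrK !normcM e1 mul1r.
by rewrite nc_realp ?(ltW h2) // gtr_pMr.
Qed.

Lemma shrinking_selfmap e n : `‖e‖ = 1 -> selfmap (shrinking e n).
Proof.
move=> e1; split.
  apply: holoZ; apply: holoD; first exact: holo_cst.
  by apply: holoZ; exact: holo_id.
move=> z z1; have := shrinking_dist n e1 z1; have h0 := half_pow_gt0 n.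
have hl := half_pow_le n.
have := nc_sub_ge (shrinking e n z) (e * (1 - half_pow n)%:C).
by rewrite normcM e1 mul1r nc_realp; lra.
Qed.

Lemma shrinking_hyp0 e n : `‖e‖ = 1 -> hyp0 (shrinking e n) <= 3^-1.
Proof.
move=> e1; have h0 := half_pow_gt0 n; have hl := half_pow_le n.
have a0 : `‖shrinking e n 0‖ = 1 - half_pow n.
  by rewrite /shrinking mulr0 addr0 normcM e1 mul1r nc_realp //; lra.
have d0 : cder (shrinking e n) 0 (e * (half_pow n / 2)%:C).
  apply: cderZ; exact: cder_affine.
have h2 : 0 <= half_pow n / 2 by lra.
rewrite /hyp0 a0 (derive1_cder d0) normcM e1 mul1r nc_realp //.
rewrite ler_pdivrMr; nra.
Qed.

Lemma half_pow_small1 (d : R) : 0 < d -> exists K, forall n, (K <= n)%N -> half_pow n < d.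
Proof.
move=> d0; have [K KP] := half_pow_small d0; exists K => n /KP.
rewrite /half_pow exprS => h.
have : 0 < (2^-1 : R) ^+ n by rewrite exprn_gt0 // invr_gt0.
lra.
Qed.

Lemma shrinking_boundary e : `‖e‖ = 1 -> boundary_selfmaps (shrinking e) e.
Proof.
move=> e1; split.
- by move=> n; apply/holo_selfmapP; exact: shrinking_selfmap.
- by rewrite /unit_circle /= normCE e1.
apply/cvg_tendsP => d d0; have [K KP] := half_pow_small1 d0.
exists K => // n /KP h /=; have h0 := half_pow_gt0 n.
rewrite /shrinking mulr0 addr0 -[X in _ - X]mulr1 -mulrBr normcM e1 mul1r.
by rewrite nc_subC one_sub_real nc_realp subKr // ltW.
Qed.

Lemma shrinking_injective e n z w : `‖e‖ = 1 -> shrinking e n z = shrinking e n w -> z = w.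
Proof.
move=> e1; have e0 : e != 0 by rewrite -nc_gt0 e1.
have h2 : 0 < half_pow n / 2 by rewrite divr_gt0 // half_pow_gt0.
have hn : (half_pow n / 2)%:C != 0 :> R[i] by rewrite -nc_gt0 nc_realp ?ltW.
by rewrite /shrinking => /(mulfI e0) /addrI /(mulfI hn).
Qed.

Lemma shrinking_univalent : univalent_disjoint (shrinking 1) (shrinking (- 1)).
Proof.
have n1 : `‖1 : R[i]‖ = 1 by rewrite nc1.
have n2 : `‖- 1 : R[i]‖ = 1 by rewrite nc_opp nc1.
exists id => // K [_ KD]; exists 0%N => n _; split.
- by move=> z w _ _; exact: shrinking_injective.
- by move=> z w _ _; exact: shrinking_injective.
apply/seteqP; split => // y [[z /KD/unit_discE z1 zy] [w /KD/unit_discE w1 wy]].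
have := shrinking_dist n n1 z1; have := shrinking_dist n n2 w1.
rewrite zy wy mul1r mulN1r opprK => A B.
have h0 := half_pow_gt0 n; have hl := half_pow_le n.
have := nc_sub_le (y + (1 - half_pow n)%:C) (y - (1 - half_pow n)%:C).
rewrite (_ : _ - (_ - _) = (2 * (1 - half_pow n))%:C); last first.
  by rewrite (rmorphM (real_complex R)) /= (rmorph_nat (real_complex R)); ring.
by rewrite nc_realp; lra.
Qed.

Lemma shrinking_not_disjoint : ~ hyp_deriv_disjoint (shrinking 1) (shrinking (- 1)).
Proof.
have n1 : `‖1 : R[i]‖ = 1 by rewrite nc1.
have n2 : `‖- 1 : R[i]‖ = 1 by rewrite nc_opp nc1.
move=> /(hyp_deriv_disjointP (fun n => shrinking_selfmap n n1)
  (fun n => shrinking_selfmap n n2))[s _ [h1 _ _]].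
have d0 : 0 < 2^-1 :> R by rewrite invr_gt0.
have [K /(_ K (leqnn K))] := h1 _ d0.
by have := shrinking_hyp0 (s K) n1; lra.
Qed.

End Shrinking.

Theorem theorem5p1 (R : realType) :
  (forall (phi1 phi2 : nat -> R[i] -> R[i]) (a b : R[i]),
     boundary_selfmaps phi1 a -> boundary_selfmaps phi2 b ->
     [/\ disj_universal_BD phi1 phi2 <-> hyp_deriv_separated phi1 phi2,
         hyp_deriv_separated phi1 phi2 <-> hyp_deriv_disjoint phi1 phi2,
         hyp_deriv_disjoint phi1 phi2 -> univalent_disjoint phi1 phi2 &
         univalent_disjoint phi1 phi2 <-> disj_universal_HD phi1 phi2]) /\
  (exists (phi1 phi2 : nat -> R[i] -> R[i]) (a b : R[i]),
     [/\ boundary_selfmaps phi1 a, boundary_selfmaps phi2 b,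
         univalent_disjoint phi1 phi2 & ~ hyp_deriv_disjoint phi1 phi2]).
Proof.
split; last first.
  exists (@shrinking R 1), (@shrinking R (- 1)), 1, (- 1); split.
  - by apply: shrinking_boundary; rewrite nc1.
  - by apply: shrinking_boundary; rewrite nc_opp nc1.
  - exact: shrinking_univalent.
  - exact: shrinking_not_disjoint.
move=> phi1 phi2 a b B1 B2.
have sp1 n : selfmap (phi1 n) by have [/(_ n)/holo_selfmapP] := B1.
have sp2 n : selfmap (phi2 n) by have [/(_ n)/holo_selfmapP] := B2.
have esc1 : tends1 (fun n => normc (phi1 n 0)) by move=> d; exact: boundary_escape B1.
have esc2 : tends1 (fun n => normc (phi2 n 0)) by move=> d; exact: boundary_escape B2.
split.
- split; first exact: universal_BD_separated.
  exact: separated_universal_BD.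
- exact: separated_iff_disjoint.
- exact: disjoint_imp_univalent.
- split; first exact: univalent_universal_HD.
  exact: universal_HD_univalent.
Qed.
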